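(* Let $E$ be a directed graph. The nondegenerate representations of $\mathcal T\mathcal O(E)$ are in one-to-one correspondence with the families of operators $\{S_e\}_{e\in E^1_+}$ and $\{P_u\}_{u\in E^0}$ such that (i) the $\{S_e\}$ are partial isometries and the $\{P_u\}$ are projections, (ii) $u\ne v\implies P_uP_v=0$, (iii) $\sum P_u=1$ in the strong operator topology, (iv) $S_e^*S_e=P_{t(e)}$, (v) $P_u\ge\sum\{S_fS_f^*\mid o(f)=u\}$.
   Context: Representations and families of operators are on Hilbert spaces. Graphs. A graph $E$ consists of a set $E^0$ of vertices, a set $E^1$ of edges, maps $o,t:E^1\to E^0$, and a reversal $e\mapsto\overline e$ on $E^1$ with $\overline{\overline e}=e$, $\overline e\ne e$, $o(\overline e)=t(e)$. A directed graph is a graph with a subset $E^1_+\subseteq E^1$ containing exactly one edge from each pair $\{e,\overline e\}$. (No finiteness or countability assumptions.) In (v), $f$ ranges over $E^1_+$. A path is a finite or infinite sequence $e_1e_2\cdots$ of edges with $t(e_{i-1})=o(e_i)$ and $e_i\ne\overline{e_{i-1}}$ for $i>1$; vertices are paths of length $0$. It is directed if all $e_i\in E^1_+$ (length-zero paths are directed). $E^*$, $E^\infty$: finite, infinite paths; $E^*_+$, $E^\infty_+$: directed ones; $E^{**}=E^*\cup E^\infty$, $E^{**}_+=E^*_+\cup E^\infty_+$. For $v\in E^0$: $\Delta_1(v)=\{e\in E^1_+: o(e)=v\}$, $V(v)=\{t(p): p\in E^*_+, o(p)=v\}$, and for finite $F\subseteq\Delta_1(v)$, $V(v;F)=\{v\}\cup\bigcup_{e\in\Delta_1(v)\setminus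 F}V(t(e))$. Forests. A directed graph $T$ is a directed forest if between any two vertices there is at most one path in $T^*$. Let $\mathcal A(T)$ be the ring of subsets of $T^0$ consisting of finite disjoint unions of sets $V(v;F)$ and $\emptyset$, and $A(T)\subseteq\ell^\infty(T^0)$ the closed linear span of $\{\chi_B: B\in\mathcal A(T)\}$. Its spectrum $A(T)^\wedge$ is the set of $\mathcal A(T)$-ultrafilters, identified with $T^0\cup(T^\infty_+/\!\sim)$: $v\in T^0$ corresponds to $\{B: v\in B\}$, the class of $p=e_1e_2\cdots\in T^\infty_+$ to $\{B: V(o(e_j))\subseteq B\text{ for some }j\}$; $p\sim q$ iff some tail of $p$ equals some tail of $q$. Groupoids. $G(E)$ is the discrete groupoid $E^*$ with unit space $E^0$, $r(p)=o(p)$, $s(p)=t(p)$, $(e_1\cdots e_n)^{-1}=\overline{e_n}\cdots\overline{e_1}$, product = concatenation followed by cancellation of pairs $e\overline e$. $\widetilde E$ is the directed forest with vertices $E^*$, edges the pairs $(p,q)$ with $o(p)=o(q)$ and $p^{-1}q\in E^1$, directed when $p^{-1}q\in E^1_+$, $o(p,q)=p$, $t(p,q)=q$, $\overline{(p,q)}=(q,p)$. Let $\lambda(p)=o(p)$, extended to $A(\widetilde E)^\wedge$ ($\lambda$ is constant on components). $G(E)$ acts on $\widetilde E$ by left multiplication ($\alpha\cdot p$ defined when $s(\alpha)=\lambda(p)$), hence on $A(\widetilde E)^\wedge$. $G(E)*A(\widetilde E)^\wedge=\{(\alpha,x): s(\alpha)=\lambda(x)\}$ with relative product topology, $s(\alpha,x)=x$,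 $r(\alpha,x)=\alpha x$, $(\alpha,\beta x)(\beta,x)=(\alpha\beta,x)$; the unit space is identified with $A(\widetilde E)^\wedge$. For $x\in A(\widetilde E)^\wedge$: $\underline x=x$ if $x\in E^*$; if $x\in\widetilde E^\infty_+/\!\sim$, $\underline x=(p_0^{-1}p_1)(p_1^{-1}p_2)\cdots$ where $(p_0,p_1)(p_1,p_2)\cdots$ is the unique infinite path in $\widetilde E$ with $p_0=\lambda(x)$ having a tail in the class $x$. Let $X(E,\emptyset)=\{x\in A(\widetilde E)^\wedge:\underline x\in E^{**}_+\}$ (clopen). $\mathcal T\mathcal G(E)$ is the restriction of $G(E)*A(\widetilde E)^\wedge$ to $X(E,\emptyset)$, and $\mathcal T\mathcal O(E)=C^*(\mathcal T\mathcal G(E))$ (full groupoid $C^*$-algebra). *)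

(* Defs.v *)
From HB Require Import structures.
From mathcomp Require Import all_boot all_order all_algebra sesquilinear.
From mathcomp Require Import complex finmap.
From mathcomp Require Import all_classical all_reals all_analysis.

Set Implicit Arguments.
Unset Strict Implicit.
Unset Printing Implicit Defensive.

Import Order.TTheory GRing.Theory Num.Theory.
Import numFieldNormedType.Exports.

Local Open Scope classical_set_scope.
Local Open Scope ring_scope.

(* Serre-style graphs.  [dpos] is the set E^1_+; by [dpos_bar] it contains
   exactly one edge of each pair {e, ebar e}. *)
Record digraph := Digraph {
  vertex : choiceType;
  edge : choiceType;
  eo : edge -> vertex;
  et : edge -> vertex;
  ebar : edge -> edge;
  ebarK : involutive ebar;
  ebar_neq : forall e, ebar e != e;
  eo_bar : forall e, eo (ebar e) = et e;
  dpos : pred edge;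
  dpos_bar : forall e, dpos (ebar e) = ~~ dpos e }.

Definition pedge (E : digraph) := {e : edge E | dpos e}.
HB.instance Definition _ (E : digraph) := Choice.on (pedge E).

Section Paths.
Variable E : digraph.
Implicit Types (v : vertex E) (e : edge E) (s : seq (edge E)).

Fixpoint chain v s : bool :=
  if s is e :: s' then (eo e == v) && chain (et e) s' else true.

Definition reduced s := sorted (fun e f => f != ebar e) s.

(* A finite path is its origin together with its edges, so that the vertices
   are the pairs (v, [::]). *)
Definition gpath :=
  {p : vertex E * seq (edge E) | chain p.1 p.2 && reduced p.2}.
HB.instance Definition _ := Choice.on gpath.

Definition po (p : gpath) : vertex E := (val p).1.
Definition pe (p : gpath) : seq (edge E) := (val p).2.
Definition pt (p : gpath) : vertex E := last (po p) (map (@et E) (pe p)).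
Definition directed (p : gpath) : bool := all (@dpos E) (pe p).

Definition ipath (z : nat -> edge E) : Prop :=
  forall i, et (z i) = eo (z i.+1) /\ z i.+1 <> ebar (z i).
Definition idirected (z : nat -> edge E) : Prop := forall i, dpos (z i).
Definition tail_equiv (z w : nat -> edge E) : Prop :=
  exists m n, forall k, z (m + k)%N = w (n + k)%N.

Lemma path0_subproof v : chain v [::] && reduced [::]. Proof. by []. Qed.
Definition path0 v : gpath := Sub (v, [::]) (path0_subproof v).

Lemma path1_subproof e : chain (eo e) [:: e] && reduced [:: e].
Proof. by rewrite /= eqxx. Qed.
Definition path1 e : gpath := Sub (eo e, [:: e]) (path1_subproof e).

Definition Delta1 v : set (edge E) := [set e | dpos e /\ eo e = v].

Definition Vset v : set (vertex E) :=
  [set w | exists p, [/\ directed p, po p = v & pt p = w]].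

Definition VFset v (F : set (edge E)) : set (vertex E) :=
  [set v] `|` \bigcup_(e in Delta1 v `\` F) Vset (et e).

(* Finite disjoint unions of sets V(v;F), built one piece at a time. *)
Inductive ringA : set (set (vertex E)) :=
| ringA0 : ringA set0
| ringAU v F B : finite_set F -> F `<=` Delta1 v ->
    VFset v F `&` B = set0 -> ringA B -> ringA (VFset v F `|` B).

(* Proper filters of the ring, as order filters (downward directed and upward
   closed). *)
Record ringA_filter (x : set (set (vertex E))) : Prop := RingAFilter {
  rf_sub : x `<=` ringA;
  rf_neq0 : x !=set0;
  rf_proper : ~ x set0;
  rf_dir : forall B C, x B -> x C -> exists2 D, x D & D `<=` B `&` C;
  rf_up : forall B C, x B -> ringA C -> B `<=` C -> x C }.

Definition ringA_ultrafilter (x : set (set (vertex E))) : Prop :=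
  ringA_filter x /\ forall y, ringA_filter y -> x `<=` y -> y `<=` x.

(* The spectrum of A(T), with the topology generated by the sets of
   ultrafilters containing a given member of the ring. *)
Definition spectrum := set_type ringA_ultrafilter.
HB.instance Definition _ := Choice.on spectrum.
HB.instance Definition _ := isSubBaseTopological.Build spectrum
  ringA (fun B : set (vertex E) => [set x : spectrum | val x B]).

Definition vertex_uf v : set (set (vertex E)) := [set B | ringA B /\ B v].
Definition end_uf (z : nat -> edge E) : set (set (vertex E)) :=
  [set B | ringA B /\ exists j, Vset (eo (z j)) `<=` B].

End Paths.

Arguments path0 {E}.

Section PathGroupoid.
Variable E : digraph.
Implicit Types (v : vertex E) (e f : edge E) (s : seq (edge E)).
Implicit Types (p q r : gpath E).

Lemma et_bar e : et (ebar e) = eo e.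
Proof. by rewrite -eo_bar ebarK. Qed.

(* Left multiplication of a reduced word by one letter. *)
Definition push e s :=
  if s is f :: s' then if f == ebar e then s' else e :: s else [:: e].

(* Concatenation followed by cancellation; the letters of [s] are moved one by
   one, from the last to the first, to the front of the reduced word [t]. *)
Definition wmul s t := foldr push t s.
Definition winv s := rev (map (@ebar E) s).

Lemma reduced_cons e s :
  reduced (e :: s) = (if s is f :: _ then f != ebar e else true) && reduced s.
Proof. by case: s. Qed.

Lemma reduced_tl e s : reduced (e :: s) -> reduced s.
Proof. exact: path_sorted. Qed.

Lemma push_reduced e s : reduced s -> reduced (push e s).
Proof.
case: s => [|f s] //= rs; case: ifP => [_|/negbT fe].
  exact: reduced_tl rs.
by rewrite reduced_cons fe.
Qed.

Lemma push_chain e s : chain (et e) s -> chain (eo e) (push e s).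
Proof.
case: s => [|f s] /=; first by rewrite eqxx.
case: ifP => [/eqP ->|_] /=; first by rewrite et_bar => /andP[].
by rewrite eqxx.
Qed.

Lemma push_cons e s : reduced (e :: s) -> push e s = e :: s.
Proof. by case: s => [|f s] //= /andP[/negbTE ->]. Qed.

Lemma pushK e s : reduced s -> push (ebar e) (push e s) = s.
Proof.
case: s => [|f s] rs /=; first by rewrite ebarK eqxx.
case: ifP => [/eqP fe|_] /=; last by rewrite ebarK eqxx.
by rewrite fe in rs *; rewrite push_cons.
Qed.

Lemma pushKV e s : reduced s -> push e (push (ebar e) s) = s.
Proof. by move=> rs; rewrite -{1}[e]ebarK pushK. Qed.

Lemma wmul_reduced s t : reduced t -> reduced (wmul s t).
Proof. by move=> rt; elim: s => //= e s; exact: push_reduced. Qed.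

Lemma wmul_chain v s t : chain v s -> chain (last v (map (@et E) s)) t ->
  chain v (wmul s t).
Proof.
elim: s v => //= e s IH v /andP[/eqP <- cs] ct.
by apply: push_chain; exact: IH.
Qed.

Lemma wmul_push e s t : reduced s -> reduced t ->
  wmul (push e s) t = push e (wmul s t).
Proof.
case: s => [|f s] //= rs rt; case: ifP => [/eqP ->|_] //=.
by rewrite pushKV ?wmul_reduced.
Qed.

Lemma wmulA s t u : reduced t -> reduced u ->
  wmul (wmul s t) u = wmul s (wmul t u).
Proof.
by move=> rt ru; elim: s => //= e s <-; rewrite wmul_push ?wmul_reduced.
Qed.

Lemma wmul0 s : reduced s -> wmul s [::] = s.
Proof.
elim: s => //= e s IH rs; rewrite IH ?push_cons //.
exact: reduced_tl rs.
Qed.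

Lemma wmulV s : wmul (winv s) s = [::].
Proof.
rewrite /winv; elim: s => //= e s IH.
by rewrite rev_cons /wmul foldr_rcons /= ebarK eqxx.
Qed.

Lemma winvK : involutive winv.
Proof.
move=> s; rewrite /winv map_rev revK -map_comp -[RHS]map_id.
by apply: eq_map => e /=; rewrite ebarK.
Qed.

Lemma winv_reduced s : reduced s -> reduced (winv s).
Proof.
rewrite /reduced /winv rev_sorted sorted_map; apply: sub_sorted => e f /=.
by rewrite ebarK eq_sym.
Qed.

Lemma chain_cat v s t :
  chain v (s ++ t) = chain v s && chain (last v (map (@et E) s)) t.
Proof. by elim: s v => //= e s IH v; rewrite IH andbA. Qed.

Lemma winv_chain v s : chain v s -> 
  chain (last v (map (@et E) s)) (winv s) /\
  last (last v (map (@et E) s)) (map (@et E) (winv s)) = v.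
Proof.
elim: s v => //= e s IH v /andP[/eqP <- /IH[cs ls]].
rewrite /winv /= rev_cons -cats1 chain_cat cs ls /= eo_bar eqxx.
by rewrite map_cat last_cat /= et_bar.
Qed.

Lemma last_push e s : chain (et e) s ->
  last (eo e) (map (@et E) (push e s)) = last (et e) (map (@et E) s).
Proof.
case: s => [|f s] //=; case: ifP => [/eqP -> /=|//].
by rewrite et_bar.
Qed.

Lemma last_wmul v s t : chain v s -> chain (last v (map (@et E) s)) t ->
  last v (map (@et E) (wmul s t)) =
  last (last v (map (@et E) s)) (map (@et E) t).
Proof.
elim: s v => //= e s IH v /andP[/eqP <- cs] ct.
by rewrite last_push ?wmul_chain // IH.
Qed.

Lemma pe_reduced p : reduced (pe p).
Proof. by case/andP: (valP p). Qed.
Lemma pe_chain p : chain (po p) (pe p).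
Proof. by case/andP: (valP p). Qed.

Lemma gpath_ext p q : po p = po q -> pe p = pe q -> p = q.
Proof.
move=> pq epq; apply: val_inj; rewrite [LHS]surjective_pairing.
by rewrite [RHS]surjective_pairing; congr pair.
Qed.

(* The product is meaningful when [pt p = po q]; it is [p] otherwise. *)
Definition pmul p q : gpath E := insubd p (po p, wmul (pe p) (pe q)).

Lemma pmulE p q : pt p = po q ->
  (po (pmul p q) = po p) * (pe (pmul p q) = wmul (pe p) (pe q)).
Proof.
move=> pq; rewrite /pmul /po /pe insubdK //= -/(po p) -/(pe p) -/(pe q).
rewrite unfold_in /= wmul_chain ?wmul_reduced ?pe_reduced ?pe_chain //.
by rewrite -/(pt p) pq pe_chain.
Qed.

Lemma pt_pmul p q : pt p = po q -> pt (pmul p q) = pt q.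
Proof.
move=> pq; rewrite {1}/pt !(pmulE pq) last_wmul ?pe_chain -/(pt p) ?pq //.
exact: pe_chain.
Qed.

Lemma pinv_subproof p : let q := (pt p, winv (pe p)) in
  chain q.1 q.2 && reduced q.2.
Proof.
by rewrite /= winv_reduced ?pe_reduced // (winv_chain (pe_chain p)).1.
Qed.
Definition pinv p : gpath E := Sub (pt p, winv (pe p)) (pinv_subproof p).

Lemma po_pinv p : po (pinv p) = pt p. Proof. by []. Qed.
Lemma pe_pinv p : pe (pinv p) = winv (pe p). Proof. by []. Qed.
Lemma pt_pinv p : pt (pinv p) = po p.
Proof. exact: (winv_chain (pe_chain p)).2. Qed.
Lemma pinvK p : pinv (pinv p) = p.
Proof.
by apply: gpath_ext; rewrite ?po_pinv ?pt_pinv // !pe_pinv winvK.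
Qed.

Lemma pmulA p q r : pt p = po q -> pt q = po r ->
  pmul (pmul p q) r = pmul p (pmul q r).
Proof.
move=> pq qr; have pqr : pt (pmul p q) = po r by rewrite pt_pmul.
have pqr' : pt p = po (pmul q r) by rewrite (pmulE qr).
apply: gpath_ext; rewrite ?(pmulE pqr, pmulE pqr', pmulE pq, pmulE qr) //.
by rewrite wmulA ?pe_reduced.
Qed.

Lemma pmulV p : pmul (pinv p) p = path0 (pt p).
Proof.
have pp := pt_pinv p.
by apply: gpath_ext; rewrite !(pmulE pp) //= wmulV.
Qed.

Lemma pmulVr p : pmul p (pinv p) = path0 (po p).
Proof. by rewrite -{1}(pinvK p) pmulV pt_pinv. Qed.

Lemma pmul0p p : pmul (path0 (po p)) p = p.
Proof.
have pp : pt (path0 (po p)) = po p by [].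
by apply: gpath_ext; rewrite !(pmulE pp).
Qed.

Lemma pmulp0 p : pmul p (path0 (pt p)) = p.
Proof.
have pp : pt p = po (path0 (pt p)) by [].
by apply: gpath_ext; rewrite !(pmulE pp) //= wmul0 ?pe_reduced.
Qed.

Lemma pmulKV p q : po p = po q -> pmul p (pmul (pinv p) q) = q.
Proof.
by move=> pq; rewrite -pmulA ?pt_pinv // pmulVr pq pmul0p.
Qed.

Lemma pmulK p q : pt p = po q -> pmul (pinv p) (pmul p q) = q.
Proof. by move=> pq; rewrite -{2}(pinvK p) pmulKV. Qed.

Lemma pinv_pmul p q : pt p = po q -> pinv (pmul p q) = pmul (pinv q) (pinv p).
Proof.
move=> pq; have qp : pt (pinv q) = po (pinv p) by rewrite pt_pinv.
rewrite -[RHS]pmulp0 pt_pmul // pt_pinv -(pmulE pq).1 -pmulVr -pmulA //; last first.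
  by rewrite pt_pmul // pt_pinv (pmulE pq).
suff -> : pmul (pmul (pinv q) (pinv p)) (pmul p q) = path0 (pt (pmul p q)).
  by rewrite -[pt _]po_pinv pmul0p.
by rewrite pmulA ?pt_pinv ?(pmulE pq) // pmulK // pmulV pt_pmul.
Qed.

End PathGroupoid.

Section Cover.
Variable E : digraph.
Implicit Types (p q : gpath E) (x y : gpath E * gpath E).

(* The forest of paths of E: its vertices are the finite paths of E, and its
   edges are the pairs (p, q) with the same origin such that p^{-1}q is a path of
   length one. *)
Definition cedge_pred x : bool :=
  (po x.1 == po x.2) && (size (pe (pmul (pinv x.1) x.2)) == 1%N).
Definition cedge := {x : gpath E * gpath E | cedge_pred x}.
HB.instance Definition _ := Choice.on cedge.

Definition co (a : cedge) : gpath E := (val a).1.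
Definition ct (a : cedge) : gpath E := (val a).2.
(* p^{-1}q for the edge (p,q) *)
Definition clabel (a : cedge) : gpath E := pmul (pinv (co a)) (ct a).

Lemma cedge_po a : po (co a) = po (ct a).
Proof. by case/andP: (valP a) => /eqP. Qed.

Lemma clabel_swap p q : po p = po q ->
  pmul (pinv q) p = pinv (pmul (pinv p) q).
Proof. by move=> pq; rewrite pinv_pmul ?pt_pinv // pinvK. Qed.

Lemma cbar_subproof (a : cedge) : cedge_pred (ct a, co a).
Proof.
have pq := cedge_po a; rewrite /cedge_pred /= -pq eqxx /= clabel_swap //.
rewrite pe_pinv /winv size_rev size_map.
by move: (valP a) => /andP[].
Qed.
Definition cbar (a : cedge) : cedge := Sub (ct a, co a) (cbar_subproof a).

Lemma cbarK : involutive cbar.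
Proof. by move=> a; apply: val_inj; rewrite /= /co /ct /= -surjective_pairing. Qed.

Lemma cbar_neq a : cbar a != a.
Proof.
apply/eqP => ab; have qp : ct a = co a by exact: (congr1 co ab).
by case/andP: (valP a); rewrite -/(co a) -/(ct a) qp pmulV.
Qed.

Lemma co_bar a : co (cbar a) = ct a. Proof. by []. Qed.

Definition cpos (a : cedge) : bool := directed (clabel a).

Lemma cpos_bar a : cpos (cbar a) = ~~ cpos a.
Proof.
rewrite /cpos /clabel /= clabel_swap ?cedge_po // -/(clabel a).
have : size (pe (clabel a)) = 1%N by move: (valP a) => /andP[_ /eqP].
rewrite /directed pe_pinv; case: (pe _) => [|e []] //= _.
by rewrite !andbT dpos_bar.
Qed.

Definition ucover : digraph :=
  Digraph cbarK cbar_neq co_bar cpos_bar.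
End Cover.

Record groupoid := Groupoid {
  garr :> topologicalType;
  gunit : Type;
  gsrc : garr -> gunit;
  grng : garr -> gunit;
  gid : gunit -> garr;
  gmul : garr -> garr -> garr;  (* meaningful when gsrc a = grng b *)
  ginv : garr -> garr;
  gsrc_id : forall u, gsrc (gid u) = u;
  grng_id : forall u, grng (gid u) = u;
  gsrc_mul : forall a b, gsrc a = grng b -> gsrc (gmul a b) = gsrc b;
  grng_mul : forall a b, gsrc a = grng b -> grng (gmul a b) = grng a;
  gmulA : forall a b c, gsrc a = grng b -> gsrc b = grng c ->
    gmul (gmul a b) c = gmul a (gmul b c);
  gmul_id : forall a, gmul a (gid (gsrc a)) = a;
  gid_mul : forall a, gmul (gid (grng a)) a = a;
  gsrc_inv : forall a, gsrc (ginv a) = grng a;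
  grng_inv : forall a, grng (ginv a) = gsrc a;
  ginv_mul : forall a, gmul (ginv a) a = gid (gsrc a);
  gmul_inv : forall a, gmul a (ginv a) = gid (grng a) }.

Definition path_groupoid (E : digraph) : groupoid :=
  @Groupoid (discrete_topology (gpath E)) (vertex E)
    (@pt E) (@po E) path0 (@pmul E) (@pinv E)
    (fun _ => erefl) (fun _ => erefl) (@pt_pmul E)
    (fun p q pq => (pmulE pq).1) (@pmulA E) (@pmulp0 E) (@pmul0p E)
    (@pt_pinv E) (@po_pinv E) (@pmulV E) (@pmulVr E).

Definition set_elt {T : Type} {A : set T} (t : T) (h : A t) : set_type A :=
  exist (fun x => x \in A) t (mem_set h).

Section Restriction.
Variables (G : groupoid) (X : set (gunit G)).

Definition restr_arr : set G := [set a | X (gsrc a) /\ X (grng a)].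

Let resP (a : restr_arr) : X (gsrc (val a)) /\ X (grng (val a)).
Proof. exact: (set_valP a). Qed.

Let unit_ext (u v : X) : val u = val v -> u = v.
Proof. exact: val_inj. Qed.

Let arr_ext (a b : restr_arr) : val a = val b -> a = b.
Proof. exact: val_inj. Qed.

Definition restr_src (a : restr_arr) : X := set_elt (resP a).1.
Definition restr_rng (a : restr_arr) : X := set_elt (resP a).2.

Lemma restr_id_subproof (u : X) :
  X (gsrc (gid (val u))) /\ X (grng (gid (val u))).
Proof. by rewrite gsrc_id grng_id; split; exact: (set_valP u). Qed.
Definition restr_id (u : X) : restr_arr :=
  @set_elt _ restr_arr _ (restr_id_subproof u).

Lemma restr_inv_subproof (a : restr_arr) :
  X (gsrc (ginv (val a))) /\ X (grng (ginv (val a))).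
Proof. by rewrite gsrc_inv grng_inv; case: (resP a). Qed.
Definition restr_inv (a : restr_arr) : restr_arr :=
  @set_elt _ restr_arr _ (restr_inv_subproof a).

Definition restr_mul (a b : restr_arr) : restr_arr :=
  insubd a (gmul (val a) (val b)).

Let src_val a b : restr_src a = restr_rng b -> gsrc (val a) = grng (val b).
Proof. by move=> /(congr1 val). Qed.

Lemma val_restr_mul a b : restr_src a = restr_rng b ->
  val (restr_mul a b) = gmul (val a) (val b).
Proof.
move=> /src_val ab; rewrite /restr_mul; apply: insubdK; apply: mem_set => /=.
by split; [rewrite gsrc_mul //; case: (resP b)
          |rewrite grng_mul //; case: (resP a)].
Qed.

Lemma restr_src_id u : restr_src (restr_id u) = u.
Proof. by apply: unit_ext; rewrite /= gsrc_id. Qed.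

Lemma restr_rng_id u : restr_rng (restr_id u) = u.
Proof. by apply: unit_ext; rewrite /= grng_id. Qed.

Lemma restr_src_mul a b : restr_src a = restr_rng b ->
  restr_src (restr_mul a b) = restr_src b.
Proof.
move=> ab; apply: unit_ext; rewrite [LHS]/= val_restr_mul //.
by rewrite gsrc_mul //; exact: src_val.
Qed.

Lemma restr_rng_mul a b : restr_src a = restr_rng b ->
  restr_rng (restr_mul a b) = restr_rng a.
Proof.
move=> ab; apply: unit_ext; rewrite [LHS]/= val_restr_mul //.
by rewrite grng_mul //; exact: src_val.
Qed.

Lemma restr_mulA a b c :
  restr_src a = restr_rng b -> restr_src b = restr_rng c ->
  restr_mul (restr_mul a b) c = restr_mul a (restr_mul b c).
Proof.
move=> ab bc; apply: arr_ext.
rewrite val_restr_mul ?restr_src_mul // val_restr_mul //.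
rewrite val_restr_mul ?restr_rng_mul // val_restr_mul //.
by apply: gmulA; exact: src_val.
Qed.

Lemma restr_src_inv a : restr_src (restr_inv a) = restr_rng a.
Proof. by apply: unit_ext; rewrite /= gsrc_inv. Qed.

Lemma restr_rng_inv a : restr_rng (restr_inv a) = restr_src a.
Proof. by apply: unit_ext; rewrite /= grng_inv. Qed.

Lemma restr_mul_id a : restr_mul a (restr_id (restr_src a)) = a.
Proof. by apply: arr_ext; rewrite val_restr_mul ?restr_rng_id //= gmul_id. Qed.

Lemma restr_id_mul a : restr_mul (restr_id (restr_rng a)) a = a.
Proof. by apply: arr_ext; rewrite val_restr_mul ?restr_src_id //= gid_mul. Qed.

Lemma restr_inv_mul a : restr_mul (restr_inv a) a = restr_id (restr_src a).
Proof.
by apply: arr_ext; rewrite val_restr_mul ?restr_src_inv //= ginv_mul.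
Qed.

Lemma restr_mul_inv a : restr_mul a (restr_inv a) = restr_id (restr_rng a).
Proof.
by apply: arr_ext; rewrite val_restr_mul ?restr_rng_inv //= gmul_inv.
Qed.

Definition restriction : groupoid :=
  Groupoid restr_src_id restr_rng_id restr_src_mul restr_rng_mul restr_mulA
    restr_mul_id restr_id_mul restr_src_inv restr_rng_inv
    restr_inv_mul restr_mul_inv.
End Restriction.

Section Action.
Variable E : digraph.
Local Notation T := (ucover E).
Implicit Types (a b p q : gpath E) (v : vertex E) (B C : set (gpath E)).
Implicit Types (x y : set (set (gpath E))).

(* The inverse image of C under p |-> a p. *)
Definition lpre a C : set (gpath E) := [set p | pt a = po p /\ C (pmul a p)].

(* The action of a on (ultra)filters of the ring of subsets of the vertex set
   of the cover. *)
Definition act a x : set (set (gpath E)) :=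
  [set C | @ringA T C /\ x (lpre a C)].

(* lambda(x) = v: the function p |-> po p is locally constant on the vertices of
   the cover, and its continuous extension takes the value v at x exactly when
   x contains a set on which it is constantly v. *)
Definition lies_over x v : Prop :=
  exists2 B, x B & B `<=` [set p | po p = v].

Let lmul_label a p q : pt a = po p -> po p = po q ->
  pmul (pinv (pmul a p)) (pmul a q) = pmul (pinv p) q.
Proof.
move=> ap pq; have aq : pt a = po q by rewrite -pq.
rewrite pinv_pmul // pmulA ?pt_pinv ?(pmulE aq) //.
by rewrite pmulK.
Qed.

Let ledge a (e : edge T) : edge T := insubd e (pmul a (co e), pmul a (ct e)).

Let val_ledge a (e : edge T) : pt a = po (co e) ->
  val (ledge a e) = (pmul a (co e), pmul a (ct e)).
Proof.
move=> ae; have ae' : pt a = po (ct e) by rewrite -cedge_po.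
apply: insubdK; rewrite unfold_in /cedge_pred /= !(pmulE ae) !(pmulE ae') eqxx.
by rewrite lmul_label ?cedge_po //; case/andP: (valP e).
Qed.

Let eo_ledge a (e : edge T) : pt a = po (eo e) -> eo (ledge a e) = pmul a (eo e).
Proof. by move=> ae; rewrite [LHS]/= /co val_ledge. Qed.

Let et_ledge a (e : edge T) : pt a = po (eo e) -> et (ledge a e) = pmul a (et e).
Proof. by move=> ae; rewrite [LHS]/= /ct val_ledge. Qed.

Let dpos_ledge a (e : edge T) : pt a = po (eo e) -> dpos (ledge a e) = dpos e.
Proof.
move=> ae; rewrite /= /cpos /clabel -[co _]/(eo (ledge a e)).
rewrite -[ct (ledge _ _)]/(et (ledge a e)) eo_ledge // et_ledge //.
by rewrite lmul_label // [LHS]/= cedge_po.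
Qed.

Let po_edge (e : edge T) : po (et e) = po (eo e).
Proof. by rewrite /= cedge_po. Qed.

Let directed_reduced (s : seq (edge T)) : all (@dpos T) s -> reduced s.
Proof.
elim: s => // e s IH /andP[de ds]; rewrite reduced_cons IH // andbT.
case: s ds {IH} => // f s /andP[df _].
by apply: contraTneq df => ->; rewrite dpos_bar de.
Qed.

Let chain_po (s : seq (edge T)) p : @chain T p s ->
  po (last p (map (@et T) s)) = po p.
Proof.
elim: s p => // e s IH p /andP[/eqP <- cs] /=.
by rewrite (IH _ cs) po_edge.
Qed.

Let Vset_po p q : @Vset T p q -> po q = po p.
Proof. by move=> [w [_ <- <-]]; rewrite chain_po // pe_chain. Qed.

Let chain_ledge a (s : seq (edge T)) p : pt a = po p -> @chain T p s ->
  all (@dpos T) s ->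
  [/\ @chain T (pmul a p) (map (ledge a) s), all (@dpos T) (map (ledge a) s) &
      last (pmul a p) (map (@et T) (map (ledge a) s)) =
      pmul a (last p (map (@et T) s))].
Proof.
elim: s p => [//|e s IH p ap /andP[/eqP ep cs] /andP[de ds]].
rewrite -ep in ap *; have aet : pt a = po (et e) by rewrite po_edge.
have [h1 h2 h3] := IH _ aet cs ds.
rewrite !map_cons /= in h1 h2 h3 *; rewrite -[co (ledge _ _)]/(eo (ledge a e)).
rewrite -[ct (ledge _ _)]/(et (ledge a e)) eo_ledge // et_ledge //.
by rewrite eqxx h1 -[cpos _]/(dpos (ledge a e)) dpos_ledge // h2 de; split.
Qed.

Let Vset_lmul a p q : pt a = po p -> @Vset T p q ->
  @Vset T (pmul a p) (pmul a q).
Proof.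
move=> ap [w [dw pw qw]].
have cw := pe_chain w; rewrite pw in cw.
have [h1 h2 h3] := chain_ledge ap cw dw.
have h : @chain T (pmul a p) (map (ledge a) (pe w)) &&
         reduced (map (ledge a) (pe w)) by rewrite h1 directed_reduced.
exists (exist _ (pmul a p, map (ledge a) (pe w)) h); split => //.
by rewrite /pt /= h3 -pw -/(pt w) qw.
Qed.

Let Vset_lpre a p : po p = po a -> lpre a (@Vset T p) = @Vset T (pmul (pinv a) p).
Proof.
move=> pa; have ap : pt (pinv a) = po p by rewrite pt_pinv.
apply/seteqP; split=> q /=.
  by move=> [aq Vq]; rewrite -[q](@pmulK _ a) //; exact: Vset_lmul.
move=> Vq; have aq : pt a = po q by rewrite (Vset_po Vq) (pmulE ap).
split=> //; have := Vset_lmul (a := a) _ Vq.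
by rewrite pmulKV //; apply; rewrite (pmulE ap).
Qed.

Let VFset_lpre a p F : po p = po a -> F `<=` @Delta1 T p ->
  let p' := pmul (pinv a) p in let F' := ledge (pinv a) @` F in
  F' `<=` @Delta1 T p' /\ lpre a (@VFset T p F) = @VFset T p' F'.
Proof.
move=> pa FD p' F'; have ap : pt (pinv a) = po p by rewrite pt_pinv.
have ap' : pt a = po p' by rewrite (pmulE ap).
have led (e : edge T) : @Delta1 T p e -> @Delta1 T p' (ledge (pinv a) e).
  move=> [de ep]; have ae : pt (pinv a) = po (eo e) by rewrite ep.
  by split; [rewrite dpos_ledge|rewrite eo_ledge // ep].
have led' (e : edge T) : @Delta1 T p' e -> @Delta1 T p (ledge a e).
  move=> [de ep]; have ae : pt a = po (eo e) by rewrite ep.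
  by split; [rewrite dpos_ledge|rewrite eo_ledge // ep pmulKV].
have ledK (e : edge T) : @Delta1 T p' e -> ledge (pinv a) (ledge a e) = e.
  move=> De; have [de ep] := De; have [de' ep'] := led' e De.
  have ae : pt a = po (eo e) by rewrite ep.
  apply: val_inj; rewrite val_ledge; last by rewrite -[co _]/(eo (ledge a e)) ep' ap.
  rewrite -[co _]/(eo (ledge a e)) -[ct _]/(et (ledge a e)) eo_ledge // et_ledge //.
  by rewrite pmulK // pmulK ?po_edge // [RHS]surjective_pairing.
have ledKV (e : edge T) : @Delta1 T p e -> ledge a (ledge (pinv a) e) = e.
  move=> De; have [de ep] := De; have [de' ep'] := led e De.
  have ae : pt (pinv a) = po (eo e) by rewrite ep.
  have ea : po a = po (eo e) by rewrite ep.
  apply: val_inj; rewrite val_ledge; last first.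
    by rewrite -[co _]/(eo (ledge (pinv a) e)) ep' ap'.
  rewrite -[co _]/(eo (ledge (pinv a) e)) -[ct _]/(et (ledge (pinv a) e)).
  rewrite eo_ledge // et_ledge // pmulKV // pmulKV ?po_edge //.
  by rewrite [RHS]surjective_pairing.
split; first by move=> _ [e Fe <-]; apply: led; exact: FD.
apply/seteqP; split=> q /=.
  move=> [aq []]; first by move=> /= apq; left; rewrite /= /p' -apq pmulK.
  move=> [e [De nFe] Vq]; right.
  exists (ledge (pinv a) e).
    split; first exact: led.
    move=> [f Ff fe]; apply: nFe.
    by rewrite -(ledKV e De) -fe ledKV //; exact: FD.
  have ae : po (et e) = po a by rewrite po_edge De.2.
  rewrite et_ledge ?De.2 // -Vset_lpre //.
move=> [/= ->|[e [De nFe] Vq]].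
  by split=> //; left; rewrite /= /p' pmulKV.
have ae : pt a = po (eo e) by rewrite De.2.
have aq : pt a = po q by rewrite (Vset_po Vq) po_edge.
split=> //; right; exists (ledge a e).
  split; first exact: led'.
  by move=> Fe; apply: nFe; exists (ledge a e) => //; exact: ledK.
by rewrite et_ledge //; apply: Vset_lmul => //; rewrite po_edge.
Qed.

Let VFset_po p F q : @VFset T p F q -> po q = po p.
Proof.
case=> [-> //|[e [[_ <-] _] /Vset_po ->]]; exact: po_edge.
Qed.

Lemma ringA_lpre a C : @ringA T C -> @ringA T (lpre a C).
Proof.
elim=> [|p F B finF FD FB _ IH].
  suff -> : lpre a set0 = set0 by exact: ringA0.
  by apply/seteqP; split=> // q [].
have -> : lpre a (@VFset T p F `|` B) = lpre a (@VFset T p F) `|` lpre a B.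
  apply/seteqP; split=> q.
    by move=> [aq [h|h]]; [left|right].
  by move=> [[aq h]|[aq h]]; split=> //; [left|right].
have [pa|pa] := eqVneq (po p) (po a).
  have [F'D VF'] := VFset_lpre pa FD.
  rewrite VF'; apply: ringAU => //; first exact: finite_image.
  rewrite -VF'; apply/seteqP; split=> // q [[aq h1] [_ h2]].
  by have : set0 (pmul a q) by rewrite -FB.
suff -> : lpre a (@VFset T p F) = set0 by rewrite set0U.
apply/seteqP; split=> // q [aq /VFset_po h]; case/eqP: pa.
by rewrite -h (pmulE aq).
Qed.

Let lpreK a C : lpre a (lpre (pinv a) C) = C `&` [set p | po p = pt a].
Proof.
apply/seteqP; split=> q /=.
  by move=> [aq [_]]; rewrite pmulK.
move=> [Cq qa]; have aq : pt a = po q by [].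
by split=> //; split; rewrite ?pt_pinv ?(pmulE aq) ?pmulK.
Qed.

Let lpreM a b C : pt a = po b ->
  lpre (pmul a b) C = lpre b (lpre a C).
Proof.
move=> ab; apply/seteqP; split=> q; rewrite /lpre /= pt_pmul //.
  by move=> [bq Cq]; rewrite (pmulE bq) -pmulA.
by move=> [bq [_ Cq]]; rewrite pmulA.
Qed.

Let lpreS a B C : B `<=` C -> lpre a B `<=` lpre a C.
Proof. by move=> BC p [ap /BC]. Qed.

Lemma act_comp a b x : pt a = po b -> act (pmul a b) x = act a (act b x).
Proof.
move=> ab; apply/seteqP; split=> C; rewrite /act /= lpreM //.
  by move=> [rC xC]; split=> //; split=> //; exact: ringA_lpre.
by move=> [rC [_ xC]].
Qed.

Lemma act_path0 v x : ringA_filter (E := T) x -> lies_over x v ->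
  act (path0 v) x = x.
Proof.
move=> Fx [B0 xB0 Bv]; have lpE C : lpre (path0 v) C = C `&` [set p | po p = v].
  apply/seteqP; split=> p /=.
    by move=> [vp]; rewrite [in path0 _](_ : v = po p) // pmul0p.
  by move=> [Cp vp]; split=> //; rewrite -vp pmul0p.
apply/seteqP; split=> C.
  by move=> [rC]; rewrite lpE => xC; apply: (rf_up Fx xC rC); apply: subIsetl.
move=> xC; split; first exact: (rf_sub Fx).
have [D xD DBC] := rf_dir Fx xB0 xC.
apply: (rf_up Fx xD); first by apply: ringA_lpre; exact: (rf_sub Fx).
by rewrite lpE => p /DBC[/Bv].
Qed.

Lemma act_filter a x : ringA_filter (E := T) x -> lies_over x (pt a) ->
  ringA_filter (E := T) (act a x) /\ lies_over (act a x) (po a).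
Proof.
move=> Fx [B0 xB0 Ba].
have img B : x B -> B `<=` [set p | po p = pt a] ->
    act a x (lpre (pinv a) B).
  move=> xB BD; split; first by apply: ringA_lpre; exact: (rf_sub Fx).
  rewrite lpreK (_ : _ `&` _ = B) //.
  by apply/seteqP; split=> [p []|p Bp] //; split=> //; exact: BD.
split; last first.
  exists (lpre (pinv a) B0); first exact: img.
  by move=> p [] /=; rewrite pt_pinv.
split.
- by move=> C [].
- by exists (lpre (pinv a) B0); exact: img.
- move=> [_ h]; apply: (rf_proper Fx); rewrite (_ : set0 = lpre a set0) //.
  by apply/seteqP; split=> // p [].
- move=> B C [rB xB] [rC xC].
  have [D xD DBC] := rf_dir Fx xB xC.
  have [D' xD' DD'] := rf_dir Fx xD xB0.
  exists (lpre (pinv a) D'); first by apply: img => // p /DD'[_ /Ba].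
  move=> p [pa /DD'[/DBC[[_ h1] [_ h2]] _]].
  by rewrite pmulKV ?pt_pinv // in h1 h2; rewrite pt_pinv in pa.
- move=> B C [rB xB] rC BC; split=> //.
  apply: (rf_up Fx xB); last exact: lpreS.
  exact: ringA_lpre.
Qed.

Lemma act_ultrafilter a x : ringA_ultrafilter (E := T) x ->
  lies_over x (pt a) -> ringA_ultrafilter (E := T) (act a x).
Proof.
move=> [Fx maxx] xa; have [Fax axa] := act_filter Fx xa.
split=> // y Fy axy.
have ya : lies_over y (pt (pinv a)).
  by rewrite pt_pinv; case: axa => B /axy yB Ba; exists B.
have [Fy' _] := act_filter Fy ya.
have xE : act (pinv a) (act a x) = x.
  by rewrite -act_comp ?pt_pinv // pmulV act_path0.
have yE : act a (act (pinv a) y) = y.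
  rewrite -act_comp // pmulVr act_path0 //.
  by rewrite pt_pinv in ya.
have xy : x `<=` act (pinv a) y.
  by rewrite -{1}xE => C [rC xC]; split=> //; exact: axy.
have yx := maxx _ Fy' xy.
by rewrite -yE => C [rC yC]; split=> //; exact: yx.
Qed.

Lemma ultrafilter_lies_over x : ringA_ultrafilter (E := T) x ->
  exists v, lies_over x v.
Proof.
move=> [Fx maxx]; have [B0 xB0] := rf_neq0 Fx.
have := rf_sub Fx xB0; move: xB0 => /[swap]; elim=> [/(rf_proper Fx)//|].
move=> p F B finF FD FB rB IH xB.
set U := _ `|` _ in xB.
pose D := [set q : gpath E | po q = po p].
have capD C : @ringA T C -> @ringA T (C `&` D).
  move=> rC; rewrite (_ : C `&` D = lpre (path0 (po p)) C); first exact: ringA_lpre.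
  apply/seteqP; split=> q /=.
    by move=> [Cq qp]; split=> //; rewrite -qp pmul0p.
  by move=> [qp]; rewrite [in path0 _](_ : po p = po q) // pmul0p.
have [[C xC CD]|nD] := pselect (exists2 C, x C & C `&` D = set0).
  apply: IH; have [C' xC' C'C] := rf_dir Fx xC xB.
  apply: (rf_up Fx xC' rB) => q C'q; have [Cq] := C'C q C'q.
  case=> // /VFset_po qp; suff : (C `&` D) q by rewrite CD.
  by split.
pose y := [set C | @ringA T C /\ exists2 C', x C' & C' `&` D `<=` C].
have Fy : ringA_filter (E := T) y.
  split.
  - by move=> C [].
  - exists (U `&` D); split; first by apply: capD; exact: (rf_sub Fx).
    by exists U.
  - move=> [_ [C xC CD]]; apply: nD; exists C => //.
    by apply/seteqP; split.
  - move=> C1 C2 [_ [C1' xC1' CD1]] [_ [C2' xC2' CD2]].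
    have [C xC CC] := rf_dir Fx xC1' xC2'.
    exists (C `&` D).
      by split; [apply: capD; exact: (rf_sub Fx)|exists C].
    by move=> q [/CC[h1 h2] Dq]; split; [apply: CD1|apply: CD2].
  - move=> C1 C2 [_ [C xC CD]] rC2 C12; split=> //; exists C => //.
    exact: subset_trans C12.
have xy : x `<=` y.
  by move=> C xC; split; [exact: (rf_sub Fx)|exists C => // q []].
have yB : y (U `&` D).
  by split; [apply: capD; exact: (rf_sub Fx)|exists U].
by exists (po p), (U `&` D); [exact: maxx yB|move=> q []].
Qed.

Lemma lies_over_inj x v w : ringA_filter (E := T) x ->
  lies_over x v -> lies_over x w -> v = w.
Proof.
move=> Fx [B xB Bv] [C xC Cw]; have [D xD DBC] := rf_dir Fx xB xC.
have [D0|/set0P[q /DBC[/Bv <- /Cw <-]]//] := eqVneq D set0.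
by case: (rf_proper Fx); rewrite -D0.
Qed.

Implicit Types (X Y : spectrum T).

Let spec_filter X : ringA_filter (val X).
Proof. exact: (set_valP X).1. Qed.

Definition lam X : vertex E := sval (cid (ultrafilter_lies_over (set_valP X))).

Lemma lamP X : lies_over (val X) (lam X).
Proof. by rewrite /lam; case: cid. Qed.

Lemma lam_eq X v : lies_over (val X) v -> lam X = v.
Proof. by move=> Xv; apply: lies_over_inj (spec_filter X) (lamP X) Xv. Qed.

(* The pairs (alpha, x) with s(alpha) = lambda(x), with the topology induced by
   the product topology. *)
Definition ga_arr : set (discrete_topology (gpath E) * spectrum T) :=
  [set g | pt g.1 = lam g.2].

Let gaP (g : ga_arr) : pt (val g).1 = lam (val g).2.
Proof. exact: (set_valP g). Qed.

Let gaP' (g : ga_arr) : lies_over (val (val g).2) (pt (val g).1).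
Proof. by rewrite gaP; exact: lamP. Qed.

Let spec_ext X Y : val X = val Y -> X = Y.
Proof. exact: val_inj. Qed.

Let ga_ext (g h : ga_arr) :
  (val g).1 = (val h).1 -> (val g).2 = (val h).2 -> g = h.
Proof.
move=> gh1 gh2; apply: val_inj.
by rewrite [LHS]surjective_pairing gh1 gh2 -surjective_pairing.
Qed.

Definition ga_src (g : ga_arr) : spectrum T := (val g).2.
Definition ga_rng (g : ga_arr) : spectrum T :=
  @set_elt _ (@ringA_ultrafilter T) (act (val g).1 (val (val g).2))
    (act_ultrafilter (set_valP (val g).2) (gaP' g)).

Let lam_rng g : lam (ga_rng g) = po (val g).1.
Proof. by apply: lam_eq; exact: (act_filter (spec_filter _) (gaP' g)).2. Qed.

Definition ga_id X : ga_arr :=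
  @set_elt _ ga_arr (path0 (lam X) : discrete_topology (gpath E), X) erefl.

Lemma ga_inv_subproof (g : ga_arr) :
  ga_arr (pinv (val g).1 : discrete_topology (gpath E), ga_rng g).
Proof. by rewrite /ga_arr /= lam_rng; exact: pt_pinv. Qed.
Definition ga_inv (g : ga_arr) : ga_arr :=
  @set_elt _ ga_arr _ (ga_inv_subproof g).

Definition ga_mul (g h : ga_arr) : ga_arr :=
  insubd g (pmul (val g).1 (val h).1 : discrete_topology (gpath E), (val h).2).

Let src_rng g h : ga_src g = ga_rng h -> pt (val g).1 = po (val h).1.
Proof. by move=> gh; rewrite gaP -/(ga_src g) gh lam_rng. Qed.

Lemma val_ga_mul g h : ga_src g = ga_rng h ->
  val (ga_mul g h) = (pmul (val g).1 (val h).1, (val h).2).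
Proof.
move=> gh; apply: insubdK; apply: mem_set.
by rewrite /ga_arr /= pt_pmul; [exact: gaP|exact: src_rng].
Qed.

Lemma ga_src_id X : ga_src (ga_id X) = X. Proof. by []. Qed.

Lemma ga_rng_id X : ga_rng (ga_id X) = X.
Proof. by apply: spec_ext; exact: act_path0 (spec_filter X) (lamP X). Qed.

Lemma ga_src_mul g h : ga_src g = ga_rng h -> ga_src (ga_mul g h) = ga_src h.
Proof. by move=> gh; rewrite /ga_src val_ga_mul. Qed.

Lemma ga_rng_mul g h : ga_src g = ga_rng h -> ga_rng (ga_mul g h) = ga_rng g.
Proof.
move=> gh; apply: spec_ext.
rewrite /= val_ga_mul //= act_comp; last by move: (src_rng gh).
by rewrite -[in RHS]/(ga_src g) gh.
Qed.

Lemma ga_mulA f g h : ga_src f = ga_rng g -> ga_src g = ga_rng h ->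
  ga_mul (ga_mul f g) h = ga_mul f (ga_mul g h).
Proof.
move=> fg gh.
have fgh : ga_src (ga_mul f g) = ga_rng h by rewrite ga_src_mul.
have fgh' : ga_src f = ga_rng (ga_mul g h) by rewrite ga_rng_mul.
by apply: ga_ext; rewrite !val_ga_mul //=; apply: (pmulA (src_rng fg) (src_rng gh)).
Qed.

Lemma ga_mul_id g : ga_mul g (ga_id (ga_src g)) = g.
Proof.
have gg : ga_src g = ga_rng (ga_id (ga_src g)) by rewrite ga_rng_id.
by apply: ga_ext; rewrite val_ga_mul //= -gaP; exact: pmulp0.
Qed.

Lemma ga_id_mul g : ga_mul (ga_id (ga_rng g)) g = g.
Proof. by apply: ga_ext; rewrite val_ga_mul //= lam_rng; exact: pmul0p. Qed.

Lemma ga_src_inv g : ga_src (ga_inv g) = ga_rng g. Proof. by []. Qed.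

Lemma ga_rng_inv g : ga_rng (ga_inv g) = ga_src g.
Proof.
apply: spec_ext; rewrite /= -act_comp; last exact: pt_pinv.
by rewrite pmulV; exact: act_path0 (spec_filter _) (gaP' g).
Qed.

Lemma ga_inv_mul g : ga_mul (ga_inv g) g = ga_id (ga_src g).
Proof.
by apply: ga_ext; rewrite val_ga_mul //=; rewrite -gaP; exact: pmulV.
Qed.

Lemma ga_mul_inv g : ga_mul g (ga_inv g) = ga_id (ga_rng g).
Proof.
have gg : ga_src g = ga_rng (ga_inv g) by rewrite ga_rng_inv.
by apply: ga_ext; rewrite val_ga_mul //= lam_rng; exact: pmulVr.
Qed.

Definition cover_groupoid : groupoid :=
  Groupoid ga_src_id ga_rng_id ga_src_mul ga_rng_mul ga_mulA ga_mul_id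
    ga_id_mul ga_src_inv ga_rng_inv ga_inv_mul ga_mul_inv.

End Action.

Section ToeplitzGroupoid.
Variable E : digraph.
Local Notation T := (ucover E).
Implicit Types x : spectrum T.

(* [underline_fin x p] and [underline_inf x z]: the point x of the spectrum
   corresponds to the vertex p of the cover, resp. to an end of the cover, and
   the path associated with x is p, resp. z. *)
Definition underline_fin x (p : gpath E) : Prop := val x = @vertex_uf T p.

Definition underline_inf x (z : nat -> edge E) : Prop :=
  exists q w : nat -> edge T,
    [/\ ipath q, idirected q & val x = end_uf q] /\
    [/\ ipath w, eo (w 0%N) = path0 (lam x), tail_equiv w q &
        forall i, pe (clabel (w i)) = [:: z i]].

Definition XE : set (spectrum T) :=
  [set x | (exists2 p, underline_fin x p & directed p) \/
           (exists2 z, underline_inf x z & ipath z /\ idirected z)].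

Definition toeplitz_groupoid : groupoid := @restriction (cover_groupoid E) XE.

Definition slice (p : gpath E) : set toeplitz_groupoid :=
  [set g | (val (val g)).1 = p].

End ToeplitzGroupoid.

Section Hilbert.
Variable R : realType.

Record hilbert := Hilbert {
  hilbert_sort :> completeNormedModType R[i];
  hdot : {dot hilbert_sort for Num.conj};
  hnormE : forall x, `|x| ^+ 2 = hdot x x }.

Record bop (H : hilbert) := BOp {
  bop_fun :> {linear H -> H};
  bop_continuous : continuous bop_fun }.
HB.instance Definition _ (H : hilbert) := gen_eqMixin (bop H).
HB.instance Definition _ (H : hilbert) := gen_choiceMixin (bop H).

Section Operators.
Variable H : hilbert.
Implicit Types S T P : bop H.

(* The adjoint exists and is unique by the Riesz representation theorem. *)
Definition adj T : bop H :=
  xget T [set T' : bop H | forall x y, hdot H (T x) y = hdot H x (T' y)].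

Definition partial_isometry S : Prop := forall x, S (adj S (S x)) = S x.

Definition projection P : Prop := (forall x, P (P x) = P x) /\ adj P = P.

(* Operator order (for self-adjoint T, T'); the order of R[i] makes 0 <= z mean
   that z is real and nonnegative. *)
Definition op_le (T T' : H -> H) : Prop :=
  forall x, 0 <= hdot H (T' x - T x) x.

(* The net of the sums of (T_i) over the finite subsets of D converges to Q in
   the strong operator topology. *)
Definition sot_sum (I : choiceType) (D : set I) (T : I -> H -> H)
    (Q : H -> H) : Prop :=
  forall x (U : set H), nbhs (Q x) U ->
    exists2 F0 : {fset I}, [set` F0] `<=` D &
      forall F : {fset I}, (F0 `<=` F)%fset -> [set` F] `<=` D ->
        U (\sum_(i <- F) T i x).

Definition op_bounded_by T (M : R[i]) : Prop := forall x, `|T x| <= M * `|x|.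

End Operators.

(* C*-algebras, not necessarily unital. *)
Record cstar_algebra := CstarAlgebra {
  cstar_sort :> completeNormedModType R[i];
  cmul : cstar_sort -> cstar_sort -> cstar_sort;
  cstar : cstar_sort -> cstar_sort;
  cmulA : forall a b c, cmul a (cmul b c) = cmul (cmul a b) c;
  cmulDl : forall a b c, cmul (a + b) c = cmul a c + cmul b c;
  cmulDr : forall a b c, cmul a (b + c) = cmul a b + cmul a c;
  cmulZl : forall k a b, cmul (k *: a) b = k *: cmul a b;
  cmulZr : forall k a b, cmul a (k *: b) = k *: cmul a b;
  cstarK : involutive cstar;
  cstarD : forall a b, cstar (a + b) = cstar a + cstar b;
  cstarZ : forall (k : R[i]) a, cstar (k *: a) = Num.conj k *: cstar a;
  cstarM : forall a b, cstar (cmul a b) = cmul (cstar b) (cstar a);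
  cnormM : forall a b, `|cmul a b| <= `|a| * `|b|;
  cnorm_star : forall a, `|cmul (cstar a) a| = `|a| ^+ 2 }.

(* *-homomorphisms from A to B(H). *)
Record representation (A : cstar_algebra) (H : hilbert) (pi : A -> bop H) :
    Prop := Representation {
  repD : forall a b x, pi (a + b) x = pi a x + pi b x;
  repZ : forall (k : R[i]) a x, pi (k *: a) x = k *: pi a x;
  repM : forall a b x, pi (cmul a b) x = pi a (pi b x);
  rep_star : forall a, pi (cstar a) = adj (pi a) }.

(* The finite sums of vectors pi(a)x form the linear span of pi(A)H. *)
Definition nondegenerate_rep (A : cstar_algebra) (H : hilbert)
    (pi : A -> bop H) : Prop :=
  closure [set y : H | exists s : seq (A * H),
                         y = \sum_(ax <- s) pi ax.1 ax.2] = [set: H].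

Section GroupoidAlgebra.
Variable G : groupoid.
Implicit Types f g : G -> R[i].

(* [R[i]^o] is R[i] with its norm topology. *)
Definition Cc : set (G -> R[i]) :=
  [set f | continuous (f : G -> R[i]^o) /\
           compact (closure [set a | f a != 0])].

(* The sum has finitely many nonzero terms if f and g are in Cc and G is
   etale. *)
Definition gconv f g : G -> R[i] := fun c =>
  \sum_(ab \in [set ab : G * G | gsrc ab.1 = grng ab.2 /\
                                 gmul ab.1 ab.2 = c]) f ab.1 * g ab.2.

Definition ginvol f : G -> R[i] := fun a => Num.conj (f (ginv a)).

(* *-representations of C_c(G); the values of pi outside C_c(G) play no role. *)
Record Cc_representation (H : hilbert) (pi : (G -> R[i]) -> bop H) : Prop :=
    CcRepresentation {
  Cc_repD : forall f g x, Cc f -> Cc g -> pi (f \+ g) x = pi f x + pi g x;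
  Cc_repZ : forall (k : R[i]) f x, Cc f -> pi (fun a => k * f a) x = k *: pi f x;
  Cc_repM : forall f g x, Cc f -> Cc g -> pi (gconv f g) x = pi f (pi g x);
  Cc_rep_star : forall f, Cc f -> pi (ginvol f) = adj (pi f) }.

(* The full groupoid C*-algebra of an etale groupoid: a C*-algebra with a
   *-homomorphism from C_c(G) that makes it the completion of C_c(G) for
     |f| = sup { |pi(f)| : pi a *-representation of C_c(G) }.
   Such a C*-algebra is unique up to a unique isomorphism under C_c(G). *)
Record full_cstar := FullCstar {
  full_alg :> cstar_algebra;
  full_emb : (G -> R[i]) -> full_alg;
  full_embD : forall f g, Cc f -> Cc g ->
    full_emb (f \+ g) = full_emb f + full_emb g;
  full_embZ : forall (k : R[i]) f, Cc f ->
    full_emb (fun a => k * f a) = k *: full_emb f;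
  full_embM : forall f g, Cc f -> Cc g ->
    full_emb (gconv f g) = cmul (full_emb f) (full_emb g);
  full_emb_star : forall f, Cc f -> full_emb (ginvol f) = cstar (full_emb f);
  full_emb_dense : closure (full_emb @` Cc) = [set: full_alg];
  full_norm_ub : forall f (H : hilbert) (pi : (G -> R[i]) -> bop H),
    Cc f -> Cc_representation pi -> op_bounded_by (pi f) `|full_emb f|;
  full_norm_lub : forall f (M : R[i]), Cc f -> 0 <= M ->
    (forall (H : hilbert) (pi : (G -> R[i]) -> bop H),
        Cc_representation pi -> op_bounded_by (pi f) M) ->
    `|full_emb f| <= M }.

End GroupoidAlgebra.

Section Families.
Variables (E : digraph) (H : hilbert).

Record toeplitz_family (SP : (pedge E -> bop H) * (vertex E -> bop H)) :
    Prop := ToeplitzFamily {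
  tf_isom : forall e, partial_isometry (SP.1 e);
  tf_proj : forall u, projection (SP.2 u);
  tf_orth : forall u v, u <> v -> forall x, SP.2 u (SP.2 v x) = 0;
  tf_sum : sot_sum [set: vertex E] (fun u x => SP.2 u x) idfun;
  tf_init : forall e x, adj (SP.1 e) (SP.1 e x) = SP.2 (et (val e)) x;
  tf_final : forall u, exists2 Q : bop H,
    sot_sum [set f : pedge E | eo (val f) = u]
            (fun f x => SP.1 f (adj (SP.1 f) x)) Q &
    op_le Q (SP.2 u) }.

(* The family attached to a representation of the Toeplitz algebra: S_e and P_u
   are the images of the characteristic functions of the sets of all (e, x) and
   of all (u, x) in the groupoid. *)
Definition family_of (A : full_cstar (toeplitz_groupoid E)) (pi : A -> bop H) :
    (pedge E -> bop H) * (vertex E -> bop H) :=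
  (fun e => pi (full_emb A \1_(slice (path1 (val e)))),
   fun u => pi (full_emb A \1_(slice (path0 u)))).

End Families.
End Hilbert.

(* Main.v *)
(** For directed paths [p], [q] with the same end let [Z(q,p)] be the compact open
    set of the arrows [(q p^-1, x)] with [p] a prefix of [x].  Products of the
    characteristic functions of these sets obey the rules of the operators
    [S_q S_p^*], and every function in [Cc] is a uniform limit of their linear
    combinations, with labels in a fixed finite set.  Given a family [S, P], the
    map [\sum c 1_Z(q,p) |-> \sum c S_q S_p^*] is bounded by the number of labels
    times the supremum norm: for a single label the projections [S_p S_p^*] commute,
    and on a joint eigenvector the sum is [S_q S_p^*] times the value of the
    function at a vertex of the cover.  Hence it extends to [Cc] and then to
    [TO(E)].  Conversely a representation of a C*-algebra is automatically bounded,
    and a representation of [Cc] is bounded by the number of labels times the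
    supremum norm; so a representation of [TO(E)] is determined by its values on the
    functions [1_Z(q,p)], that is, by its family.  Nondegeneracy is equivalent to
    [\sum P_u = 1]. *)

Require Import Defs.
From HB Require Import structures.
From mathcomp Require Import all_boot all_order all_algebra.
From mathcomp Require Import sesquilinear complex finmap ring lra.
From mathcomp Require Import all_classical all_reals all_analysis.
Import Defs.

Set Implicit Arguments.
Unset Strict Implicit.
Unset Printing Implicit Defensive.

Import Order.TTheory GRing.Theory Num.Theory.
Import numFieldNormedType.Exports.

Local Open Scope classical_set_scope.
Local Open Scope ring_scope.
Local Open Scope complex_scope.

(** * Hilbert spaces over the complex numbers *)

(** Neither the ends nor the topology of the groupoid are handled directly. A point of X(E,0) is
    recovered from the set of its directed prefixes, and every nonempty chain of directed paths
    closed under prefixes arises in this way; separation, compactness and the action thus become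
    statements about finite words. The norm of TO(E) is a supremum over representations none of
    which is assumed continuous, so uniform approximation alone says nothing about it. For this
    reason the labels of the approximants stay in a finite set that is chosen before the precision:
    a bound by the number of labels then turns uniform approximation into approximation in norm.
    Both automatic bounds rest on one identity. If b is self-adjoint and f^* f = 2 B b - b^2, then
    B^2 |x|^2 - |pi(f) x|^2 = |B x - pi(b) x|^2. It expresses that B - b is a square root of B^2 -
    f^* f without mentioning a unit. On a slice b is given by a formula; in an abstract C*-algebra
    it is the limit of an iteration. *)

Lemma gt0_real_complex (R : realType) (e : R[i]) : 0 < e ->
  exists2 r : R, 0 < r & e = r%:C.
Proof.
move=> e0; have eE : (complex.Re e)%:C = e by rewrite RRe_real // gtr0_real.
by exists (complex.Re e) => //; rewrite -ltcR eE.
Qed.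

(** * Absolute values and norms with values in the reals *)

Section ComplexAbs.
Variable R : realType.
Implicit Types z w : R[i].

Lemma rcM (a b : R) : (a * b)%:C = a%:C * b%:C :> R[i].
Proof. exact: rmorphM. Qed.
Lemma rcD (a b : R) : (a + b)%:C = a%:C + b%:C :> R[i].
Proof. exact: rmorphD. Qed.
Lemma rcX (a : R) n : (a ^+ n)%:C = a%:C ^+ n :> R[i].
Proof. exact: rmorphXn. Qed.

(** [R[i]] is only partially ordered; absolute values and norms are moved to [R], where suprema,
    infima and linear arithmetic apply. *)
Definition rabs z : R := complex.Re `|z|.

Lemma rabsE z : (rabs z)%:C = `|z|.
Proof. by rewrite /rabs RRe_real // normr_real. Qed.
Lemma rabs_ge0 z : 0 <= rabs z.
Proof. by rewrite -ler0c rabsE. Qed.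
Lemma rabs_real (r : R) : rabs r%:C = `|r|.
Proof. by rewrite /rabs normc_def /= expr0n /= addr0 sqrtr_sqr. Qed.
Lemma rabsM z w : rabs (z * w) = rabs z * rabs w.
Proof. by apply: complexI; rewrite rcM !rabsE normrM. Qed.
Lemma rabsD z w : rabs (z + w) <= rabs z + rabs w.
Proof. by rewrite -lecR rmorphD !rabsE ler_normD. Qed.
Lemma rabsN z : rabs (- z) = rabs z.
Proof. by rewrite /rabs normrN. Qed.
Lemma rabs0 : rabs 0 = 0.
Proof. by rewrite /rabs normr0. Qed.
Lemma rabs1 : rabs 1 = 1.
Proof. by rewrite /rabs normr1. Qed.
Lemma rabsB z w : rabs (z - w) = rabs (w - z).
Proof. by rewrite -rabsN opprB. Qed.
Lemma rabs_conj z : rabs (Num.conj z) = rabs z.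
Proof. by rewrite /rabs norm_conjC. Qed.
Lemma rabs0_eq0 z : rabs z <= 0 -> z = 0.
Proof.
by move=> h; apply/normr0_eq0/le_anti; rewrite -rabsE lecR h ler0c rabs_ge0.
Qed.
Lemma rabs_sq z : z * Num.conj z = (rabs z ^+ 2)%:C.
Proof. by rewrite -normCK -rabsE rcX. Qed.
Lemma ReD z w : complex.Re (z + w) = complex.Re z + complex.Re w.
Proof. by case: z w => [a b] [c d]. Qed.
Lemma Re_le_rabs z : complex.Re z <= rabs z.
Proof.
have := normc_ge_Re z; rewrite -rabsE lecR.
by apply: le_trans; exact: ler_norm.
Qed.
Lemma Re_conj z : complex.Re (Num.conj z) = complex.Re z.
Proof. by case: z. Qed.

End ComplexAbs.

Section RealNorm.
Variable R : realType.
Variable V : normedModType R[i].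
Implicit Types (x y : V).

Definition rnorm x : R := complex.Re `|x|.

Lemma rnormE x : (rnorm x)%:C = `|x|.
Proof. by rewrite /rnorm RRe_real // normr_real. Qed.

Lemma rnorm_ge0 x : 0 <= rnorm x.
Proof. by rewrite -ler0c rnormE. Qed.

Lemma rnorm0 : rnorm 0 = 0.
Proof. by rewrite /rnorm normr0. Qed.

Lemma rnorm0_eq0 x : rnorm x <= 0 -> x = 0.
Proof. by move=> h; apply/normr0_eq0/le_anti; rewrite -rnormE lecR h ler0c rnorm_ge0. Qed.

Lemma rnormN x : rnorm (- x) = rnorm x.
Proof. by rewrite /rnorm normrN. Qed.

Lemma rnormB x y : rnorm (x - y) = rnorm (y - x).
Proof. by rewrite -rnormN opprB. Qed.

Lemma rnormD x y : rnorm (x + y) <= rnorm x + rnorm y.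
Proof. by rewrite -lecR rmorphD /= !rnormE ler_normD. Qed.

Lemma rnorm_dist x y z : rnorm (x - z) <= rnorm (x - y) + rnorm (y - z).
Proof. by rewrite -(subrKA y); exact: rnormD. Qed.

Lemma rnormZ (k : R[i]) x : rnorm (k *: x) = rabs k * rnorm x.
Proof. by apply: complexI; rewrite rcM !rnormE rabsE normrZ. Qed.

Lemma nbhs_rnormP x (U : set V) :
  nbhs x U <-> exists2 e : R, 0 < e & forall y, rnorm (x - y) < e -> U y.
Proof.
split=> [/nbhs_normP [_ /= /gt0_real_complex[e e0 ->] eU]|[e e0 eU]].
  by exists e => // y; rewrite -ltcR rnormE => /eU.
apply/nbhs_normP; exists (e%:C) => /=; first by rewrite ltcR.
by move=> y /=; rewrite -rnormE ltcR; exact: eU.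
Qed.

Lemma closure_rnormP (A : set V) x :
  closure A x <-> forall e : R, 0 < e -> exists2 y, A y & rnorm (x - y) < e.
Proof.
split=> [clA e e0|h U /nbhs_rnormP[e e0 eU]].
  have [|y [Ay xy]] := clA [set y | rnorm (x - y) < e]; last by exists y.
  by apply/nbhs_rnormP; exists e.
by have [y Ay xy] := h e e0; exists y; split=> //; exact: eU.
Qed.

End RealNorm.

Section Completeness.
Variable R : realType.
Variable V : completeNormedModType R[i].

Lemma natSinv_small (e : R) : 0 < e ->
  exists N, forall n, (N <= n)%N -> n.+1%:R^-1 <= e.
Proof.
move=> e0; exists (Num.truncn e^-1) => n Nn.
rewrite invf_ple ?posrE ?ltr0n // ltW //.
by apply: lt_le_trans (truncnS_gt _) _; rewrite ler_nat.
Qed.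

Lemma rnorm_complete (u : nat -> V) :
  (forall e : R, 0 < e -> exists N, forall m n, (N <= m)%N -> (N <= n)%N ->
     rnorm (u m - u n) <= e) ->
  exists l, forall e : R, 0 < e -> exists N, forall n, (N <= n)%N ->
     rnorm (u n - l) <= e.
Proof.
move=> cu; have : cvg (u @ \oo).
  apply/cauchy_cvgP/cauchy_ballP => _ /gt0_real_complex[e e0 ->].
  have [N NP] := cu (e / 2) (divr_gt0 e0 (ltr0Sn _ 1)).
  exists (u @` [set n | (N <= n)%N], u @` [set n | (N <= n)%N]).
    by split; exists N => // n Nn; exists n.
  move=> _ [/= [m Nm <-] [n Nn <-]]; rewrite -ball_normE /= -rnormE ltcR.
  by rewrite (le_lt_trans (NP m n Nm Nn)) // ltr_pdivrMr // ltr_pMr // ltr1n.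
move=> cvu; exists (lim (u @ \oo)) => e e0.
have /cvgrPdist_le /(_ e%:C) := cvu; rewrite ltcR => /(_ e0) [N _ NP].
by exists N => n Nn; rewrite rnormB -lecR rnormE; exact: NP.
Qed.
End Completeness.

(** * Inner products and the Cauchy-Schwarz inequality *)

Section Dot.
Variables (R : realType) (H : hilbert R).
Implicit Types (x y z : H) (k : R[i]).

Lemma dotDl x y z : hdot H (x + y) z = hdot H x z + hdot H y z.
Proof. exact: linearDl. Qed.
Lemma dotDr x y z : hdot H x (y + z) = hdot H x y + hdot H x z.
Proof. exact: linearDr. Qed.
Lemma dotZl k x y : hdot H (k *: x) y = k * hdot H x y.
Proof. exact: linearZl_LR. Qed.
Lemma dotZr k x y : hdot H x (k *: y) = Num.conj k * hdot H x y.
Proof. exact: linearZr_LR. Qed.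
Lemma dotC x y : hdot H x y = Num.conj (hdot H y x).
Proof. by rewrite hermC /= expr0 mul1r. Qed.

Lemma dotNl x y : hdot H (- x) y = - hdot H x y.
Proof. by rewrite -scaleN1r dotZl mulN1r. Qed.
Lemma dotNr x y : hdot H x (- y) = - hdot H x y.
Proof. by rewrite dotC dotNl rmorphN /= -dotC. Qed.
Lemma dotBl x y z : hdot H (x - y) z = hdot H x z - hdot H y z.
Proof. by rewrite dotDl dotNl. Qed.
Lemma dotBr x y z : hdot H x (y - z) = hdot H x y - hdot H x z.
Proof. by rewrite dotDr dotNr. Qed.
Lemma dot0l x : hdot H 0 x = 0.
Proof. by rewrite -(scale0r (0 : H)) dotZl mul0r. Qed.
Lemma dot0r x : hdot H x 0 = 0.
Proof. by rewrite dotC dot0l rmorph0. Qed.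

Lemma dot_norm x : hdot H x x = (rnorm x ^+ 2)%:C.
Proof. by rewrite -hnormE -rnormE -rcX. Qed.

Definition rdot x y : R := complex.Re (hdot H x y).

Lemma rdotDl x y z : rdot (x + y) z = rdot x z + rdot y z.
Proof. by rewrite /rdot dotDl raddfD. Qed.
Lemma rdotDr x y z : rdot x (y + z) = rdot x y + rdot x z.
Proof. by rewrite /rdot dotDr raddfD. Qed.
Lemma rdotNl x y : rdot (- x) y = - rdot x y.
Proof. by rewrite /rdot dotNl raddfN. Qed.
Lemma rdotNr x y : rdot x (- y) = - rdot x y.
Proof. by rewrite /rdot dotNr raddfN. Qed.
Lemma rdotC x y : rdot x y = rdot y x.
Proof. by rewrite /rdot dotC Re_conj. Qed.
Lemma rdotZl (k : R) x y : rdot (k%:C *: x) y = k * rdot x y.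
Proof. by rewrite /rdot dotZl; case: (hdot H x y) => a b /=; rewrite mul0r subr0. Qed.
Lemma rdotZr (k : R) x y : rdot x (k%:C *: y) = k * rdot x y.
Proof. by rewrite rdotC rdotZl rdotC. Qed.
Lemma rdot_norm x : rdot x x = rnorm x ^+ 2.
Proof. by rewrite /rdot dot_norm. Qed.

Lemma rnormD_sq x y : rnorm (x + y) ^+ 2 = rnorm x ^+ 2 + rdot x y *+ 2 + rnorm y ^+ 2.
Proof. by rewrite -!rdot_norm !rdotDl !rdotDr (rdotC y x); ring. Qed.

Lemma rdot_CS x y : rdot x y <= rnorm x * rnorm y.
Proof.
have [->|x0] := eqVneq x 0; first by rewrite /rdot dot0l rnorm0 mul0r.
have nx : 0 < rnorm x by rewrite -ltcR rnormE normr_gt0.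
(* Expanding gives [0 <= 2 |x| |y| (|x| |y| - rdot x y)]; the factor [|x| |y|] is divided out once
   both vectors are nonzero. *)
have := sqr_ge0 (rnorm ((rnorm y)%:C *: x - (rnorm x)%:C *: y)).
rewrite rnormD_sq rdotNr rdotZr rdotZl rnormN !rnormZ !rabs_real.
rewrite !ger0_norm ?rnorm_ge0 // => h.
have [->|y0] := eqVneq y 0; first by rewrite /rdot dot0r rnorm0 mulr0.
have ny : 0 < rnorm y by rewrite -ltcR rnormE normr_gt0.
have : 0 <= (rnorm x * rnorm y) * (rnorm x * rnorm y - rdot x y) by nra.
by rewrite pmulr_rge0 ?mulr_gt0 // subr_ge0.
Qed.

Lemma dot_CS x y : rabs (hdot H x y) <= rnorm x * rnorm y.
Proof.
have [->|d0] := eqVneq (hdot H x y) 0; first by rewrite rabs0 mulr_ge0 ?rnorm_ge0.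
have r0 : 0 < rabs (hdot H x y).
  rewrite lt_def rabs_ge0 andbT; apply: contra_neq d0 => h.
  by apply: rabs0_eq0; rewrite h.
rewrite -(ler_pM2l r0) -expr2.
(* Multiplying [x] by the conjugate of the inner product makes the latter real, which reduces to the
   inequality for real parts. *)
have -> : rabs (hdot H x y) ^+ 2 = rdot (Num.conj (hdot H x y) *: x) y.
  by rewrite /rdot dotZl mulrC rabs_sq.
by apply: le_trans (rdot_CS _ _) _; rewrite rnormZ rabs_conj mulrA.
Qed.

Lemma dot_eq0 x : (forall y, hdot H x y = 0) -> x = 0.
Proof. by move=> /(_ x)/eqP; rewrite dnorm_eq0 => /eqP. Qed.

Lemma dot_inj x y : (forall z, hdot H z x = hdot H z y) -> x = y.
Proof.
by move=> h; apply/subr0_eq/dot_eq0 => z; rewrite dotC dotBr h subrr rmorph0.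
Qed.

End Dot.

(** * Bounded operators, the Riesz theorem and adjoints *)

Section Bop.
Variables (R : realType) (H : hilbert R).
Implicit Types (S T U : bop H) (x y z : H).

(** The linear structure packed with a map consists of proofs, and so does continuity; proof
    irrelevance reduces the equality to that of the maps. *)
Lemma bop_ext S T : (forall x, S x = T x) -> S = T.
Proof.
case: S T => [[S cS] hS] [[T cT] hT] /= ST.
have {ST} ST : S = T by apply/funext.
subst T; have cST : cS = cT.
  case: cS cT {hS hT} => [[a1] [b1]] [[a2] [b2]].
  by congr GRing.Linear.Class; [congr Algebra.isNmodMorphism.Axioms_|congr GRing.isScalable.Axioms_]; exact: Prop_irrelevance.
by subst cT; congr BOp; exact: Prop_irrelevance.
Qed.

Lemma bop_bounded S : exists2 M : R, 0 < M & forall x, rnorm (S x) <= M * rnorm x.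
Proof.
have /linear_bounded_continuous/linear_boundedP := @bop_continuous _ _ S.
move=> /pinfty_ex_gt0[M /gt0_real_complex[r r0 ->] Mb].
by exists r => // x; rewrite -lecR rcM !rnormE.
Qed.

Lemma mkbop_exists (f : H -> H) (M : R) :
  (forall k x y, f (k *: x + y) = k *: f x + f y) ->
  (forall x, rnorm (f x) <= M * rnorm x) -> exists T : bop H, forall x, T x = f x.
Proof.
move=> lf bf.
pose f1 := GRing.isLinear.Build R[i] H H *:%R f lf.
pose F : {linear H -> H} := HB.pack f f1.
suff cF : continuous F by exists (BOp cF).
apply/linear_bounded_continuous/linear_boundedP.
exists M%:C; split; first by rewrite complex_real.
move=> r Mr x; rewrite -!rnormE (@le_trans _ _ (M * rnorm x)%:C) //.
  by rewrite lecR; exact: bf.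
by rewrite rcM ler_wpM2r ?ler0c ?rnorm_ge0 // ltW.
Qed.

(** Variational proof: the vector sought minimises [J x = |x|^2 - 2 Re (f x)]. Completeness gives a
    minimiser, and the vanishing of the first variation there says that [f] and the inner product
    with it have the same real part. *)
Lemma riesz (f : H -> R[i]) (M : R) :
  (forall k x y, f (k *: x + y) = k * f x + f y) ->
  (forall x, rabs (f x) <= M * rnorm x) ->
  exists z, forall x, f x = hdot H x z.
Proof.
move=> lf bf; pose J x := rnorm x ^+ 2 - (complex.Re (f x)) *+ 2.
have f0 : f 0 = 0.
  by have := lf (-1) 0 0; rewrite scaler0 addr0 mulN1r addNr.
have fD x y : f (x + y) = f x + f y by have := lf 1 x y; rewrite scale1r mul1r.
have fZ k x : f (k *: x) = k * f x by have := lf k x 0; rewrite f0 !addr0.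
have rfZ (k : R) x : complex.Re (f (k%:C *: x)) = k * complex.Re (f x).
  by rewrite fZ; case: (f x) => a b /=; rewrite mul0r subr0.
have Jlb x : - M ^+ 2 <= J x.
  have := bf x; have := Re_le_rabs (f x); have := rnorm_ge0 x.
  rewrite /J; have := sqr_ge0 (rnorm x - M); nra.
pose A := [set J x | x in [set: H]].
have hA : has_inf A.
  by split; [exists (J 0); exists 0|exists (- M ^+ 2) => _ [x _ <-]; exact: Jlb].
(* Parallelogram law: [|x - y|^2 = 2 J x + 2 J y - 4 J ((x + y) / 2)], and the midpoint has value at
   least [inf A]. Hence minimising sequences are Cauchy. *)
have par x y : rnorm (x - y) ^+ 2 <= (J x - inf A + (J y - inf A)) *+ 2.
  have : inf A <= J (2^-1%:C *: (x + y)).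
    by apply: inf_lbound; [exact: hA.2|exists (2^-1%:C *: (x + y))].
  rewrite /J rnormZ rabs_real rfZ fD raddfD /= exprMn ger0_norm ?invr_ge0 ?ler0n //.
  rewrite !rnormD_sq rnormN rdotNr; lra.
have [u uP] : exists u : nat -> H, forall n, J (u n) <= inf A + n.+1%:R^-1.
  have : forall n : nat, exists x, J x <= inf A + n.+1%:R^-1.
    move=> n; have n0 : 0 < n.+1%:R^-1 :> R by rewrite invr_gt0 ltr0n.
    by have [_ [x _ <-] /ltW Jx] := inf_adherent n0 hA; exists x.
  by move=> /choice[u uP]; exists u.
have [z zP] : exists l, forall e : R, 0 < e -> exists N, forall n, (N <= n)%N ->
     rnorm (u n - l) <= e.
  apply: rnorm_complete => e e0.
  (* By [par] the squared distance is at most [2 (1/(m+1) + 1/(n+1))], so [e^2 / 4] for each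
     reciprocal is enough. *)
  have [N NP] := @natSinv_small R (e ^+ 2 / 4) (divr_gt0 (exprn_gt0 _ e0) (ltr0Sn _ 3)).
  exists N => m n Nm Nn; rewrite -(ler_pXn2r (n := 2)) ?nnegrE ?rnorm_ge0 ?(ltW e0) //.
  have := par (u m) (u n); have := uP m; have := uP n; have := NP _ Nm; have := NP _ Nn.
  set a := m.+1%:R^-1; set b := n.+1%:R^-1; lra.
have Jz : J z <= inf A.
  apply/ler_addgt0Pr => e e0.
  have Mz : 0 < 1 + 2 * (1 + `|M|) + 2 * rnorm z.
    by have := rnorm_ge0 z; have := normr_ge0 M; lra.
  (* [J z - J (u n)] is at most [2 (|z| + |M|)] times the distance; the divisor exceeds this and is
     positive. The other half of [e] covers [1/(n+1)]. *)
  pose d := Num.min 1 (e / 2 / (1 + 2 * (1 + `|M|) + 2 * rnorm z)).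
  have d0 : 0 < d by rewrite lt_min ltr01 !divr_gt0.
  have [N1 NP1] := zP d d0.
  have [N2 NP2] := @natSinv_small R (e / 2) (divr_gt0 e0 (ltr0Sn _ 1)).
  have := NP1 _ (leq_maxl N1 N2); have := NP2 _ (leq_maxr N1 N2).
  have := uP (maxn N1 N2); set n := maxn N1 N2; set a := n.+1%:R^-1 => h1 h2 h3.
  have : J z <= J (u n) + (1 + 2 * (1 + `|M|) + 2 * rnorm z) * d.
    have hz : z = u n - (u n - z) by rewrite subKr.
    have hu : u n = z + (u n - z) by rewrite addrC subrK.
    have fz : complex.Re (f (u n)) = complex.Re (f z) + complex.Re (f (u n - z)).
      by rewrite -raddfD -fD -hu.
    have := Re_le_rabs (f (u n - z)); have := bf (u n - z).
    have : rnorm z <= rnorm (u n) + rnorm (u n - z).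
      by rewrite {1}hz (le_trans (rnormD _ _)) // rnormN.
    have d1 : d <= 1 by rewrite ge_min lexx.
    have := rnorm_ge0 (u n - z); have := rnorm_ge0 (u n).
    have := normr_ge0 M; have := ler_norm M; have := rnorm_ge0 z.
    rewrite /J fz; move: (rnorm (u n - z)) (rnorm z) (rnorm (u n)) h3 d1 => p q r.
    move: (complex.Re _) (complex.Re (f (u n - z))) (rabs _) `|M| => s t v w.
    move=> pd d1 q0 Mw w0 r0 p0 hq vp tv.
    have h4 : M * p <= w * p by rewrite ler_wpM2r.
    have h5 : w * p <= w * d by rewrite ler_wpM2l.
    have h6 : q * p <= q * d by rewrite ler_wpM2l.
    have h7 : q ^+ 2 - r ^+ 2 <= p * q *+ 2.
      have [rq|rq] := lerP r q; last by nra.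
      rewrite subr_sqr -mulrnAr ler_pM //; [by rewrite subr_ge0|lra|lra|lra].
    have h8 : 0 <= d by exact: ltW.
    have h9 : p * q = q * p by rewrite mulrC.
    lra.
  have : (1 + 2 * (1 + `|M|) + 2 * rnorm z) * d <= e / 2.
    by rewrite mulrC -ler_pdivlMr // ge_min lexx orbT.
  lra.
have Jmin x : J z <= J x.
  by apply: le_trans Jz _; apply: inf_lbound; [exact: hA.2|exists x].
have Ref h : complex.Re (f h) = rdot h z.
  pose c := rdot h z - complex.Re (f h).
  have Jt (t : R) : 0 <= t * c *+ 2 + t ^+ 2 * rnorm h ^+ 2.
    have := Jmin (z + t%:C *: h).
    rewrite /J fD ReD rfZ rnormD_sq rdotZr rnormZ rabs_real exprMn real_normK ?num_real //.
    rewrite (rdotC z) /c; lra.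
  apply/eqP; rewrite eq_sym -subr_eq0 -/c; apply/eqP.
  have [h0|h0] := eqVneq (rnorm h) 0.
    have := Jt (- c); rewrite h0 expr0n mulr0 addr0 => hc.
    by apply/eqP; rewrite -sqrf_eq0 eq_le sqr_ge0 andbT; nra.
  have h1 : 0 < rnorm h ^+ 2 by rewrite exprn_even_gt0.
  (* This [t] minimises the quadratic in [Jt]; the minimum is [- c^2 / |h|^2], which forces
     [c = 0]. *)
  have := Jt (- c / rnorm h ^+ 2).
  rewrite [X in X + _](_ : _ = - (c ^+ 2 / rnorm h ^+ 2) *+ 2); last by field.
  rewrite [X in _ + X](_ : _ = (c ^+ 2 / rnorm h ^+ 2)); last by field.
  move=> hq; have : c ^+ 2 / rnorm h ^+ 2 <= 0 by lra.
  rewrite pmulr_lle0 ?invr_gt0 // => hc.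
  by apply/eqP; rewrite -sqrf_eq0 eq_le sqr_ge0 andbT.
exists z => x; apply/eqP; rewrite eq_complex; apply/andP; split; apply/eqP.
  exact: Ref.
(* The real part at [i x] yields the imaginary part at [x]. *)
have := Ref ('i%C *: x); rewrite /rdot dotZl fZ.
by case: (f x) (hdot H x z) => a b [a' b'] /=; rewrite !mul0r !mul1r !sub0r => /oppr_inj.
Qed.

Lemma adj_exists T : exists T' : bop H, forall x y, hdot H (T x) y = hdot H x (T' y).
Proof.
have [M M0 TM] := bop_bounded T.
have : forall y, exists z, forall x, hdot H (T x) y = hdot H x z.
  move=> y; apply: (@riesz _ (M * rnorm y)).
    by move=> k x x'; rewrite linearP dotDl dotZl.
  move=> x; rewrite (@le_trans _ _ (rnorm (T x) * rnorm y)) ?dot_CS //.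
  by rewrite -mulrA (mulrC (rnorm y)) mulrA ler_wpM2r ?rnorm_ge0.
move=> /choice[T' T'P].
have [T1 T1E] : exists T1 : bop H, forall x, T1 x = T' x; last first.
  by exists T1 => x y; rewrite T1E.
apply: (@mkbop_exists _ M).
  move=> k x y; apply: dot_inj => z.
  by rewrite -T'P !dotDr !dotZr -!T'P.
move=> x; have [T0|T0] := eqVneq (rnorm (T' x)) 0.
  by rewrite T0 mulr_ge0 ?rnorm_ge0 ?ltW.
have T1 : 0 < rnorm (T' x) by rewrite lt_def T0 rnorm_ge0.
rewrite -(ler_pM2l T1) -expr2 -rdot_norm /rdot -T'P.
apply: le_trans (rdot_CS _ _) _; rewrite mulrA ler_wpM2r ?rnorm_ge0 // mulrC.
exact: TM.
Qed.

Lemma adjP T x y : hdot H (T x) y = hdot H x (adj T y).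
Proof.
rewrite /adj; case: xgetP => [T' _ h|h]; first exact: h.
by have [T' T'P] := adj_exists T; case: (h T').
Qed.

Lemma adjPr T x y : hdot H x (T y) = hdot H (adj T x) y.
Proof. by rewrite dotC adjP -dotC. Qed.

Lemma adj_unique T T' : (forall x y, hdot H (T x) y = hdot H x (T' y)) -> adj T = T'.
Proof. by move=> h; apply: bop_ext => y; apply: dot_inj => z; rewrite -adjP h. Qed.

Lemma adjK T : adj (adj T) = T.
Proof. by apply: adj_unique => x y; rewrite -adjPr. Qed.

End Bop.

(** * Operators given by formulas and by limits *)

Section Operators.
Variables (R : realType) (H : hilbert R).
Implicit Types (S T U : bop H) (x y z : H).

Lemma bopD T x y : T (x + y) = T x + T y. Proof. exact: linearD. Qed.
Lemma bopB T x y : T (x - y) = T x - T y. Proof. exact: linearB. Qed.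
Lemma bopZ T k x : T (k *: x) = k *: T x. Proof. exact: linearZ. Qed.
Lemma bop0 T : T 0 = 0. Proof. exact: linear0. Qed.

Definition linear_op (f : H -> H) := forall k x y, f (k *: x + y) = k *: f x + f y.
Definition obound (f : H -> H) (M : R) := forall x, rnorm (f x) <= M * rnorm x.

Lemma zero_exists : exists T : bop H, forall x, T x = 0.
Proof.
apply: (@mkbop_exists _ _ _ 0); first by move=> k x y; rewrite scaler0 addr0.
by move=> x; rewrite rnorm0 mul0r.
Qed.

(** Total in [f]: the zero operator stands in when [f] is not linear and bounded. Operator
    expressions can be written first and justified later through [mkbopE]. *)
Definition mkbop (f : H -> H) : bop H :=
  xget (projT1 (cid zero_exists)) [set T : bop H | forall x, T x = f x].

Lemma mkbopE f : linear_op f -> (exists M, obound f M) -> forall x, mkbop f x = f x.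
Proof.
move=> lf [M bf]; rewrite /mkbop; case: xgetP => [T _ //|h].
by have [T Tf] := mkbop_exists lf bf; case: (h T).
Qed.

Definition bzero : bop H := mkbop (fun=> 0).
Lemma bzeroE x : bzero x = 0.
Proof.
apply: mkbopE; first by move=> k y z; rewrite scaler0 addr0.
by exists 0 => y; rewrite rnorm0 mul0r.
Qed.

Definition bcomp S T : bop H := mkbop (fun x => S (T x)).
Lemma bcompE S T x : bcomp S T x = S (T x).
Proof.
apply: mkbopE; first by move=> k y z; rewrite !linearP.
have [M M0 SM] := bop_bounded S; have [N N0 TN] := bop_bounded T.
exists (M * N) => y; apply: le_trans (SM _) _.
by rewrite -mulrA ler_pM2l.
Qed.

Definition badd S T : bop H := mkbop (fun x => S x + T x).
Lemma baddE S T x : badd S T x = S x + T x.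
Proof.
apply: mkbopE; first by move=> k y z; rewrite !linearP /= scalerDr addrACA.
have [M M0 SM] := bop_bounded S; have [N N0 TN] := bop_bounded T.
exists (M + N) => y; apply: le_trans (rnormD _ _) _.
by rewrite mulrDl lerD.
Qed.

Definition bscale k S : bop H := mkbop (fun x => k *: S x).
Lemma bscaleE k S x : bscale k S x = k *: S x.
Proof.
apply: mkbopE; first by move=> j y z; rewrite linearP /= scalerDr !scalerA mulrC.
have [M M0 SM] := bop_bounded S.
by exists (rabs k * M) => y; rewrite rnormZ -mulrA ler_wpM2l ?rabs_ge0.
Qed.

Lemma adj_comp S T x : adj (bcomp S T) x = adj T (adj S x).
Proof. by apply: dot_inj => z; rewrite -adjP bcompE !adjP. Qed.

Lemma adj_self T : (forall x y, hdot H (T x) y = hdot H x (T y)) -> adj T = T.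
Proof. exact: adj_unique. Qed.

Lemma projectionP P : projection P <-> (forall x, P (P x) = P x) /\
  forall x y, hdot H (P x) y = hdot H x (P y).
Proof.
split=> [[PP aP]|[PP aP]]; split=> //; last exact: adj_self.
by move=> x y; rewrite adjP aP.
Qed.

Lemma proj_pyth P x : projection P -> rnorm x ^+ 2 = rnorm (P x) ^+ 2 + rnorm (x - P x) ^+ 2.
Proof.
move=> /projectionP[PP aP]; have -> : rnorm x = rnorm (P x + (x - P x)) by rewrite addrC subrK.
by rewrite [LHS]rnormD_sq /rdot dotBr !aP PP subrr /= mul0rn addr0.
Qed.

Lemma proj_le P x : projection P -> rnorm (P x) <= rnorm x.
Proof.
move=> pP; rewrite -(ler_pXn2r (n := 2)) ?nnegrE ?rnorm_ge0 //.
by rewrite (proj_pyth x pP) lerDl sqr_ge0.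
Qed.

(** [app i e] reads: the index [i] approximates within [e]. The lemma serves two completions:
    functions of [Cc] approximated by coefficient lists, with [K] the number of labels, and elements
    of the full algebra, with [K = 1]. The limit is pointwise in [x], along indices with errors
    [1/(n+1)]. *)
Lemma limit_operator (I : Type) (app : I -> R -> Prop) (rho : I -> bop H) (K : R) :
  0 <= K -> (forall e, 0 < e -> exists i, app i e) ->
  (forall i j e d, app i e -> app j d -> obound (fun x => rho i x - rho j x) (K * (e + d))) ->
  exists T : bop H, forall i e, app i e -> obound (fun x => T x - rho i x) (K * e).
Proof.
move=> K0 appE appC.
have /choice[i iP] : forall n : nat, exists i, app i n.+1%:R^-1.
  by move=> n; apply: appE; rewrite invr_gt0 ltr0n.
have archK x (e : R) : 0 < e -> exists N, forall n, (N <= n)%N -> K * n.+1%:R^-1 * rnorm x <= e.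
  move=> e0; have c0 : 0 < K * rnorm x + 1 by rewrite ltr_wpDl ?mulr_ge0 ?rnorm_ge0.
  have [N NP] := @natSinv_small R (e / (K * rnorm x + 1)) (divr_gt0 e0 c0).
  exists N => n /NP; rewrite ler_pdivlMr // => h.
  rewrite mulrAC; apply: le_trans h; rewrite mulrC ler_wpM2l ?invr_ge0 ?ler0n //.
  by rewrite lerDl.
have : forall x, exists l, forall e : R, 0 < e -> exists N, forall n, (N <= n)%N ->
    rnorm (rho (i n) x - l) <= e.
  move=> x; apply: rnorm_complete => e e0.
  have [N NP] := archK x (e / 2) (divr_gt0 e0 (ltr0Sn _ 1)).
  exists N => m n Nm Nn; apply: le_trans (appC _ _ _ _ (iP m) (iP n) x) _.
  by rewrite mulrDr mulrDl [leRHS]splitr lerD // NP.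
move=> /choice[T0 T0P].
have T0b j e x : app j e -> rnorm (T0 x - rho j x) <= K * e * rnorm x.
  move=> je; apply/ler_addgt0Pr => d d0.
  have d2 : 0 < d / 2 by rewrite divr_gt0.
  have [N1 N1P] := T0P x _ d2; have [N2 N2P] := archK x _ d2.
  pose n := maxn N1 N2.
  have h1 := N1P n (leq_maxl _ _); have h2 := N2P n (leq_maxr _ _).
  have h3 : rnorm (rho (i n) x - rho j x) <= K * n.+1%:R^-1 * rnorm x + K * e * rnorm x.
    by rewrite -mulrDl -mulrDr; exact: appC.
  have h4 := rnorm_dist (T0 x) (rho (i n) x) (rho j x).
  rewrite (rnormB (T0 x) (rho (i n) x)) in h4.
  move: (K * _ * _) h2 h3 => u h2 h3; move: (K * e * _) h3 => v h3.
  move: (rnorm _) (rnorm _) (rnorm _) h1 h3 h4 => r s t h1 h3 h4. lra.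
have T0l : linear_op T0.
  move=> k x y; apply/subr0_eq/rnorm0_eq0/ler_addgt0Pr => d d0.
  (* Three errors enter, one of them scaled by [rabs k]. *)
  have e0 : 0 < d / (2 + rabs k) / 1 by rewrite divr1 divr_gt0 // ltr_wpDr ?rabs_ge0.
  rewrite divr1 in e0; set e := d / _ in e0.
  have [N1 N1P] := T0P x _ e0; have [N2 N2P] := T0P y _ e0.
  have [N3 N3P] := T0P (k *: x + y) _ e0.
  pose n := maxn (maxn N1 N2) N3.
  have h1 : rnorm (rho (i n) x - T0 x) <= e by apply: N1P; rewrite /n -maxnA leq_maxl.
  have h2 : rnorm (rho (i n) y - T0 y) <= e by apply: N2P; rewrite /n maxnAC leq_maxr.
  have h3 : rnorm (rho (i n) (k *: x + y) - T0 (k *: x + y)) <= e.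
    by apply: N3P; rewrite leq_maxr.
  have -> : T0 (k *: x + y) - (k *: T0 x + T0 y) =
      (T0 (k *: x + y) - rho (i n) (k *: x + y)) +
      (k *: (rho (i n) x - T0 x) + (rho (i n) y - T0 y)).
    by rewrite linearP /= scalerBr [X in _ = _ + X]addrACA -opprD addrA subrK.
  apply: le_trans (rnormD _ _) _; rewrite rnormB.
  have := rnormD (k *: (rho (i n) x - T0 x)) (rho (i n) y - T0 y); rewrite rnormZ.
  have : rabs k * rnorm (rho (i n) x - T0 x) <= rabs k * e by rewrite ler_wpM2l ?rabs_ge0.
  have : e * (2 + rabs k) = d by rewrite divfK // gt_eqF // ltr_wpDr ?rabs_ge0.
  rewrite add0r; lra.
have T0B : exists M, obound T0 M.
  have [j je] := appE 1 ltr01; have [M M0 jM] := bop_bounded (rho j).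
  exists (K + M) => x; rewrite -(subrK (rho j x) (T0 x)).
  apply: le_trans (rnormD _ _) _; rewrite mulrDl lerD //.
  by have := T0b _ _ x je; rewrite mulr1.
exists (mkbop T0) => j e je x; rewrite mkbopE //; exact: T0b.
Qed.

Lemma obound_eq0 (f : H -> H) (K : R) : (forall e, 0 < e -> obound f (K * e)) -> forall x, f x = 0.
Proof.
move=> fK x; apply/rnorm0_eq0/ler_addgt0Pr => d d0; rewrite add0r.
have c0 : 0 < `|K| * rnorm x + 1 by rewrite ltr_wpDl ?mulr_ge0 ?rnorm_ge0.
apply: le_trans (fK (d / (`|K| * rnorm x + 1)) (divr_gt0 d0 c0) x) _.
rewrite (@le_trans _ _ (`|K| * (d / (`|K| * rnorm x + 1)) * rnorm x)) //.
  by rewrite ler_wpM2r ?rnorm_ge0 // ler_wpM2r ?ler_norm // ltW // divr_gt0.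
have -> : `|K| * (d / (`|K| * rnorm x + 1)) * rnorm x =
  d * ((`|K| * rnorm x) / (`|K| * rnorm x + 1)) by ring.
rewrite -[leRHS]mulr1 ler_wpM2l ?(ltW d0) //.
by rewrite ler_pdivrMr // mul1r lerDl.
Qed.

End Operators.

(** * Strong sums of orthogonal projections *)

Section OrthogonalSums.
Variables (R : realType) (H : hilbert R) (I : choiceType) (D : set I) (T : I -> bop H).
Hypothesis Tproj : forall i, D i -> projection (T i).
Hypothesis Torth : forall i j, D i -> D j -> i <> j -> forall x, T i (T j x) = 0.
Implicit Types (x y : H) (F : {fset I}).

Let psum F x := \sum_(i <- F) T i x.

Lemma psum_lin F k x y : psum F (k *: x + y) = k *: psum F x + psum F y.
Proof.
rewrite /psum scaler_sumr -big_split; apply: eq_bigr => i _.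
by rewrite bopD bopZ.
Qed.

Lemma psum_proj F F' x : (F `<=` F')%fset -> [set` F'] `<=` D ->
  psum F (psum F' x) = psum F x.
Proof.
move=> FF' F'D; rewrite /psum big_seq [RHS]big_seq; apply: eq_bigr => i iF.
have iF' : i \in F' := fsubsetP FF' _ iF.
have Di : D i := F'D _ iF'.
rewrite (raddf_sum (T i)) (bigD1_seq i) ?fset_uniq //= (proj1 (Tproj Di)) big_seq_cond.
rewrite big1 ?addr0 // => j /andP[jF' /eqP ji].
by apply: Torth => // [|/esym//]; exact: F'D.
Qed.

Lemma psum_dot F x y : [set` F] `<=` D -> hdot H (psum F x) y = hdot H x (psum F y).
Proof.
move=> FD; rewrite /psum.
rewrite (big_morph (fun z => hdot H z y) (fun u v : H => dotDl u v y) (dot0l y)).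
rewrite (big_morph (fun z => hdot H x z) (fun u v : H => dotDr x u v) (dot0r x)).
rewrite big_seq [RHS]big_seq; apply: eq_bigr => i iF.
by have /projectionP[_ ->] := Tproj (FD _ iF).
Qed.

Lemma psum_adj F x y : [set` F] `<=` D -> rdot (psum F x) y = rdot x (psum F y).
Proof. by move=> FD; rewrite /rdot psum_dot. Qed.

Lemma psum_norm F x : [set` F] `<=` D -> rnorm (psum F x) ^+ 2 = rdot (psum F x) x.
Proof. by move=> FD; rewrite -rdot_norm psum_adj // psum_proj // rdotC. Qed.

Lemma psum_le F x : [set` F] `<=` D -> rnorm (psum F x) <= rnorm x.
Proof.
move=> FD; have [->|n0] := eqVneq (rnorm (psum F x)) 0; first exact: rnorm_ge0.
have n1 : 0 < rnorm (psum F x) by rewrite lt_def n0 rnorm_ge0.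
by rewrite -(ler_pM2l n1) -expr2 psum_norm // rdot_CS.
Qed.

Lemma psum_diff F F' x : (F `<=` F')%fset -> [set` F'] `<=` D ->
  rnorm (psum F' x - psum F x) ^+ 2 = rdot (psum F' x) x - rdot (psum F x) x.
Proof.
move=> FF' F'D; have FD : [set` F] `<=` D by move=> i /(fsubsetP FF')/F'D.
rewrite rnormD_sq rnormN rdotNr !psum_norm // -psum_adj //.
rewrite psum_adj // rdotC psum_adj // -[rdot x _]rdotC psum_proj //; lra.
Qed.

(** The numbers [rdot (psum F x) x] increase with [F] and are bounded by [|x|^2]. Within [e^2] of
    their supremum, [psum_diff] leaves room only for differences of norm at most [e]. *)
Lemma psum_cauchy x (e : R) : 0 < e -> exists2 F0, [set` F0] `<=` D &
  forall F, (F0 `<=` F)%fset -> [set` F] `<=` D -> rnorm (psum F x - psum F0 x) <= e.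
Proof.
move=> e0; pose V := [set r : R | exists2 F, [set` F] `<=` D & r = rdot (psum F x) x].
have V0 : has_sup V.
  split; first by exists (rdot (psum fset0 x) x), fset0.
  exists (rnorm x ^+ 2) => _ [F FD ->]; rewrite -psum_norm //.
  by rewrite ler_pXn2r ?nnegrE ?rnorm_ge0 // psum_le.
have e2 : 0 < e ^+ 2 by rewrite exprn_gt0.
have [_ [F0 F0D ->] supF0] := sup_adherent e2 V0.
exists F0 => // F F0F FD; rewrite -(ler_pXn2r (n := 2)) ?nnegrE ?rnorm_ge0 ?(ltW e0) //.
rewrite psum_diff //; have : V (rdot (psum F x) x) by exists F.
move=> /(sup_upper_bound V0); lra.
Qed.

Lemma fsetU_D F F' : [set` F] `<=` D -> [set` F'] `<=` D -> [set` (F `|` F')%fset] `<=` D.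
Proof. by move=> FD FD' i /fsetUP[/FD|/FD']. Qed.

(** The index set may be uncountable, so the net is thinned to a sequence of finite sets with Cauchy
    error [1/(n+1)]; a union of two of them compares their sums. *)
Lemma psum_limit x : exists y, forall e : R, 0 < e -> exists2 F0, [set` F0] `<=` D &
  forall F, (F0 `<=` F)%fset -> [set` F] `<=` D -> rnorm (psum F x - y) <= e.
Proof.
have /choice[u uP] : forall n : nat, exists F0, [set` F0] `<=` D /\
    forall F, (F0 `<=` F)%fset -> [set` F] `<=` D -> rnorm (psum F x - psum F0 x) <= n.+1%:R^-1.
  move=> n; have [|F0 F0D F0P] := @psum_cauchy x n.+1%:R^-1; first by rewrite invr_gt0.
  by exists F0.
have [y yP] : exists y, forall e : R, 0 < e -> exists N, forall n, (N <= n)%N ->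
    rnorm (psum (u n) x - y) <= e.
  apply: rnorm_complete => e e0; have e2 : 0 < e / 2 by rewrite divr_gt0.
  have [N NP] := natSinv_small e2; exists N => m n Nm Nn.
  have [um umP] := uP m; have [un unP] := uP n; have umn := fsetU_D um un.
  have h1 := le_trans (umP _ (fsubsetUl _ _) umn) (NP m Nm).
  have h2 := le_trans (unP _ (fsubsetUr _ _) umn) (NP n Nn).
  have := rnorm_dist (psum (u m) x) (psum (u m `|` u n)%fset x) (psum (u n) x).
  rewrite (rnormB (psum (u m) x) (psum (_ `|` _)%fset x)); lra.
exists y => e e0; have e2 : 0 < e / 2 by rewrite divr_gt0.
have [N1 N1P] := natSinv_small e2; have [N2 N2P] := yP _ e2.
pose n := maxn N1 N2; have [un unP] := uP n; exists (u n) => // F unF FD.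
have := le_trans (unP F unF FD) (N1P n (leq_maxl _ _)); have := N2P n (leq_maxr _ _).
have := rnorm_dist (psum F x) (psum (u n) x) y; lra.
Qed.

Lemma sot_sumP (S : H -> H) : sot_sum D (fun i x => T i x) S <->
  forall x (e : R), 0 < e -> exists2 F0, [set` F0] `<=` D &
  forall F, (F0 `<=` F)%fset -> [set` F] `<=` D -> rnorm (psum F x - S x) <= e.
Proof.
split=> [h x e e0|h x U /nbhs_rnormP[e e0 eU]].
  have [|F0 F0D F0P] := h x [set y | rnorm (S x - y) < e].
    by apply/nbhs_rnormP; exists e.
  by exists F0 => // F F0F FD; rewrite rnormB; apply/ltW/F0P.
have e2 : 0 < e / 2 by rewrite divr_gt0.
have [F0 F0D F0P] := h x _ e2; exists F0 => // F F0F FD; apply: eU.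
have := F0P F F0F FD; rewrite rnormB /psum; lra.
Qed.

(** Provides the sum in condition (v). The strong limit [Q] is again a projection, and
    [P Q = Q = Q P] makes [P - Q] one, whence the positivity. *)
Lemma sot_orth_proj (P : bop H) : projection P -> (forall i, D i -> forall x, P (T i x) = T i x) ->
  exists2 Q : bop H, sot_sum D (fun i x => T i x) Q & op_le Q P.
Proof.
move=> Pp PT; have /projectionP[PP Pa] := Pp.
have [Q0 Q0P] := choice psum_limit.
have Q0lin : linear_op Q0.
  move=> k x y; apply/subr0_eq/rnorm0_eq0/ler_addgt0Pr => e e0; rewrite add0r.
  pose K := 2 + rabs k; have K0 : 0 < K by rewrite ltr_wpDr ?rabs_ge0.
  have eK : 0 < e / K by rewrite divr_gt0.
  have [F1 F1D F1P] := Q0P x _ eK; have [F2 F2D F2P] := Q0P y _ eK.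
  have [F3 F3D F3P] := Q0P (k *: x + y) _ eK.
  pose F := (F1 `|` (F2 `|` F3))%fset.
  have FD : [set` F] `<=` D by do !apply: fsetU_D.
  have h1 := F1P F (fsubsetUl _ _) FD.
  have h2 := F2P F (fsubset_trans (fsubsetUl _ _) (fsubsetUr _ _)) FD.
  have := F3P F (fsubset_trans (fsubsetUr _ _) (fsubsetUr _ _)) FD.
  have -> : Q0 (k *: x + y) - (k *: Q0 x + Q0 y) =
    (k *: (psum F x - Q0 x) + (psum F y - Q0 y)) - (psum F (k *: x + y) - Q0 (k *: x + y)).
    by rewrite psum_lin scalerBr [X in _ = X - _]addrACA -opprD opprB [RHS]addrC subrKA.
  have := rnormD (k *: (psum F x - Q0 x) + (psum F y - Q0 y)) (- (psum F (k *: x + y) - Q0 (k *: x + y))).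
  have := rnormD (k *: (psum F x - Q0 x)) (psum F y - Q0 y); rewrite rnormN rnormZ.
  have : rabs k * rnorm (psum F x - Q0 x) <= rabs k * (e / K) by rewrite ler_wpM2l ?rabs_ge0.
  have : e / K * K = e by rewrite divfK // gt_eqF.
  rewrite /K mulrDr (mulrC _ (rabs k)); lra.
have Qb : obound Q0 1.
  move=> x; rewrite mul1r; apply/ler_addgt0Pr => e e0; have [F FD FP] := Q0P x _ e0.
  have := FP F (fsubset_refl _) FD; have := psum_le x FD.
  have := rnorm_dist (Q0 x) (psum F x) 0; rewrite !subr0 (rnormB (Q0 x)); lra.
pose Q := mkbop Q0; have QE x : Q x = Q0 x by apply: mkbopE => //; exists 1.
exists Q; first by apply/sot_sumP => x e /(Q0P x); rewrite QE.
have Qlim x (e : R) : 0 < e -> exists2 F0, [set` F0] `<=` D &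
    forall F, (F0 `<=` F)%fset -> [set` F] `<=` D -> rnorm (psum F x - Q x) <= e.
  by rewrite QE; exact: Q0P.
have Qadj x y : hdot H (Q x) y = hdot H x (Q y).
  apply/subr0_eq/rabs0_eq0/ler_addgt0Pr => e e0; rewrite add0r.
  pose K := rnorm x + rnorm y + 1; have K0 : 0 < K by rewrite ltr_wpDl ?addr_ge0 ?rnorm_ge0.
  have eK : 0 < e / K by rewrite divr_gt0.
  have [F1 F1D F1P] := Qlim x _ eK; have [F2 F2D F2P] := Qlim y _ eK.
  have FD := fsetU_D F1D F2D.
  have h1 := F1P _ (fsubsetUl _ _) FD; have h2 := F2P _ (fsubsetUr _ _) FD.
  move: (F1 `|` F2)%fset FD h1 h2 => F FD h1 h2.
  have -> : hdot H (Q x) y - hdot H x (Q y) =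
      hdot H x (psum F y - Q y) - hdot H (psum F x - Q x) y.
    by rewrite dotBl dotBr psum_dot // opprB [RHS]addrC subrKA.
  apply: le_trans (rabsD _ _) _; rewrite rabsN.
  have g1 := dot_CS x (psum F y - Q y); have g2 := dot_CS (psum F x - Q x) y.
  have g3 : rnorm x * rnorm (psum F y - Q y) <= rnorm x * (e / K) by rewrite ler_wpM2l ?rnorm_ge0.
  have g4 : rnorm (psum F x - Q x) * rnorm y <= e / K * rnorm y by rewrite ler_wpM2r ?rnorm_ge0.
  have : e / K * K = e by rewrite divfK // gt_eqF.
  rewrite /K !mulrDr mulr1 (mulrC _ (rnorm x)); move: eK; lra.
have SQ F x : [set` F] `<=` D -> psum F (Q x) = psum F x.
  move=> FD; apply/subr0_eq/rnorm0_eq0/ler_addgt0Pr => e e0; rewrite add0r.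
  have [F1 F1D F1P] := Qlim x _ e0; have UD := fsetU_D FD F1D.
  have := F1P _ (fsubsetUr _ _) UD; rewrite rnormB; apply: le_trans.
  rewrite -(psum_proj x (fsubsetUl F F1) UD).
  have -> : psum F (Q x) - psum F (psum (F `|` F1)%fset x) = psum F (Q x - psum (F `|` F1)%fset x).
    by rewrite addrC -scaleN1r -psum_lin scaleN1r addrC.
  exact: psum_le.
have QQ x : Q (Q x) = Q x.
  apply/subr0_eq/rnorm0_eq0/ler_addgt0Pr => e e0; rewrite add0r.
  have e2 : 0 < e / 2 by rewrite divr_gt0.
  have [F1 F1D F1P] := Qlim x _ e2; have [F2 F2D F2P] := Qlim (Q x) _ e2.
  have FD := fsetU_D F1D F2D.
  have h1 := F1P _ (fsubsetUl _ _) FD; have := F2P _ (fsubsetUr _ _) FD; rewrite SQ // => h2.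
  have := rnorm_dist (Q (Q x)) (psum (F1 `|` F2)%fset x) (Q x).
  rewrite (rnormB (Q (Q x)) (psum _ x)); lra.
have PQ x : P (Q x) = Q x.
  apply/subr0_eq/rnorm0_eq0/ler_addgt0Pr => e e0; rewrite add0r.
  have e2 : 0 < e / 2 by rewrite divr_gt0.
  have [F FD /(_ F (fsubset_refl _) FD) h] := Qlim x _ e2.
  have PS : P (psum F x) = psum F x.
    by rewrite /psum raddf_sum big_seq [RHS]big_seq; apply: eq_bigr => i iF /=; rewrite (PT _ (FD _ iF)).
  have := rnorm_dist (P (Q x)) (psum F x) (Q x).
  have := proj_le (Q x - psum F x) Pp; rewrite bopB PS (rnormB (Q x) (psum F x)); lra.
have QP x : Q (P x) = Q x by apply: dot_inj => z; rewrite -Qadj -Pa PQ Qadj.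
move=> x; have -> : hdot H (P x - Q x) x = hdot H (P x - Q x) (P x - Q x).
  rewrite [RHS]dotBr -Pa -Qadj bopB PP PQ bopB QP QQ subrr dot0l subr0.
  by [].
by rewrite dot_norm lecR sqr_ge0.
Qed.

End OrthogonalSums.

(** * Directed paths and the spectrum of the cover *)

Section DirectedPaths.
Variable E : digraph.
Implicit Types (p q c d : gpath E) (e f : edge E) (s t L : seq (edge E)).

(** Of two letters that cancel only one is positive. Hence directed paths multiply by plain
    concatenation. *)
Lemma directed_reduced (D : digraph) (s : seq (edge D)) : all (@dpos D) s -> reduced s.
Proof.
elim: s => // e s IH /andP[de ds]; rewrite reduced_cons IH // andbT.
case: s ds {IH} => // f s /andP[df _].
by apply: contraTneq df => ->; rewrite dpos_bar de.
Qed.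

Lemma reduced_cat s t : reduced (s ++ t) =
  [&& reduced s, reduced t & if t is f :: _ then (s == [::]) || (f != ebar (last f s)) else true].
Proof.
rewrite /reduced; case: s => [|e s] /=.
  by case: t => //= f t; rewrite andbT.
rewrite cat_path; case: t => [|f t] /=; first by rewrite !andbT.
by congr (_ && _); rewrite andbC.
Qed.

Lemma wmul_cat s t : reduced (s ++ t) -> wmul s t = s ++ t.
Proof.
elim: s => // e s IH; rewrite cat_cons reduced_cons => /andP[es rs].
by rewrite [LHS]/= IH // push_cons // reduced_cons es.
Qed.

Lemma pe_pmul_cat p d : pt p = po d -> reduced (pe p ++ pe d) ->
  pe (pmul p d) = pe p ++ pe d.
Proof. by move=> pd r; rewrite (pmulE pd) wmul_cat. Qed.

Lemma pe_pmul_dir p d : pt p = po d -> directed p -> directed d ->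
  pe (pmul p d) = pe p ++ pe d.
Proof.
move=> pd dp dd; rewrite pe_pmul_cat //; apply: directed_reduced.
by rewrite all_cat; apply/andP; split.
Qed.

Lemma directed_pmul p d : pt p = po d -> directed p -> directed d -> directed (pmul p d).
Proof.
by move=> pd dp dd; rewrite /directed pe_pmul_dir // all_cat; apply/andP; split.
Qed.

Lemma directed1 e : directed (path1 e) = dpos e.
Proof. by rewrite /directed /= andbT. Qed.

Lemma po_pmul p q : pt p = po q -> po (pmul p q) = po p.
Proof. by move=> pq; rewrite (pmulE pq). Qed.

Lemma pe0_path0 p : pe p = [::] -> p = path0 (po p).
Proof. by move=> p0; apply: gpath_ext. Qed.

Lemma pt_pe0 p : pe p = [::] -> pt p = po p.
Proof. by rewrite /pt => ->. Qed.

Lemma gpath_uncons p e s : pe p = e :: s ->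
  po p = eo e /\ exists d, [/\ p = pmul (path1 e) d, po d = et e & pe d = s].
Proof.
move=> pes; have := pe_chain p; have := pe_reduced p; rewrite pes => rs /=.
move=> /andP[/eqP ep cs]; split=> //.
have h : chain (et e, s).1 (et e, s).2 && reduced (et e, s).2.
  by rewrite /= cs (reduced_tl rs).
pose d : gpath E := exist _ (et e, s) h.
have ed : pt (path1 e) = po d by [].
exists d; split=> //; apply: gpath_ext; first by rewrite po_pmul.
by rewrite pe_pmul_cat.
Qed.

Lemma gpath_take p n : exists c d, [/\ p = pmul c d, pt c = po d, po c = po p,
  pe c = take n (pe p) & pe d = drop n (pe p)].
Proof.
have := pe_chain p; have := pe_reduced p.
rewrite -{1 2}(cat_take_drop n (pe p)) reduced_cat chain_cat.
move=> /and3P[r1 r2 _] /andP[c1 c2].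
have h1 : chain (po p, take n (pe p)).1 (po p, take n (pe p)).2 && reduced (po p, take n (pe p)).2.
  by rewrite /= c1 r1.
pose c : gpath E := exist _ (po p, take n (pe p)) h1.
have h2 : chain (pt c, drop n (pe p)).1 (pt c, drop n (pe p)).2 && reduced (pt c, drop n (pe p)).2.
  by rewrite /= r2 andbT.
pose d : gpath E := exist _ (pt c, drop n (pe p)) h2.
exists c, d; have cd : pt c = po d by [].
split=> //; apply: gpath_ext; first by rewrite po_pmul.
rewrite pe_pmul_cat //; first by rewrite /pe /= cat_take_drop.
by rewrite /pe /= cat_take_drop; exact: pe_reduced.
Qed.

End DirectedPaths.

(** * The sets V(p;F) of the cover described by words *)

Section Cover.
Variable E : digraph.
Local Notation T := (ucover E).
Implicit Types (p q c d : gpath E) (e f : edge E) (s t L : seq (edge E)).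
Implicit Types (B C : set (gpath E)).

Lemma tedge_subproof p e (h : pt p = eo e) : cedge_pred (p, pmul p (path1 e)).
Proof. by rewrite /cedge_pred /= po_pmul // eqxx pmulK. Qed.
Definition tedge p e (h : pt p = eo e) : edge T := Sub (p, pmul p (path1 e)) (tedge_subproof h).

Lemma clabel_tedge p e (h : pt p = eo e) : clabel (tedge h) = path1 e.
Proof. by rewrite /clabel /= pmulK. Qed.

Lemma clabelE (a : edge T) : exists e (h : pt (co a) = eo e), a = tedge h.
Proof.
have hp := cedge_po a; case/andP: (valP a) => _.
rewrite -/(co a) -/(ct a) -/(clabel a); case ec : (pe (clabel a)) => [|e []] // _.
have [pc _] := gpath_uncons ec.
have h : pt (co a) = eo e by rewrite -pc po_pmul // pt_pinv.
exists e, h; apply: val_inj; rewrite [LHS]surjective_pairing /=; congr pair.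
rewrite -[LHS](@pmulKV _ (co a)) // -/(clabel a); congr pmul.
by apply: gpath_ext.
Qed.

Lemma dpos_tedge p e (h : pt p = eo e) : @dpos T (tedge h) = dpos e.
Proof. by rewrite /= /cpos clabel_tedge directed1. Qed.

Lemma chain_directed (s : seq (edge T)) p : @chain T p s -> all (@dpos T) s ->
  let q := last p (map (@et T) s) in po p = po q /\ directed (pmul (pinv p) q).
Proof.
elim: s p => [p _ _|a s IH p /andP[/eqP ap cs] /andP[da ds]].
  by rewrite /= pmulV.
have [h1 h2] := IH _ cs ds; rewrite [last p _]/= in h1 h2 *.
set q := last _ _ in h1 h2 *.
have pa : po p = po (ct a) by rewrite -ap -cedge_po.
have aq : pt (pmul (pinv p) (ct a)) = po (pmul (pinv (ct a)) q).
  by rewrite pt_pmul ?pt_pinv // po_pmul ?pt_pinv.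
split; first by rewrite pa.
suff -> : pmul (pinv p) q = pmul (pmul (pinv p) (ct a)) (pmul (pinv (ct a)) q).
  by apply: directed_pmul => //; rewrite -ap; exact: da.
rewrite pmulA ?pt_pinv //; last by rewrite po_pmul // pt_pinv.
by rewrite pmulKV.
Qed.

Lemma VsetE p q : @Vset T p q <-> po p = po q /\ directed (pmul (pinv p) q).
Proof.
split=> [[w [dw pw qw]]|].
  have := pe_chain w; rewrite pw => cw; have := chain_directed cw dw.
  by rewrite /= -[in last p]pw -/(pt w) qw.
move=> [pq]; set d := pmul _ _ => dd.
have [s sE] : exists s, pe d = s by exists (pe d).
have qE : q = pmul p d by rewrite pmulKV.
have pd : pt p = po d by rewrite po_pmul // pt_pinv.
(* The word is detached from [q], so that the induction on its length can move the base point
   [p]. *)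
clearbody d; elim: s p d dd sE qE pd {pq} => [|e s IH] p d dd sE qE pd.
  rewrite (pe0_path0 sE) -pd pmulp0 in qE; rewrite qE.
  by exists (path0 (p : vertex T)).
have [de [d' [dE d'o d'e]]] := gpath_uncons sE.
move: dd; rewrite /directed sE /= => /andP[dpe ds].
have h : pt p = eo e by rewrite pd.
have [w [dw wo wt]] : @Vset T (pmul p (path1 e)) q.
  apply: (IH _ d') => //; first by rewrite /directed d'e.
    by rewrite qE dE pmulA.
  by rewrite pt_pmul.
have da : @dpos T (tedge h) by rewrite dpos_tedge.
have hw : @chain T p (tedge h :: pe w) && reduced (tedge h :: pe w).
  apply/andP; split.
    apply/andP; split; first exact: eqxx.
    by have := pe_chain w; rewrite wo.
  by apply: directed_reduced; apply/andP.
exists (exist _ (p : vertex T, tedge h :: pe w) hw); split=> //.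
  by apply/andP.
by rewrite -wt /pt /po /pe /= -[X in last X _]wo.
Qed.

(* [V(p;F)] in the cover, with [F] given by a list of edges of [E] through the
   labels of its elements; [L] may contain further edges. *)
Definition VL p L : set (gpath E) :=
  [set q | po p = po q /\ let c := pe (pmul (pinv p) q) in
    all (@dpos E) c /\ (if c is e :: _ then e \notin L else true)].

Lemma VLP p L q : VL p L q <-> exists d, [/\ q = pmul p d, pt p = po d, directed d &
  if pe d is e :: _ then e \notin L else true].
Proof.
split=> [[pq [h1 h2]]|[d [-> pd dd h]]].
  by exists (pmul (pinv p) q); split; rewrite ?pmulKV // po_pmul // pt_pinv.
by split; rewrite ?po_pmul //= pmulK.
Qed.

Lemma VL_pmul p d : pt p = po d -> directed d -> VL p [::] (pmul p d).
Proof. by move=> pd dd; apply/VLP; exists d; split=> //; case: pe. Qed.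

Lemma VL0 p : VL p [::] = @Vset T p.
Proof.
apply/seteqP; split=> q; first by move=> [pq [h _]]; apply/VsetE.
by move=> /VsetE[pq h]; split=> //=; split=> //; case: pe.
Qed.

(** An edge leaving [p] is known from its label, and the branch behind it consists of the words that
    begin with this label; so only the first letter of [d] has to be tested. *)
Lemma VFsetE p (F : set (edge T)) q : F `<=` @Delta1 T p ->
  (@VFset T p F q <-> exists d, [/\ q = pmul p d, pt p = po d, directed d &
    if pe d is e :: _ then forall a, F a -> pe (clabel a) <> [:: e] else True]).
Proof.
move=> FD; split.
  move=> [/= ->|[a [[da ap] nFa] /VsetE [aq aqd]]].
    by exists (path0 (pt p)); rewrite pmulp0.
  have [e [h0 aE0]] := clabelE a.
  have h : pt p = eo e by rewrite -h0 -[co a]/(@eo T a) ap.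
  have aE : a = tedge h.
    by rewrite [LHS]aE0; apply: val_inj => /=; rewrite -[co a]/(@eo T a) ap.
  exists (pmul (path1 e) (pmul (pinv (et a)) q)).
  have paE : et a = pmul p (path1 e) by rewrite aE.
  have ed : pt (path1 e) = po (pmul (pinv (et a)) q).
    by rewrite po_pmul ?pt_pinv // po_pinv paE pt_pmul.
  have de : directed (path1 e) by rewrite directed1 -(dpos_tedge h) -aE.
  split; first by rewrite -pmulA // -paE pmulKV.
  - by rewrite po_pmul.
  - exact: directed_pmul.
  - rewrite pe_pmul_dir //= => b Fb; have [e' [h' bE]] := clabelE b.
    rewrite bE clabel_tedge /= => -[ee'].
    apply: nFa; rewrite (_ : a = b) // bE aE; apply: val_inj => /=.
    by have [_ bp] := FD b Fb; rewrite -[co b]/(@eo T b) bp ee'.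
move=> [d [qE pd dd]]; case sE : (pe d) => [|e s] h.
  by left; rewrite qE (pe0_path0 sE) -pd pmulp0.
have [de [d' [dE d'o d'e]]] := gpath_uncons sE.
have pe' : pt p = eo e by rewrite pd.
move: dd; rewrite /directed sE /= => /andP[dpe ds].
right; exists (tedge pe').
  split; first by split => //; rewrite dpos_tedge.
  by move=> /h; rewrite clabel_tedge.
have aE : et (tedge pe') = pmul p (path1 e) by [].
apply/VsetE; rewrite aE qE dE -pmulA //; split; last first.
  by rewrite pmulK ?pt_pmul // /directed d'e.
by rewrite [RHS]po_pmul // pt_pmul.
Qed.

Lemma VFset_VL p (F : set (edge T)) : finite_set F -> F `<=` @Delta1 T p ->
  exists L, @VFset T p F = VL p L.
Proof.
move=> /finite_seqP[s sE] FD.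
exists (flatten (map (fun a : edge T => pe (clabel a)) s)).
apply/seteqP; split=> q.
  move=> /(VFsetE _ FD)[d [qE pd dd h]]; apply/VLP; exists d; split=> //.
  case: (pe d) h => // e t h; apply/flattenP => -[_ /mapP[a sa ->] ea].
  have Fa : F a by rewrite sE.
  apply: (h a Fa); have [e' [h' aE]] := clabelE a.
  by move: ea; rewrite aE clabel_tedge inE => /eqP ->.
move=> /VLP[d [qE pd dd h]]; apply/(VFsetE _ FD); exists d; split=> //.
case: (pe d) h => // e t /flattenP h a; rewrite sE => sa ae.
by apply: h; exists (pe (clabel a)); [exact: map_f|rewrite ae inE].
Qed.

(** [L] is an arbitrary list, so [F] keeps the cover edges at [p] whose label occurs in it.
    Finiteness comes from the injectivity of labels on edges with a common origin. *)
Lemma VL_VFset p L : exists F, [/\ finite_set F, F `<=` @Delta1 T p & VL p L = @VFset T p F].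
Proof.
pose F : set (edge T) := [set a | @Delta1 T p a /\ exists2 e, e \in L & pe (clabel a) = [:: e]].
have FD : F `<=` @Delta1 T p by move=> a [].
exists F; split=> //.
  pose g (a : edge T) := pe (clabel a).
  have injg : set_inj F g.
    move=> a b /set_mem[[_ ap] _] /set_mem[[_ bp] _]; rewrite /g => ab.
    have [e [h aE]] := clabelE a; have [f [h' bE]] := clabelE b.
    move: ab; rewrite {1}aE {1}bE !clabel_tedge => -[ef].
    by rewrite aE bE; apply: val_inj; rewrite /= -[co a]/(@eo T a) ap -[co b]/(@eo T b) bp ef.
  apply: (card_le_finite _ (finite_image (fun e => [:: e]) (finite_seq L))).
  rewrite -(card_le_eql (inj_card_eq injg)).
  by apply: subset_card_le => _ [a [_ [e eL ae]] <-]; exists e.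
apply/seteqP; split=> q.
  move=> /VLP[d [qE pd dd h]]; apply/(VFsetE _ FD); exists d; split=> //.
  by case: (pe d) h => // e t h a [_ [e' e'L ->]] [ee']; move: h; rewrite -ee' e'L.
move=> /(VFsetE _ FD)[d [qE pd dd h]]; apply/VLP; exists d; split=> //.
move: dd; rewrite /directed; case sE : (pe d) h => [|e t] //= h /andP[de _].
have [he _] := gpath_uncons sE; have pe' : pt p = eo e by rewrite pd.
apply/negP => eL; apply: (h (tedge pe')); last by rewrite clabel_tedge.
split; first by split=> //; rewrite dpos_tedge.
by exists e => //; rewrite clabel_tedge.
Qed.

End Cover.

(** * Ultrafilters and their directed prefixes *)

Section Spectrum.
Variable E : digraph.
Local Notation T := (ucover E).
Local Notation G := (toeplitz_groupoid E).
Implicit Types (p q r c d w a : gpath E) (e f : edge E) (s t L : seq (edge E)).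
Implicit Types (B C : set (gpath E)) (x y : spectrum T) (g h : G).

Lemma ringA_VL p L : @ringA T (VL p L).
Proof.
have [F [fF FD ->]] := VL_VFset p L; rewrite -[VFset _ _]setU0.
by apply: ringAU => //; [rewrite setI0|exact: ringA0].
Qed.

(** The disjointness in [ringA] is dropped, so that inductions only have to treat unions. *)
Lemma ringA_VL_ind (P : set (gpath E) -> Prop) : P set0 ->
  (forall p L B, P B -> P (VL p L `|` B)) -> forall B, @ringA T B -> P B.
Proof.
move=> P0 PU B; elim=> // p F B' fF FD _ _ PB'.
by have [L ->] := VFset_VL fF FD; exact: PU.
Qed.

Lemma VLS p L M : {subset L <= M} -> VL p M `<=` VL p L.
Proof.
move=> LM q /VLP[d [qE pd dd h]]; apply/VLP; exists d; split=> //.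
by case: (pe d) h => // e t; apply: contra; exact: LM.
Qed.

Lemma VL_id p L : VL p L p.
Proof. by apply/VLP; exists (path0 (pt p)); rewrite pmulp0. Qed.

Lemma VL_trans p q : VL p [::] q -> VL q [::] `<=` VL p [::].
Proof.
move=> /VLP[d [-> pd dd _]] r /VLP[d' [-> pd' dd' _]]; apply/VLP.
rewrite pt_pmul // in pd'; exists (pmul d d'); rewrite pmulA // po_pmul //.
by split=> //; [exact: directed_pmul|case: pe].
Qed.

(* [c] is the word leading from [w] to [p]; if it does not cancel against the
   directed words [d] then the position of [p d] relative to [w] does not depend
   on [d]. *)
Lemma VL_rigid p w M (K : set (gpath E)) : po w = po p ->
  pe (pmul (pinv w) p) != [::] ->
  (forall q, K q -> exists d, [/\ q = pmul p d, pt p = po d, directed d &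
     reduced (pe (pmul (pinv w) p) ++ pe d)]) ->
  K `<=` VL w M \/ K `&` VL w M = set0.
Proof.
move=> wp c0 KP; set c := pmul _ _ in c0 KP.
have Kc q : K q -> po w = po q /\ exists d, directed d /\ pe (pmul (pinv w) q) = pe c ++ pe d.
  move=> /KP[d [-> pd dd rd]]; rewrite po_pmul //; split=> //; exists d; split=> //.
  by rewrite -pmulA ?pt_pinv // -/c pe_pmul_cat // pt_pmul // pt_pinv.
case cE : (pe c) c0 => [//|a s] _; rewrite cE in Kc.
have [/andP[h1 h2]|h] := boolP (all (@dpos E) (a :: s) && (a \notin M)).
  left=> q /Kc[wq [d [dd qE]]]; split=> //=; rewrite qE; split=> //.
  by rewrite all_cat h1.
right; apply/seteqP; split=> // q [/Kc[wq [d [dd qE]]] [_]] /=.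
rewrite qE all_cat => -[/andP[h1 _] h2]; case/negP: h.
by rewrite h1.
Qed.

(** Every member of the ring is decided on some neighbourhood [V(p;L)] of the vertex [p]. This makes
    the filter of a vertex maximal and gives it a base. *)
Lemma VL_dichotomy p B : @ringA T B ->
  exists L, VL p L `<=` B \/ VL p L `&` B = set0.
Proof.
elim/ringA_VL_ind => [|w M {}B [L1 h1]].
  by exists [::]; right; rewrite setI0.
have [L2 h2] : exists L, VL p L `<=` VL w M \/ VL p L `&` VL w M = set0.
  have [wp|wp] := eqVneq (po w) (po p); last first.
    exists [::]; right; apply/seteqP; split=> // q [[pq _] [wq _]].
    by case/eqP: wp; rewrite wq.
  have [c0|c0] := eqVneq (pe (pmul (pinv w) p)) [::].
    exists M; left; suff -> : p = w by [].
    rewrite -(@pmulKV _ w p) // (pe0_path0 c0) po_pmul ?pt_pinv //.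
    by rewrite po_pinv pmulp0.
  case cE : (pe (pmul (pinv w) p)) c0 => [//|a s] c0.
  (* The only letter that cancels after [w^-1 p] is the reverse of its last letter; once it is
     excluded as first letter of [d], [VL_rigid] applies. *)
  exists [:: ebar (last a s)]; apply: (@VL_rigid p) => //; first by rewrite cE.
  move=> q /VLP[d [-> pd dd hd]]; exists d; split=> //.
  rewrite reduced_cat pe_reduced directed_reduced //=.
  by case: (pe d) hd => // f t; rewrite inE cE.
case: h1 h2 => h1 [h2|h2].
- exists L1; left; exact: subset_trans h1 (@subsetUr _ _ _).
- exists L1; left; exact: subset_trans h1 (@subsetUr _ _ _).
- exists L2; left; exact: subset_trans h2 (@subsetUl _ _ _).
- exists (L1 ++ L2); right; apply/seteqP; split=> // q [Kq [wq|bq]].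
    rewrite -h2; split=> //; apply: VLS Kq => e eL; rewrite mem_cat eL orbT //.
  rewrite -h1; split=> //; apply: VLS Kq => e eL; rewrite mem_cat eL //.
Qed.

(** Each letter of [s] cancels at most one letter of [t]. If [t] is directed and longer than [s],
    the product therefore still ends in a directed letter. *)
Lemma wmul_drop s t : exists s' k, (k <= size s)%N /\ wmul s t = s' ++ drop k t.
Proof.
elim: s => [|e s [s' [k [ks wE]]]]; first by exists [::], 0%N; rewrite drop0.
rewrite /= -/(wmul s t) wE; case: s' {wE} => [|f s'] /=; last first.
  by case: ifP => _; [exists s'|exists [:: e, f & s']]; exists k; rewrite leqW.
case dk : (drop k t) => [|f u] /=.
  by exists [:: e], k; rewrite dk leqW.
case: ifP => _; last by exists [:: e], k; rewrite dk leqW.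
by exists [::], k.+1; rewrite ltnS ks -(add1n k) -drop_drop dk /= drop0.
Qed.

(** [n] bounds the lengths of all base words [w] of [B]. For a longer directed [p] the word [w^-1 p]
    ends in a letter of [p], and no directed continuation cancels it. *)
Lemma VL_ray B : @ringA T B -> exists n, forall p, directed p -> (n < size (pe p))%N ->
  VL p [::] `<=` B \/ VL p [::] `&` B = set0.
Proof.
elim/ringA_VL_ind => [|w M {}B [n nP]].
  by exists 0%N => p _ _; right; rewrite setI0.
exists (maxn n (size (pe w))) => p dp; rewrite gtn_max => /andP[np wp].
have [h2|h2] : VL p [::] `<=` VL w M \/ VL p [::] `&` VL w M = set0; last first.
- have [h1|h1] := nP p dp np; last by right; rewrite setIUr h1 h2 setU0.
  left; exact: subset_trans h1 (@subsetUr _ _ _).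
- left; exact: subset_trans h2 (@subsetUl _ _ _).
have [pw|pw] := eqVneq (po w) (po p); last first.
  right; apply/seteqP; split=> // q [[pq _] [wq _]].
  by case/eqP: pw; rewrite wq.
have [s' [k [kw cE]]] := wmul_drop (pe (pinv w)) (pe p).
rewrite pe_pinv /winv size_rev size_map in kw.
have {}cE : pe (pmul (pinv w) p) = s' ++ drop k (pe p).
  by rewrite pmulE ?pt_pinv // cE.
have : drop k (pe p) != [::].
  by rewrite -size_eq0 size_drop subn_eq0 -ltnNge (leq_ltn_trans kw).
have : all (@dpos E) (drop k (pe p)).
  by move: dp; rewrite /directed -{1}(cat_take_drop k (pe p)) all_cat => /andP[].
case: (drop k (pe p)) cE => // f u cE dfu _.
apply: (@VL_rigid p) => //; first by rewrite cE; case: s' {cE}.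
move=> q /VLP[d [-> pd dd _]]; exists d; split=> //.
rewrite reduced_cat pe_reduced directed_reduced //=.
move: dd; rewrite /directed; case: (pe d) => // g r /= /andP[dg _].
apply/orP; right; rewrite cE last_cat /=; apply: contraTneq dg => ->.
by rewrite dpos_bar negbK; move/allP: dfu; apply; rewrite mem_last.
Qed.

Lemma VL_prefix p q : directed p -> VL p [::] q -> directed q /\ prefix (pe p) (pe q).
Proof.
move=> dp /VLP[d [-> pd dd _]]; split; first exact: directed_pmul.
by rewrite pe_pmul_dir // prefix_prefix.
Qed.

Lemma prefix_VL p q : directed q -> po p = po q -> prefix (pe p) (pe q) ->
  VL p [::] q.
Proof.
move=> dq pq; rewrite prefixE => /eqP h.
have [c [d [qE cd cq ce de]]] := gpath_take q (size (pe p)).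
have pc : p = c by apply: gpath_ext; rewrite ?ce ?cq ?pq.
apply/VLP; exists d; rewrite pc; split=> //; last by case: pe.
by move: dq; rewrite /directed -{1}(cat_take_drop (size (pe p)) (pe q)) all_cat -de => /andP[].
Qed.

Lemma prefix_total s t u : prefix s u -> prefix t u -> prefix s t \/ prefix t s.
Proof.
elim: u s t => [|e u IH] [|f s] [|g t] //=; try by [left|right].
by move=> /andP[/eqP-> /IH h] /andP[/eqP-> /h]; rewrite eqxx.
Qed.

Lemma prefix_size_eq s t : prefix s t -> (size t <= size s)%N -> s = t.
Proof. by rewrite prefixE => /eqP <- ; rewrite size_take_min => h; rewrite take_oversize //; move: h; rewrite leq_min => /andP[]. Qed.

Lemma VL_size p q : directed p -> VL p [::] q -> (size (pe p) <= size (pe q))%N.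
Proof.
move=> dp /(VL_prefix dp)[_]; rewrite prefixE => /eqP <-.
by rewrite size_take_min geq_minr.
Qed.

Let spec_filter x : ringA_filter (val x).
Proof. exact: (set_valP x).1. Qed.

(** An infinite directed path is kept as the sequence of its prefixes, [P n] being the one of length
    [n]; then only the sets [VL] are needed. *)
Definition ray (P : nat -> gpath E) := forall n,
  [/\ directed (P n), size (pe (P n)) = n & VL (P n) [::] (P n.+1)].

Lemma VL_mono (P : nat -> gpath E) : (forall n, VL (P n) [::] (P n.+1)) ->
  forall m n, (m <= n)%N -> VL (P m) [::] (P n).
Proof.
move=> rP m n /subnK <-; elim: (n - m)%N => [|k IH]; first exact: VL_id.
by rewrite addSn; apply: (VL_trans IH); exact: rP.
Qed.

Lemma ray_mono P : ray P -> forall m n, (m <= n)%N -> VL (P m) [::] (P n).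
Proof. by move=> rP; apply: VL_mono => n; have [] := rP n. Qed.

(** The ring need not contain complements; disjointness from a member of the filter takes their
    place in the criterion for maximality. *)
Lemma ultra_of_dichotomy (x : set (set (gpath E))) :
  ringA_filter (E := T) x ->
  (forall B, @ringA T B -> x B \/ exists2 C, x C & C `&` B = set0) ->
  ringA_ultrafilter (E := T) x.
Proof.
move=> Fx xB; split=> // y Fy xy B yB.
have [//|[C xC CB]] := xB B (rf_sub Fy yB).
have [D yD DCB] := rf_dir Fy (xy _ xC) yB.
case: (rf_proper Fy); suff <- : D = set0 by [].
by apply/seteqP; split=> // q /DCB; rewrite CB.
Qed.

Lemma vertex_uf_ultra p : ringA_ultrafilter (E := T) (@vertex_uf T p).
Proof.
apply: ultra_of_dichotomy; last first.
  move=> B rB; have [L [h|h]] := VL_dichotomy p rB.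
    by left; split=> //; apply: h; exact: VL_id.
  by right; exists (VL p L) => //; split; [exact: ringA_VL|exact: VL_id].
split.
- by move=> B [].
- by exists (VL p [::]); split; [exact: ringA_VL|exact: VL_id].
- by case.
- move=> B C [rB Bp] [rC Cp].
  have [L hL] := VL_dichotomy p rB; have [M hM] := VL_dichotomy p rC.
  case: hL => hL; last first.
    by have : set0 p by rewrite -hL; split=> //; exact: VL_id.
  case: hM => hM; last first.
    by have : set0 p by rewrite -hM; split=> //; exact: VL_id.
  exists (VL p (L ++ M)); first by split; [exact: ringA_VL|exact: VL_id].
  by move=> q qLM; split; [apply: hL|apply: hM]; apply: VLS qLM => e h;
    rewrite mem_cat h ?orbT.
- by move=> B C [_ Bp] rC BC; split=> //; exact: BC.
Qed.

Definition ray_uf (P : nat -> gpath E) : set (set (gpath E)) :=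
  [set B | @ringA T B /\ exists n, VL (P n) [::] `<=` B].

Lemma ray_uf_ultra P : ray P -> ringA_ultrafilter (E := T) (ray_uf P).
Proof.
move=> rP; apply: ultra_of_dichotomy; last first.
  move=> B rB; have [n nP] := VL_ray rB; have [d1 s1 _] := rP n.+1.
  have [|h|h] := nP _ d1; first by rewrite s1.
    by left; split=> //; exists n.+1.
  right; exists (VL (P n.+1) [::]) => //.
  by split; [exact: ringA_VL|exists n.+1].
split.
- by move=> B [].
- by exists (VL (P 0%N) [::]); split; [exact: ringA_VL|exists 0%N].
- by move=> [_ [n nP]]; apply: (nP (P n)); exact: VL_id.
- move=> B C [rB [m mB]] [rC [n nC]]; exists (VL (P (maxn m n)) [::]).
    by split; [exact: ringA_VL|exists (maxn m n)].
  have h1 := VL_trans (ray_mono rP (leq_maxl m n)).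
  have h2 := VL_trans (ray_mono rP (leq_maxr m n)).
  by move=> q hq; split; [apply: mB; exact: h1|apply: nC; exact: h2].
- by move=> B C [_ [n nB]] rC BC; split=> //; exists n; exact: subset_trans BC.
Qed.

Lemma ray_step P : ray P -> forall n, exists e, [/\ dpos e, pt (P n) = eo e &
  P n.+1 = pmul (P n) (path1 e)].
Proof.
move=> rP n; have [dn sn /VLP[d [nE pd dd _]]] := rP n.
have [_ sn1 _] := rP n.+1.
have : size (pe d) = 1%N.
  apply/eqP; rewrite -(eqn_add2l (size (pe (P n)))) -size_cat -pe_pmul_dir //.
  by rewrite -nE sn1 sn addn1.
case dE : (pe d) => [|e []] // _; have [de _] := gpath_uncons dE.
have d1 : d = path1 e by apply: gpath_ext.
exists e; split; last by rewrite -d1.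
  by move: dd; rewrite d1 directed1.
by rewrite pd.
Qed.

Lemma XE_cases x : XE x -> (exists2 p, directed p & val x = @vertex_uf T p) \/
  (exists2 P, ray P & val x = ray_uf P).
Proof.
move=> [[p xp dp]|[z [q [w [[iq dq xq] [iw w0 [m [n mn]] wz]]]] [iz dz]]].
  by left; exists p.
right; pose P n := eo (w n).
have stepw i : pt (P i) = eo (z i) /\ P i.+1 = pmul (P i) (path1 (z i)).
  have [wi _] := iw i; rewrite {2}/P -wi; have [e [h wE]] := clabelE (w i).
  have := wz i; rewrite {1}wE clabel_tedge => -[<-]; split; first exact: h.
  by rewrite {1}wE.
have stepq j : VL (eo (q j)) [::] (eo (q j.+1)).
  have [qj _] := iq j; rewrite -qj; have [e [h qE]] := clabelE (q j).
  apply/VLP; exists (path1 e); rewrite {1}qE; split=> //.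
  by have := dq j; rewrite qE dpos_tedge directed1.
have rP : ray P.
  have dP k : directed (P k) /\ size (pe (P k)) = k.
    elim: k => [|k [IH1 IH2]]; first by rewrite /P w0.
    have [h ->] := stepw k; have dzn : directed (path1 (z k)) by rewrite directed1.
    split; first exact: directed_pmul.
    by rewrite pe_pmul_dir // size_cat IH2 addn1.
  move=> k; have [h1 h2] := dP k; split=> //; have [h ->] := stepw k.
  by apply/VLP; exists (path1 (z k)); rewrite directed1.
(* From [m + j] in [w] and from [n + j] in [q] on, the two cover paths agree, so they generate the
   same filter. *)
exists P => //; rewrite xq; apply/seteqP; split=> B [rB [j jB]]; split=> //.
  exists (m + j)%N; rewrite /P mn; apply: subset_trans jB; rewrite -VL0.
  by apply: VL_trans; apply: (VL_mono stepq); rewrite leq_addl.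
exists (n + j)%N; rewrite -mn -VL0; apply: subset_trans jB.
by apply: VL_trans; apply: (ray_mono rP); rewrite leq_addl.
Qed.

(* The directed prefixes of the path attached to [x]; by [XE_ext] they determine a
   point of [X(E, 0)]. *)
Definition prs x : set (gpath E) := [set p | directed p /\ val x (VL p [::])].

Lemma prs_down x p q : prs x p -> directed q -> VL q [::] p -> prs x q.
Proof.
move=> [dp xp] dq qp; split=> //; apply: (rf_up (spec_filter x) xp).
  exact: ringA_VL.
exact: VL_trans.
Qed.

Lemma prs_total x p q : prs x p -> prs x q -> VL p [::] q \/ VL q [::] p.
Proof.
move=> [dp xp] [dq xq]; have [D xD DS] := rf_dir (spec_filter x) xp xq.
have [D0|/set0P[r /DS[pr qr]]] := eqVneq D set0.
  by case: (rf_proper (spec_filter x)); rewrite -D0.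
have [dr pr'] := VL_prefix dp pr; have [_ qr'] := VL_prefix dq qr.
have pq : po p = po q by rewrite pr.1 qr.1.
by have [h|h] := prefix_total pr' qr'; [left|right]; apply: prefix_VL.
Qed.

Lemma prs_neq0 x : XE x -> exists p, prs x p.
Proof.
case/XE_cases => [[p dp xp]|[P rP xP]].
  by exists p; split=> //; rewrite xp; split; [exact: ringA_VL|exact: VL_id].
have [d0 _ _] := rP 0%N.
by exists (P 0%N); split=> //; rewrite xP; split; [exact: ringA_VL|exists 0%N].
Qed.

(* [L] may contain edges that do not start at the end of [p]: they impose nothing. *)
Definition avoids x p L := forall e, e \in L -> pt p = eo e -> dpos e -> ~ prs x (pmul p (path1 e)).

(** The central reduction: topology, action and equality of points are read off from [prs]. At a
    vertex the sets [V(p;L)] with [p] this vertex form a base, at an end the sets [V(P n)] do.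
    Conversely, the letter that follows [p] in the path of [x], if there is one, is not in [L]. *)
Lemma XE_memP x B : XE x -> @ringA T B ->
  (val x B <-> exists p L, [/\ prs x p, avoids x p L & VL p L `<=` B]).
Proof.
move=> Xx rB; have Fx := spec_filter x.
suff VLin p L : prs x p -> avoids x p L -> val x (VL p L).
  split; last first.
    by move=> [p [L [xp xL LB]]]; apply: (rf_up Fx _ rB LB); exact: VLin.
  case/XE_cases: Xx => [[p dp xp]|[P rP xP]] xB.
    have [L [LB|LB]] := VL_dichotomy p rB; last first.
      rewrite xp in xB; have : set0 p; last by [].
      by rewrite -LB; split; [exact: VL_id|exact: xB.2].
    exists p, L; split=> //.
      by split=> //; rewrite xp; split; [exact: ringA_VL|exact: VL_id].
    move=> e eL pe' de [_]; rewrite xp => -[_ /VLP[d [pE pd dd _]]].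
    have := congr1 (fun u => size (pe u)) pE; rewrite /= !pe_pmul_dir ?directed1 //; last by apply: directed_pmul; rewrite ?directed1.
    by rewrite !size_cat /= => /eqP; rewrite -{1}[size (pe p)]addn0 -addnA eqn_add2l.
  move: xB; rewrite xP => -[_ [n nB]]; have [dn _ _] := rP n.
  exists (P n), [::]; split=> //; split=> //; rewrite xP; split; first exact: ringA_VL.
  by exists n.
move=> xp xL; have [dp _] := xp.
case/XE_cases: Xx => [[q dq xq]|[P rP xP]].
  rewrite xq; split; first exact: ringA_VL.
  have : VL p [::] q by move: xp.2; rewrite xq => -[].
  move=> /VLP[d [qE pd dd _]]; apply/VLP; exists d; split=> //.
  move: dd; rewrite /directed; case dE : (pe d) => [|e s] //= /andP[de ds].
  apply/negP => eL; have [ep [d' [d'E d'o d's]]] := gpath_uncons dE.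
  have pe' : pt p = eo e by rewrite pd.
  apply: (xL e eL) => //; split; first by apply: directed_pmul => //; rewrite directed1.
  rewrite xq; split; first exact: ringA_VL.
  apply/VLP; exists d'; rewrite pt_pmul // pmulA // -d'E; split=> //.
    by rewrite /directed d's.
  by case: pe.
have [n nP] : exists n, VL (P n) [::] `<=` VL p [::] by move: xp.2; rewrite xP => -[].
(* [P m] is longer than [p], so that the letter following [p] is visible in it. *)
pose m := maxn n (size (pe p)).+1; have [dm sm _] := rP m.
have : VL p [::] (P m).
  by apply: nP; apply: (ray_mono rP); rewrite leq_maxl.
move=> /VLP[d [mE pd dd _]].
have : (size (pe p) < m)%N by rewrite leq_maxr.
rewrite -sm mE pe_pmul_dir // size_cat; case dE : (pe d) => [|e s] //=.
  by rewrite addn0 ltnn.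
move=> _; move: (dd); rewrite /directed dE /= => /andP[de ds].
have [ep [d' [d'E d'o d's]]] := gpath_uncons dE.
have pe' : pt p = eo e by rewrite pd.
rewrite xP; split; first exact: ringA_VL.
exists m => q /VLP[c [-> mc dc _]]; apply/VLP; exists (pmul d c).
rewrite mE pt_pmul // in mc; rewrite mE pmulA // po_pmul // pe_pmul_dir //.
split=> //; first exact: directed_pmul.
rewrite dE /=; apply/negP => eL; apply: (xL e eL) => //.
split; first by apply: directed_pmul => //; rewrite directed1.
rewrite xP; split; first exact: ringA_VL.
exists m; apply: VL_trans; apply/VLP; exists d'; rewrite pt_pmul // pmulA // -d'E; split=> //.
  by rewrite /directed d's.
by case: pe.
Qed.

Lemma XE_ext x y : XE x -> XE y -> prs x = prs y -> x = y.
Proof.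
move=> Xx Xy xy; apply: val_inj; apply/seteqP.
have av p L : avoids x p L = avoids y p L by rewrite /avoids xy.
split=> B zB; have rB := rf_sub (spec_filter _) zB.
  move/(XE_memP Xx rB): zB => [p [L [xp xL LB]]]; apply/(XE_memP Xy rB).
  by exists p, L; rewrite -xy -av.
move/(XE_memP Xy rB): zB => [p [L [xp xL LB]]]; apply/(XE_memP Xx rB).
by exists p, L; rewrite xy av.
Qed.

Lemma lam_prs x p : prs x p -> lam x = po p.
Proof.
move=> [_ xp]; apply: lam_eq; exists (VL p [::]) => //.
by move=> q [].
Qed.

(** Such a chain has a largest element and comes from a vertex, or it contains a path of each length
    and comes from an end. The lemma produces the points needed for the action, for compactness and
    for [vertex_point]. *)
Lemma XE_exists (O : set (gpath E)) : O !=set0 -> (forall p, O p -> directed p) ->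
  (forall p q, O p -> directed q -> VL q [::] p -> O q) ->
  (forall p q, O p -> O q -> VL p [::] q \/ VL q [::] p) ->
  exists x, XE x /\ prs x = O.
Proof.
move=> [p0 Op0] Od Odown Otot.
have [[p [Op pmax]]|nmax] := pselect (exists p, O p /\ forall q, O q -> VL q [::] p).
  pose x : spectrum T := set_elt (vertex_uf_ultra p).
  exists x; split; first by left; exists p => //; exact: Od.
  apply/seteqP; split=> q.
    by move=> [dq [_ qp]]; exact: Odown qp.
  move=> Oq; split; first exact: Od.
  by split; [exact: ringA_VL|exact: pmax].
(* A path of length [n] is not largest, hence is properly extended in [O]; the extension is cut back
   to length [n + 1]. *)
have Osize n : exists p, O p /\ size (pe p) = n.
  elim: n => [|n [p [Op pn]]].
    have [c [d [pE cd cp ce _]]] := gpath_take p0 0.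
    rewrite take0 in ce; exists c; rewrite ce; split=> //.
    have dc : directed c by rewrite /directed ce.
    apply: (Odown p0) => //; apply: prefix_VL; [exact: Od|by []|].
    by rewrite ce prefix0s.
  have [q [Oq qp]] : exists q, O q /\ ~ VL q [::] p.
    apply: contrapT => h; apply: nmax; exists p; split=> // q Oq.
    by apply: contrapT => nq; apply: h; exists q.
  have pq : VL p [::] q by have [] := Otot p q Op Oq.
  have [_ pq'] := VL_prefix (Od _ Op) pq.
  have sq : (n < size (pe q))%N.
    rewrite ltnNge; apply/negP => qn; apply: qp.
    have pqE : p = q.
      apply: gpath_ext; first exact: pq.1.
      by apply: prefix_size_eq => //; rewrite pn.
    by rewrite pqE; exact: VL_id.
  have [c [d [qE cd cq ce _]]] := gpath_take q n.+1.
  exists c; split; last by rewrite ce size_takel.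
  have dc : directed c.
    have := Od _ Oq; rewrite /directed ce -{1}(cat_take_drop n.+1 (pe q)) all_cat.
    by case/andP.
  apply: (Odown q) => //; apply: prefix_VL => //; first exact: Od.
  by rewrite ce prefixE size_takel.
have [P PP] := choice Osize.
have rP : ray P.
  move=> n; have [On sn] := PP n; have [On1 sn1] := PP n.+1.
  split=> //; first exact: Od.
  have [//|h] := Otot _ _ On On1.
  have [_ pp] := VL_prefix (Od _ On1) h.
  have : (size (pe (P n.+1)) <= size (pe (P n)))%N.
    by move: pp; rewrite prefixE => /eqP <-; rewrite size_take_min geq_minr.
  by rewrite sn sn1 ltnn.
pose x : spectrum T := set_elt (ray_uf_ultra rP).
have prx : prs x = O.
  apply/seteqP; split=> q.
    move=> [dq [_ [n nq]]]; apply: (Odown (P n)) => //; first exact: (PP n).1.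
    by apply: nq; exact: VL_id.
  move=> Oq; split; first exact: Od.
  split; first exact: ringA_VL.
  exists (size (pe q)); apply: VL_trans.
  have [On sn] := PP (size (pe q)); have [//|h] := Otot _ _ Oq On.
  have [_ pp] := VL_prefix (Od _ On) h.
  have -> : P (size (pe q)) = q.
    by apply: gpath_ext; [exact: h.1|apply: prefix_size_eq => //; rewrite sn].
  exact: VL_id.
(* Membership in [XE] asks for an edge sequence [z] and its lift [w]; both are read off from
   consecutive prefixes. *)
exists x; split=> //; right.
have /choice[z zP] := ray_step rP.
have ez n : pt (P n) = eo (z n) by have [] := zP n.
have dz n : dpos (z n) by have [] := zP n.
have eoz n : et (z n) = eo (z n.+1).
  by rewrite -ez; have [_ h ->] := zP n; rewrite pt_pmul.
have iz (D : digraph) (u : nat -> edge D) : (forall n, dpos (u n)) ->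
    (forall n, et (u n) = eo (u n.+1)) -> ipath u.
  move=> du eu n; split=> //; apply: contraPnot (du n.+1) => ->.
  by rewrite dpos_bar du.
exists z; last by split=> //; exact: iz.
pose w n : edge T := tedge (ez n).
have dw n : dpos (w n) by rewrite dpos_tedge.
have ew n : et (w n) = eo (w n.+1).
  by have [_ _ h] := zP n; rewrite [RHS]/= /co /= h.
exists w, w; split; split => //; try exact: iz.
- rewrite [LHS]/=; apply/seteqP; split=> B [rB [j jB]]; split=> //; exists j.
    by rewrite -VL0.
  by rewrite VL0.
- have [OP0 s0] := PP 0%N.
  rewrite (@lam_prs x (P 0%N)); last by rewrite prx.
  by rewrite [LHS]/= /co /=; apply: pe0_path0; apply: size0nil.
- by exists 0%N, 0%N.
- by move=> i; rewrite clabel_tedge.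
Qed.

(** * Arrows and the action in terms of prefixes *)

Definition lab g : gpath E := (val (val g)).1.
Definition pnt g : spectrum T := (val (val g)).2.
Definition pnt' g : spectrum T := ga_rng (val g).
Definition prg g := prs (pnt g).

Lemma XE_pnt g : XE (pnt g).
Proof. exact: (set_valP g).1. Qed.
Lemma XE_pnt' g : XE (pnt' g).
Proof. exact: (set_valP g).2. Qed.
Lemma pt_lab g : pt (lab g) = lam (pnt g).
Proof. exact: (set_valP (val g)). Qed.

Lemma prg_po g p : prg g p -> pt (lab g) = po p.
Proof. by move=> gp; rewrite pt_lab; apply: lam_prs. Qed.

Lemma prg_directed g p : prg g p -> directed p.
Proof. by case. Qed.

Lemma G_ext g h : lab g = lab h -> prg g = prg h -> g = h.
Proof.
move=> gh pgh; have {}pgh : pnt g = pnt h by apply: XE_ext => //; exact: XE_pnt.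
do 2!apply: val_inj; rewrite [LHS]surjective_pairing [RHS]surjective_pairing.
by congr pair.
Qed.

Lemma act_VL a x p : po p = po a ->
  act a (val x) (VL p [::]) <-> val x (VL (pmul (pinv a) p) [::]).
Proof.
move=> pa; have -> : VL (pmul (pinv a) p) [::] = lpre a (VL p [::]).
  have ap : pt (pinv a) = po p by rewrite pt_pinv.
  apply/seteqP; split=> q.
    move=> /VLP[d [-> pd dd _]]; rewrite pt_pmul // in pd.
    have qd : pt (pmul (pinv a) p) = po d by rewrite pt_pmul.
    have paq : pt a = po (pmul (pinv a) p) by rewrite po_pmul.
    split; first by rewrite po_pmul.
    rewrite -pmulA //.
    by rewrite pmulKV //; apply: VL_pmul.
  move=> [aq /VLP[d [qE pd dd _]]]; apply/VLP; exists d.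
  rewrite pt_pmul // pmulA // -qE pmulK //; split=> //; by case: pe.
by split=> [[]//|h]; split=> //; exact: ringA_VL.
Qed.

Lemma prs_act x a y p : val y = act a (val x) -> directed p -> po p = po a ->
  prs y p <-> val x (VL (pmul (pinv a) p) [::]).
Proof.
by move=> yE dp pa; rewrite -act_VL // -yE; split=> [[]//|h]; split.
Qed.

(** The range of [g] lies in [XE] too. A prefix [q] of the range point pulls back to [V(a^-1 q)],
    with [a] the label, and this set contains the source. A set [V(p;L)] inside it gives [a p = q d]
    with [d] directed. Hence every arrow lies in some [Zset]. *)
Lemma prg_lab g : exists2 p, prg g p & directed (pmul (lab g) p).
Proof.
have [q yq] := prs_neq0 (XE_pnt' g).
have qa : po q = po (lab g).
  rewrite -(lam_prs yq); apply: lam_eq.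
  have gl : lies_over (val (pnt g)) (pt (lab g)) by rewrite pt_lab; exact: lamP.
  exact: (act_filter (spec_filter _) gl).2.
have [dq _] := yq.
have := (prs_act (erefl : val (pnt' g) = act (lab g) (val (pnt g))) dq qa).1 yq.
have rV := ringA_VL (pmul (pinv (lab g)) q) [::].
move=> /(XE_memP (XE_pnt g) rV)[p [L [gp _ LV]]]; exists p => //.
have /VLP[d [pE pd dd _]] := LV _ (VL_id p L).
have aq : pt (pinv (lab g)) = po q by rewrite pt_pinv.
have qd : pt q = po d by rewrite -pd pt_pmul.
by rewrite pE pmulA // pmulKV // ?po_pmul //; exact: directed_pmul.
Qed.

(** A point [z] of [XE] with the same directed prefixes as [y] is built first. It then suffices that
    [z] is contained in [y], because [z] is maximal. *)
Lemma XE_act x y a p : XE x -> val y = act a (val x) -> lam x = pt a ->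
  prs x p -> directed (pmul a p) -> XE y.
Proof.
move=> Xx yE xa xp dap.
have ap : pt a = po p by rewrite -xa (lam_prs xp).
have prsy q : directed q -> po q = po a ->
    prs y q <-> val x (VL (pmul (pinv a) q) [::]) by apply: prs_act.
have yap : prs y (pmul a p).
  by apply/prsy; rewrite ?po_pmul // pmulK //; exact: xp.2.
have [z [Xz zy]] : exists z, XE z /\ prs z = prs y.
  apply: XE_exists; first by exists (pmul a p).
  - by move=> q [].
  - by move=> q r; exact: prs_down.
  - by move=> q r; exact: prs_total.
suff -> : y = z by [].
apply: val_inj; apply/seteqP.
suff zy' : val z `<=` val y.
  by split=> //; exact: ((set_valP z).2 _ (spec_filter y) zy').
move=> B zB; have rB := rf_sub (spec_filter z) zB.
have [q [L [zq zL LB]]] := (XE_memP Xz rB).1 zB.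
rewrite yE; split=> //.
rewrite zy in zq; have [dq _] := zq.
have qa : po q = po a by rewrite -(lam_prs zq) (lam_prs yap) po_pmul.
have aq : pt (pinv a) = po q by rewrite pt_pinv.
have xq := (prsy q dq qa).1 zq.
have [r [M [xr rM MV]]] := (XE_memP Xx (ringA_VL _ _)).1 xq.
(* A prefix of [x] beyond both [p] and [a^-1 q]; multiplied by [a] it is directed and begins with
   [q]. *)
have [r' [xr' pr' qr']] : exists r', [/\ prs x r', VL p [::] r' & VL (pmul (pinv a) q) [::] r'].
  have qr := MV _ (VL_id r M).
  have [pr|rp] := prs_total xp xr; first by exists r.
  by exists p; split=> //; [exact: VL_id|apply: VL_trans rp; exact: qr].
have [dr _] := xr'.
have /VLP[d [rE qd dd _]] := qr'.
have qd' : pt q = po d by rewrite -qd pt_pmul.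
have ar : pmul a r' = pmul q d.
  by rewrite rE pmulA // pmulKV // po_pmul.
have ar' : pt a = po r' by rewrite -pr'.1.
have sub K : VL r' K `<=` lpre a (VL (pmul a r') K).
  move=> u /VLP[d' [uE rd' dd' h]]; split; first by rewrite uE po_pmul.
  by apply/VLP; exists d'; rewrite uE pmulA // pt_pmul.
(* If [a r'] is [q] itself, the forbidden letters carry over to [r']. Otherwise [q] is followed in
   [a r'] by a letter outside [L], and all of [V(r')] is mapped into [V(q;L)]. *)
case dE : (pe d) => [|e u].
  have qE : q = pmul a r' by rewrite ar (pe0_path0 dE) -qd' pmulp0.
  have xL : avoids x r' L.
    move=> e eL re de xre; apply: (zL e eL) => //; first by rewrite qE pt_pmul.
    rewrite zy; apply/prsy.
    - by apply: directed_pmul; rewrite ?directed1 // qE pt_pmul.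
    - by rewrite po_pmul // qE pt_pmul.
    - by rewrite qE pmulA // pmulK ?po_pmul //; exact: xre.2.
  apply: (rf_up (spec_filter x) (B := VL r' L)).
  - by apply: (XE_memP Xx (ringA_VL _ _)).2; exists r', L; split=> // ?.
  - exact: ringA_lpre.
  - by apply: subset_trans (sub L) _ => v [av h]; split=> //; apply: LB; rewrite qE.
have [ed [d' [d'E d'o d's]]] := gpath_uncons dE.
move: (dd); rewrite /directed dE /= => /andP[de du].
have qe : pt q = eo e by rewrite qd'.
have eL : e \notin L.
  apply/negP => eL; apply: (zL e eL) => //; rewrite zy.
  have yr : prs y (pmul a r').
    apply/prsy; rewrite ?po_pmul // ?pmulK //; last exact: xr'.2.
    by rewrite ar; exact: directed_pmul.
  apply: (prs_down yr); first by apply: directed_pmul => //; rewrite directed1.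
  rewrite ar d'E -pmulA //; apply/VLP; exists d'; rewrite pt_pmul //; split=> //.
    by rewrite /directed d's.
  by case: pe.
apply: (rf_up (spec_filter x) xr'.2); first exact: ringA_lpre.
move=> v /sub[av hv]; split=> //; apply: LB.
have /VLP[d2 [vE rd2 dd2 _]] := hv.
apply/VLP; exists (pmul d d2); rewrite vE ar -pmulA //; last by rewrite -rd2 ar pt_pmul.
rewrite ar pt_pmul // in rd2.
by rewrite po_pmul // pe_pmul_dir // dE; split=> //; exact: directed_pmul.
Qed.

Lemma G_exists x a p : XE x -> prs x p -> pt a = po p -> directed (pmul a p) ->
  exists g, lab g = a /\ pnt g = x.
Proof.
move=> Xx xp ap dap; have xa : lam x = pt a by rewrite ap (lam_prs xp).
pose g0 : ga_arr (E:=E) := @set_elt _ (@ga_arr E) (a : discrete_topology (gpath E), x) (esym xa).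
have h : restr_arr (G := cover_groupoid E) (@XE E) g0.
  by split=> //=; apply: (@XE_act x (ga_rng g0) a p).
by exists (@set_elt _ (@restr_arr (cover_groupoid E) (@XE E)) _ h).
Qed.

Lemma prg_rng g p : prg g p -> directed (pmul (lab g) p) -> prs (pnt' g) (pmul (lab g) p).
Proof.
move=> gp dap; have ap := prg_po gp.
apply/(prs_act (erefl : val (pnt' g) = act (lab g) (val (pnt g)))) => //.
  by rewrite po_pmul.
by rewrite pmulK //; exact: gp.2.
Qed.

Lemma gsrcE g h : gsrc g = gsrc h <-> pnt g = pnt h.
Proof.
split=> [gh|gh]; first by have := congr1 val gh.
by apply: val_inj.
Qed.

Lemma gsrc_rng g h : gsrc g = grng h <-> pnt g = pnt' h.
Proof.
split=> [gh|gh]; first by have := congr1 val gh.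
by apply: val_inj.
Qed.

Lemma gmulE g h : gsrc g = grng h ->
  lab (gmul g h) = pmul (lab g) (lab h) /\ pnt (gmul g h) = pnt h.
Proof.
move=> gh; have gh' := congr1 val gh.
have := val_restr_mul gh; rewrite /lab /pnt /= => ->.
by rewrite val_ga_mul.
Qed.

Lemma ginvE g : lab (ginv g) = pinv (lab g) /\ pnt (ginv g) = pnt' g.
Proof. by []. Qed.

(** * The topology of the groupoid *)

Definition basic a p L : set G := [set h | [/\ lab h = a, prg h p & avoids (pnt h) p L]].

Lemma mem_VL x p L : XE x -> directed p -> (val x (VL p L) <-> prs x p /\ avoids x p L).
Proof.
move=> Xx dp; split=> [xV|[xp xL]]; last first.
  by apply: (XE_memP Xx (ringA_VL _ _)).2; exists p, L; split=> // ?.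
split.
  by split=> //; apply: (rf_up (spec_filter x) xV (ringA_VL _ _)); exact: VLS.
move=> e eL pe' de [_ xe].
have [D xD DV] := rf_dir (spec_filter x) xV xe.
apply: (rf_proper (spec_filter x)); suff <- : D = set0 by [].
apply/seteqP; split=> // q /DV[/VLP[d [qE pd dd h]] /VLP[d' [qE' pd' dd' _]]].
rewrite pt_pmul // in pd'.
have dE : d = pmul (path1 e) d'.
  by rewrite -(@pmulK _ p d) // -qE qE' pmulA // pmulK //= po_pmul.
by move: h; rewrite dE pe_pmul_dir ?directed1 //= eL.
Qed.

Lemma nbhs_set_type (X : topologicalType) (A : set X) (x : A) (U : set A) :
  nbhs x U <-> exists2 V, nbhs (val x) V & forall y : A, V (val y) -> U y.
Proof.
split=> [[W [[V oV <-] Vx] WU]|[V xV VU]].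
  by exists V; [exact: open_nbhs_nbhs|move=> y Vy; exact: WU].
have cv : continuous (val : A -> X) := @initial_continuous _ _ _.
apply: (@filterS _ (nbhs x) _ (val @^-1` V)); last exact: cv.
by move=> y; exact: VU.
Qed.

Lemma spec_bigI x (s : seq (set (gpath E))) : (forall C, C \in s -> val x C) ->
  exists2 B, val x B & forall C, C \in s -> B `<=` C.
Proof.
elim: s => [_|C s IH xs].
  by have [B xB] := rf_neq0 (spec_filter x); exists B.
have [|B xB Bs] := IH; first by move=> D Ds; apply: xs; rewrite inE Ds orbT.
have [D xD DBC] := rf_dir (spec_filter x) xB (xs C (mem_head _ _)).
exists D => // C'; rewrite inE => /predU1P[->|/Bs BC'] q /DBC[] // Bq _.
exact: BC'.
Qed.

(** The ring is only given as a subbase, but a filter contains a set inside any finitely many of its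
    members, so single sets form a base at each point. *)
Lemma nbhs_spectrum x (U : set (spectrum T)) :
  nbhs x U <-> exists2 B, val x B & forall y, val y B -> U y.
Proof.
split=> [[W [[D DF <-] [V DV Vx] WU]]|[B xB BU]].
  have [F FR VE] := DF _ DV.
  have xF C : C \in F -> val x C by move=> CF; move: Vx; rewrite -VE; apply.
  have [B xB BF] := spec_bigI xF; exists B => // y yB; apply: WU; exists V => //.
  suff : V y by []; rewrite -VE => C CF; apply: (rf_up (spec_filter y) yB); last exact: BF.
  by have := FR C CF; rewrite inE.
exists [set y | val y B]; split=> //.
exists [set [set y : spectrum T | val y B]]; last by rewrite bigcup_set1.
move=> _ ->; exists [fset B]%fset.
  by move=> C /fset1P ->; apply/mem_set; exact: (rf_sub (spec_filter x)).
by apply/seteqP; split=> [y|y yB C /fset1P -> //]; apply; exact/fset1P.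
Qed.

(** Labels are discrete, and [XE_memP] reduces a neighbourhood in the spectrum to one prefix and
    finitely many forbidden letters. *)
Lemma nbhsG g A : nbhs g A <->
  exists p L, [/\ prg g p, avoids (pnt g) p L & basic (lab g) p L `<=` A].
Proof.
split.
  move=> /nbhs_set_type[V /nbhs_set_type[W [[W1 W2] /= [gW1 gW2] W12] WV] VA].
  have {}gW1 : W1 (lab g) by exact: nbhs_singleton gW1.
  have /nbhs_spectrum[B xB BW] := gW2.
  have rB := rf_sub (spec_filter _) xB.
  have [p [L [gp gL LB]]] := (XE_memP (XE_pnt g) rB).1 xB.
  exists p, L; split=> // h [hg hp hL]; apply: VA; apply: WV; apply: W12.
  split; first by have := gW1; rewrite -hg.
  apply: BW; apply: (XE_memP (XE_pnt h) rB).2; exists p, L.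
  by split.
move=> [p [L [gp gL pA]]].
apply/nbhs_set_type; exists [set k : ga_arr (E:=E) | (val k).1 = lab g /\ val (val k).2 (VL p L)].
  apply/nbhs_set_type; exists [set k | k.1 = lab g /\ val k.2 (VL p L)] => //.
  exists ([set lab g], [set y | val y (VL p L)]) => //=; split=> //.
  apply/nbhs_spectrum; exists (VL p L) => //.
  by apply/mem_VL => //; [exact: XE_pnt|exact: prg_directed gp].
move=> h [hg /(mem_VL _ (XE_pnt h) (prg_directed gp))[hp hL]].
by apply: pA.
Qed.

(* The set of arrows (q p^-1, x) with [p] a prefix of [x]: its characteristic
   function corresponds to [S_q S_p^*]. *)
Definition Zset q p : set G := [set g | lab g = pmul q (pinv p) /\ prg g p].

Lemma directed_lab q p g : pt q = pt p -> Zset q p g -> pmul (lab g) p = q.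
Proof. by move=> qp [-> _]; rewrite pmulA ?pt_pinv // pmulV -qp pmulp0. Qed.

Lemma avoids_nil x p : avoids x p [::]. Proof. by []. Qed.

Lemma basic_nbhs g p L : prg g p -> avoids (pnt g) p L -> nbhs g (basic (lab g) p L).
Proof. by move=> gp gL; apply/nbhsG; exists p, L; split=> // ?. Qed.

Lemma basic_open a p L : open (basic a p L).
Proof. by rewrite openE => g [<- gp gL]; exact: basic_nbhs. Qed.

Lemma basic0 q p : basic (pmul q (pinv p)) p [::] = Zset q p.
Proof. by apply/seteqP; split=> g []. Qed.

Lemma Zset_open q p : open (Zset q p).
Proof. by rewrite -basic0; exact: basic_open. Qed.

Lemma lab_open (A : set (gpath E)) : open [set g | A (lab g)].
Proof.
rewrite openE => g Ag; apply/nbhsG; have [p gp _] := prg_lab g.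
by exists p, [::]; split=> // h [/= ->].
Qed.

(* A point of which [p] is not a prefix has a prefix branching off from [p], or it
   is a proper prefix of [p], isolated from [p] by the next edge of [p]. *)
Lemma Zset_closed q p : directed p -> closed (Zset q p).
Proof.
move=> dp; rewrite -openC openE => g gZ; apply/nbhsG.
have [lg|lg] := eqVneq (lab g) (pmul q (pinv p)); last first.
  have [r gr _] := prg_lab g; exists r, [::]; split=> // h [/= hg _ _] [hq _].
  by case/eqP: lg; rewrite -hg.
have gp : ~ prg g p by move=> gp; apply: gZ.
have [[r gr rp]|nr] := pselect (exists2 r, prg g r & ~ (VL p [::] r \/ VL r [::] p)).
  exists r, [::]; split=> // h [_ hr _] [_ hp]; apply: rp.
  exact: (prs_total hp hr).
have np r : prg g r -> VL r [::] p.
  move=> gr; have [h|//] : VL p [::] r \/ VL r [::] p.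
    by apply: contrapT => h; apply: nr; exists r.
  by case: gp; apply: prs_down h.
(* All prefixes of [g] are prefixes of [p], so there is one of maximal length. *)
have [r gr rmax] : exists2 r, prg g r & forall r', prg g r' -> VL r' [::] r.
  have sz r : prg g r -> (size (pe r) <= size (pe p))%N.
    move=> gr; have [_] := VL_prefix (prg_directed gr) (np _ gr).
    by rewrite prefixE => /eqP <-; rewrite size_take_min geq_minr.
  pose P n := `[< exists2 r, prg g r & size (pe r) = n >].
  have exP : exists n, P n.
    by have [r gr _] := prg_lab g; exists (size (pe r)); apply/asboolP; exists r.
  have ubP n : P n -> (n <= size (pe p))%N by move=> /asboolP[r gr <-]; exact: sz.
  case: (ex_maxnP exP ubP) => n /asboolP[r gr <-] rmax; exists r => // r' gr'.
  have [h|//] := prs_total gr gr'.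
  have [_ pr] := VL_prefix (prg_directed gr) h.
  have -> : r' = r; last exact: VL_id.
  apply/esym/gpath_ext; first exact: h.1.
  by apply: prefix_size_eq => //; apply: rmax; apply/asboolP; exists r'.
have /VLP[d [pE pd dd _]] := np _ gr.
case dE : (pe d) => [|e s].
  by case: gp; rewrite pE (pe0_path0 dE) -pd pmulp0.
have [ed [d' [d'E d'o d's]]] := gpath_uncons dE.
move: (dd); rewrite /directed dE /= => /andP[de ds].
have re : pt r = eo e by rewrite pd.
exists r, [:: e]; split=> //.
  move=> f; rewrite inE => /eqP -> _ _ gre; have := rmax _ gre.
  have dre : directed (pmul r (path1 e)) by apply: directed_pmul => //; [exact: prg_directed gr|rewrite directed1].
  move=> /(VL_size dre); rewrite pe_pmul_dir ?directed1 //; last exact: prg_directed gr.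
  by rewrite size_cat addn1 ltnn.
move=> h [_ hr hL] [_ hp]; apply: (hL e) => //; first exact: mem_head.
have dr := prg_directed gr.
apply: (prs_down hp); first by apply: directed_pmul; rewrite ?directed1.
apply/VLP; exists d'; rewrite pt_pmul // pE d'E pmulA //; split=> //.
  by rewrite /directed d's.
by case: pe.
Qed.

(** The limit of an ultrafilter is the point whose prefixes are the paths that are prefixes of
    almost every source. These paths form a chain, and [XE_exists] applies. *)
Lemma Zset_compact q p : directed q -> directed p -> pt q = pt p -> compact (Zset q p).
Proof.
move=> dq dp qp; rewrite compact_ultra => F UF FZ.
pose a := pmul q (pinv p).
have ap : pt a = po p by rewrite pt_pmul ?pt_pinv // po_pinv.
have aq : pmul a p = q by rewrite pmulA ?pt_pinv // pmulV -qp pmulp0.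
pose O r := directed r /\ F [set h | lab h = a /\ prg h r].
have Fne A : F A -> exists h, A h by exact: filter_ex.
have [x [Xx xO]] : exists x, XE x /\ prs x = O.
  apply: XE_exists; first by exists p.
  - by move=> r [].
  - move=> r r' [dr Fr] dr' rr'; split=> //; apply: filterS Fr => h [ha hr].
    by split=> //; apply: prs_down rr'.
  - move=> r r' [dr Fr] [dr' Fr'].
    by have [h [[_ hr] [_ hr']]] := Fne _ (filterI Fr Fr'); exact: prs_total hr hr'.
have xp : prs x p by rewrite xO.
have [|g [ga gx]] := G_exists Xx xp ap; first by rewrite aq.
exists g; split; first by split=> //; rewrite /prg gx.
move=> A /nbhsG[r [L [gr gL rA]]].
rewrite /prg gx xO in gr; have [dr Fr] := gr.
(* Letters are treated one at a time. The ultrafilter decides each: were [r e] a prefix almost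
   everywhere, it would be a prefix of the limit, against [gL]. *)
suff FL M : {subset M <= L} -> F [set h | avoids (pnt h) r M].
  have FL' : F [set h | avoids (pnt h) r L] by apply: FL.
  by apply: filterS (filterI Fr FL') => h [[ha hr] hL]; apply: rA; rewrite ga.
elim: M => [_|e M IH eML]; first by apply: filterS Fr => h _; exact: avoids_nil.
have {}IH : F [set h | avoids (pnt h) r M].
  by apply: IH => f fM; apply: eML; rewrite inE fM orbT.
suff Fe : F [set h | pt r = eo e -> dpos e -> ~ prs (pnt h) (pmul r (path1 e))].
  apply: filterS (filterI IH Fe) => h [hM he] f; rewrite inE => /predU1P[->|]; first exact: he.
  exact: hM.
have [[re de]|nre] := pselect (pt r = eo e /\ dpos e); last first.
  by apply: filterS Fr => h _ re de; case: nre.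
have dre : directed (pmul r (path1 e)) by apply: directed_pmul; rewrite ?directed1.
have [Fe|Fe] := in_ultra_setVsetC [set h | prg h (pmul r (path1 e))] UF; last first.
  by apply: filterS Fe => h he _ _.
case: (gL e (eML e (mem_head _ _)) re de); rewrite gx xO; split=> //.
by apply: filterS (filterI Fr Fe) => h [[]].
Qed.

Lemma Zset_cover g : exists q p, [/\ directed q, directed p, pt q = pt p & Zset q p g].
Proof.
have [p gp dap] := prg_lab g; have ap := prg_po gp.
exists (pmul (lab g) p), p; split=> //; first exact: prg_directed gp.
  by rewrite pt_pmul.
by split=> //; rewrite pmulA ?pt_pinv // pmulVr -ap pmulp0.
Qed.

End Spectrum.

(** * Convolution on the Toeplitz groupoid *)

(** If no finite subfamily covers [K], the sets containing what finitely many [U i] leave of [K]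
    form a proper filter; a cluster point of it in [K] has a neighbourhood [U i] that contradicts
    this. *)
Lemma compact_seq_cover (X : topologicalType) (J : eqType) (U : J -> set X)
    (D : set J) (K : set X) : compact K ->
  (forall x, K x -> exists i, D i /\ nbhs x (U i)) ->
  exists l : seq J, (forall i, i \in l -> D i) /\
    forall x, K x -> exists2 i, i \in l & U i x.
Proof.
move=> cK KU; apply: contrapT => nl.
pose F : set_system X := [set A | exists l : seq J, (forall i, i \in l -> D i) /\
  K `\` [set x | exists2 i, i \in l & U i x] `<=` A].
have FF : ProperFilter F.
  split.
    move=> [l [lD lK]]; apply: nl; exists l; split=> // x Kx.
    by apply: contrapT => nx; apply: (lK x).
  split.
  - by exists [::]; split.
  - move=> A B [l [lD lA]] [m [mD mB]]; exists (l ++ m); split.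
      by move=> i; rewrite mem_cat => /orP[/lD|/mD].
    move=> x [Kx nx]; split; [apply: lA|apply: mB]; split=> // -[i il Ui]; apply: nx;
      by exists i => //; rewrite mem_cat il ?orbT.
  - by move=> A B AB [l [lD lA]]; exists l; split=> // x /lA/AB.
have FK : F K by exists [::]; split=> // x [].
have [x [Kx xF]] := cK F FF FK.
have [i [Di xU]] := KU x Kx.
have Fi : F (~` U i).
  exists [:: i]; split; first by move=> j; rewrite inE => /eqP ->.
  by move=> y [_ nu] Uy; apply: nu; exists i => //; exact: mem_head.
by have [y []] := xF _ _ Fi xU.
Qed.

Section AbstractGroupoid.
Variable G : groupoid.
Implicit Types g h : G.

Lemma gmulKr g h : gsrc g = grng h -> gmul (gmul g h) (ginv h) = g.
Proof. by move=> gh; rewrite gmulA ?grng_inv // gmul_inv -gh gmul_id. Qed.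

Lemma gsrc_div g h : gsrc g = gsrc h -> gsrc (gmul g (ginv h)) = grng h.
Proof. by move=> gh; rewrite gsrc_mul ?grng_inv // gsrc_inv. Qed.

Lemma gdivK g h : gsrc g = gsrc h -> gmul (gmul g (ginv h)) h = g.
Proof. by move=> gh; rewrite gmulA ?gsrc_inv ?grng_inv // ginv_mul -gh gmul_id. Qed.

Lemma ginvK g : ginv (ginv g) = g.
Proof.
rewrite -[LHS]gmul_id gsrc_inv grng_inv -ginv_mul -gmulA ?gsrc_inv ?grng_inv //.
by rewrite ginv_mul gsrc_inv gid_mul.
Qed.

End AbstractGroupoid.

(** * Products of the functions 1_Z(q,p) *)

Section Convolution.
Variables (R : realType) (E : digraph).
Local Notation T := (ucover E).
Local Notation G := (toeplitz_groupoid E).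
Implicit Types (p q r d w a b : gpath E) (e : edge E) (L : seq (edge E)).
Implicit Types (x y : spectrum T) (g h k c : G) (f : G -> R[i]).

Definition quot q p := pmul q (pinv p).

Lemma po_quot q p : pt q = pt p -> po (quot q p) = po q.
Proof. by move=> qp; rewrite po_pmul. Qed.
Lemma pt_quot q p : pt q = pt p -> pt (quot q p) = po p.
Proof. by move=> qp; rewrite pt_pmul // pt_pinv. Qed.
Lemma quotK q p : pt q = pt p -> pmul (quot q p) p = q.
Proof. by move=> qp; rewrite pmulA ?pt_pinv // pmulV -qp pmulp0. Qed.
Lemma quotM r q p : pt r = pt q -> pt q = pt p ->
  pmul (quot r q) (quot q p) = quot r p.
Proof.
by move=> rq qp; rewrite -{2}(quotK rq) [in RHS]/quot -pmulA // ?po_quot ?pt_quot // quotK.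
Qed.
Lemma quotV q p : pt q = pt p -> pinv (quot q p) = quot p q.
Proof. by move=> qp; rewrite /quot pinv_pmul // pinvK. Qed.
Lemma quot_pmul q p d : pt q = pt p -> pt p = po d ->
  quot (pmul q d) (pmul p d) = quot q p.
Proof.
move=> qp pd; have qd : pt q = po d by rewrite qp.
have h1 : pt (pmul q d) = po (pinv d) by rewrite pt_pmul.
have h2 : pt (pinv d) = po (pinv p) by rewrite pt_pinv.
by rewrite /quot pinv_pmul // -(pmulA h1 h2) [pmul (pmul q d) _]pmulA // pmulVr -qd pmulp0.
Qed.

Lemma gdivE g h : gsrc g = gsrc h ->
  [/\ gsrc (gmul g (ginv h)) = grng h, gmul (gmul g (ginv h)) h = g,
      lab (gmul g (ginv h)) = pmul (lab g) (pinv (lab h)) &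
      pnt (gmul g (ginv h)) = pnt' h].
Proof.
move=> gh; have gh' : gsrc g = grng (ginv h) by rewrite grng_inv.
have [l1 l2] := gmulE gh'.
by split; [exact: gsrc_div|exact: gdivK|rewrite l1|rewrite l2].
Qed.

Definition setprod (A B : set G) : set G :=
  [set c | exists g h, [/\ A g, B h, gsrc g = grng h & gmul g h = c]].

(* The term of the convolution at [c] that comes from the arrow with label [b]
   and the same source as [c], if there is one. *)
Definition conv_at (f1 f2 : G -> R[i]) c b : R[i] :=
  if pselect (exists h, lab h = b /\ gsrc c = gsrc h) is left H then
    f1 (gmul c (ginv (projT1 (cid H)))) * f2 (projT1 (cid H)) else 0.

Lemma arrow_unique g h k : gsrc g = gsrc h -> gsrc g = gsrc k -> lab h = lab k -> h = k.
Proof.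
move=> gh gk hk; apply: G_ext => //; rewrite /prg.
by move: gh gk => /gsrcE <- /gsrcE <-.
Qed.

Lemma conv_atE f1 f2 c h : gsrc c = gsrc h ->
  conv_at f1 f2 c (lab h) = f1 (gmul c (ginv h)) * f2 h.
Proof.
move=> ch; rewrite /conv_at; case: pselect => [H|]; last by case; exists h.
case: cid => k /= [kh ck]; suff -> : k = h by [].
exact: (arrow_unique ck ch kh).
Qed.

(** A label and a source fix an arrow ([arrow_unique]), so over each source such an [f] has at most
    as many nonzero values as [A] has labels. The size of [A] is the constant in the norm
    estimates. *)
Definition suppin (A : seq (gpath E)) (f : G -> R[i]) := forall g, f g != 0 -> lab g \in A.

(** The right factor of a factorisation of [c] has the source of [c], so it is known from its label,
    and the sum over factorisations becomes a sum over labels. *)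
Lemma gconvE f1 f2 c A : uniq A -> suppin A f2 ->
  gconv f1 f2 c = \sum_(b <- A) conv_at f1 f2 c b.
Proof.
move=> uA fA; pose P b := `[< exists h, lab h = b /\ gsrc c = gsrc h >].
(* The value [c] is a placeholder for labels without an arrow over this source; [P] filters them
   out. *)
pose F b : G := xget c [set h | lab h = b /\ gsrc c = gsrc h].
have FP b : P b -> lab (F b) = b /\ gsrc c = gsrc (F b).
  by move=> /asboolP[h hb]; rewrite /F; case: xgetP => [k _ //|/(_ h)].
pose phi b := (gmul c (ginv (F b)), F b).
pose A' := [seq b <- A | P b].
have uphi : uniq (map phi A').
  rewrite map_inj_in_uniq ?filter_uniq // => b b'.
  rewrite !mem_filter => /andP[/FP[lb _] _] /andP[/FP[lb' _] _] /(congr1 snd)/= bb'.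
  by rewrite -lb -lb' bb'.
rewrite /gconv -(@fsbig_widen _ _ _ _ [set` map phi A']).
- rewrite -fsbig_seq // big_map big_filter [RHS](bigID P) /=.
  rewrite [X in _ = _ + X]big1 ?addr0.
    apply: eq_bigr => b /FP[lb cb]; rewrite -[in RHS]lb conv_atE //=.
  move=> b nPb; rewrite /conv_at; case: pselect => // H.
  by case/asboolP: nPb.
- move=> gh /mapP[b]; rewrite mem_filter => /andP[/FP[lb cb] _] -> /=.
  by have [h1 h2 _ _] := gdivE cb.
- move=> [g h] [[gh ghc] ngh]; apply: contrapT => /eqP.
  have {}gh : gsrc g = grng h := gh; have {}ghc : gmul g h = c := ghc.
  rewrite mulf_eq0 negb_or => /andP[_ f2h]; apply: ngh.
  have ch : gsrc c = gsrc h by rewrite -ghc gsrc_mul.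
  have Ph : P (lab h) by apply/asboolP; exists h.
  have [lF cF] := FP _ Ph.
  have hF : F (lab h) = h by apply: (arrow_unique cF ch lF).
  apply/mapP; exists (lab h); first by rewrite mem_filter Ph fA.
  by rewrite /phi hF -{1}(gmulKr gh) ghc.
Qed.

(** As [B] lies in one slice, the right factor of [c] is unique and no multiplicity arises. *)
Lemma gconv_indic (A B : set G) b : B `<=` [set h | lab h = b] ->
  gconv \1_A \1_B = \1_(setprod A B) :> (G -> R[i]).
Proof.
move=> Bb; apply/funext => c; rewrite (@gconvE _ _ _ [:: b]) //; last first.
  move=> h; rewrite indicE inE; case: (boolP (h \in B)) => [/set_mem/Bb /= -> //|].
  by rewrite eqxx.
rewrite big_seq1 !indicE; case: (boolP (c \in setprod A B)) => [/set_mem|nc].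
  move=> [g [h [Ag Bh gh ghc]]]; rewrite -(Bb h Bh).
  have ch : gsrc c = gsrc h by rewrite -ghc gsrc_mul.
  rewrite conv_atE // -ghc gmulKr //.
  by rewrite !indicE !mem_set // mulr1.
rewrite /conv_at; case: pselect => // H; case: cid => h /= [_ ch].
rewrite !indicE; case: (boolP (h \in B)) => [/set_mem Bh|]; last by rewrite mulr0.
case: (boolP (_ \in A)) => [/set_mem Ag|]; last by rewrite mul0r.
case/negP: nc; apply/mem_set.
have [h1 h2 _ _] := gdivE ch.
by exists (gmul c (ginv h)), h.
Qed.

Definition chi q p : G -> R[i] := \1_(Zset q p).

Lemma prs_pnt' g q : directed q -> po q = po (lab g) ->
  prs (pnt' g) q <-> val (pnt g) (VL (pmul (pinv (lab g)) q) [::]).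
Proof. exact: prs_act. Qed.

Lemma Zset_exists x q p : XE x -> prs x p -> directed q -> pt q = pt p ->
  exists2 g, Zset q p g & pnt g = x.
Proof.
move=> Xx xp dq qp; have [|g [lg gx]] := @G_exists E x (quot q p) p Xx xp (pt_quot qp).
  by rewrite quotK.
by exists g => //; split=> //; rewrite /prg gx.
Qed.

Lemma Zset_rng g q p : directed q -> pt q = pt p -> Zset q p g -> prs (pnt' g) q.
Proof.
move=> dq qp Zg; have := directed_lab qp Zg => <-.
by apply: prg_rng; [exact: Zg.2|rewrite (directed_lab qp Zg)].
Qed.

(** On operators, [S_p^*] cancels the head of [S_(p d)]. For the inclusion from right to left, [c]
    is divided by the arrow of [Zset (pmul p d) r] over the same source. *)
Lemma chi_mul_ext q p d r : directed q -> directed p -> directed d -> directed r ->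
  pt q = pt p -> pt p = po d -> pt d = pt r ->
  gconv (chi q p) (chi (pmul p d) r) = chi (pmul q d) r.
Proof.
move=> dq dp dd dr qp pd dr'; have qd : pt q = po d by rewrite qp.
have pdr : pt (pmul p d) = pt r by rewrite pt_pmul.
have qdr : pt (pmul q d) = pt r by rewrite pt_pmul.
have qpd : pt (pmul q d) = pt (pmul p d) by rewrite !pt_pmul.
rewrite /chi (@gconv_indic _ _ (quot (pmul p d) r)); last by move=> h [].
congr (\1_ _); apply/seteqP; split=> c.
  move=> [g [h [[lg gp] [lh hr] gh <-]]]; have [lgh pgh] := gmulE gh.
  split; last by rewrite /prg pgh.
  rewrite lgh lg lh -/(quot q p) -/(quot (pmul p d) r) -/(quot (pmul q d) r).
  by rewrite -(quot_pmul qp pd) quotM.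
move=> [lc cr].
have [h Zh hc] := Zset_exists (XE_pnt c) cr (directed_pmul pd dp dd) pdr.
have ch : gsrc c = gsrc h by apply/gsrcE.
have [h1 h2 h3 h4] := gdivE ch.
exists (gmul c (ginv h)), h; split=> //; split.
  rewrite h3 lc Zh.1 -/(quot (pmul p d) r) -/(quot (pmul q d) r).
  by rewrite quotV // quotM // quot_pmul.
rewrite /prg h4; apply: (prs_down (Zset_rng (directed_pmul pd dp dd) pdr Zh)) => //.
exact: VL_pmul.
Qed.

Lemma ginvol_chi q p : directed q -> directed p -> pt q = pt p ->
  ginvol (chi q p) = chi p q.
Proof.
move=> dq dp qp; apply/funext => g; rewrite /ginvol /chi !indicE conjC_nat; congr (_%:R).
congr nat_of_bool; apply: asbool_equiv_eq.
have inv r s h : directed r -> directed s -> pt r = pt s -> Zset r s h -> Zset s r (ginv h).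
  move=> dr ds rs Zh; split; last exact: Zset_rng Zh.
  by rewrite (ginvE h).1 Zh.1 -/(quot r s) quotV.
split=> [h|]; last exact: inv.
by rewrite -(ginvK g); exact: inv.
Qed.

Lemma chi_mul_restr q p d r : directed q -> directed p -> directed d -> directed r ->
  pt q = pt d -> pt p = po d -> pt p = pt r ->
  gconv (chi q (pmul p d)) (chi p r) = chi q (pmul r d).
Proof.
move=> dq dp dd dr qd pd pr; have rd : pt r = po d by rewrite -pr.
have qpd : pt q = pt (pmul p d) by rewrite pt_pmul.
have prd : pt (pmul p d) = pt (pmul r d) by rewrite !pt_pmul.
have qrd : pt q = pt (pmul r d) by rewrite pt_pmul.
have labd h : lab h = quot p r -> pmul (pinv (lab h)) (pmul p d) = pmul r d.
  by move=> ->; rewrite quotV // -(pmulA _ pd) ?pt_quot // quotK.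
rewrite /chi (@gconv_indic _ _ (quot p r)); last by move=> h [].
congr (\1_ _); apply/seteqP; split=> c.
  move=> [g [h [[lg gp] [lh hr] gh <-]]]; have [lgh pgh] := gmulE gh.
  split.
    rewrite lgh lg lh -/(quot p r) -/(quot q (pmul p d)) -/(quot q (pmul r d)).
    by rewrite -(quot_pmul pr rd) quotM.
  rewrite /prg pgh; split; first exact: directed_pmul.
  have /gsrc_rng gh' := gh.
  rewrite -(labd h lh); apply/prs_pnt'; rewrite -?gh' //; first exact: directed_pmul.
  by rewrite lh -/(quot p r) po_quot // po_pmul.
move=> [lc crd].
have cr : prg c r by apply: (prs_down crd) => //; apply: VL_pmul.
have [h Zh hc] := Zset_exists (XE_pnt c) cr dp pr.
have ch : gsrc c = gsrc h by apply/gsrcE.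
have [h1 h2 h3 h4] := gdivE ch.
exists (gmul c (ginv h)), h; split=> //; split.
  rewrite h3 lc Zh.1 -/(quot p r) -/(quot q (pmul r d)) -/(quot q (pmul p d)).
  by rewrite quotV // -(quot_pmul (esym pr) pd) quotM.
rewrite /prg h4; apply/prs_pnt'; first exact: directed_pmul.
  by rewrite Zh.1 -/(quot p r) po_quot // po_pmul.
by rewrite labd ?Zh.1 // hc; exact: crd.2.
Qed.

Lemma chi_mul_orth q p p' r : directed p' -> pt p' = pt r ->
  ~ (VL p [::] p' \/ VL p' [::] p) -> gconv (chi q p) (chi p' r) = fun=> 0.
Proof.
move=> dp' pr npp; rewrite /chi (@gconv_indic _ _ (quot p' r)); last by move=> h [].
rewrite (_ : setprod _ _ = set0); first by apply/funext => g; rewrite indicE in_set0.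
apply/seteqP; split=> // c [g [h [[lg gp] Zh /gsrc_rng gh _]]].
apply: npp; apply: (prs_total _ (Zset_rng dp' pr Zh)).
by rewrite -gh.
Qed.

(** The case split behind all products of functions [chi] and of operators [S_q S_p^*]: the first
    two cases give one such term, the third gives zero. *)
Lemma directed_compare p q : directed p -> directed q ->
  [\/ exists d, [/\ q = pmul p d, pt p = po d & directed d],
      exists d, [/\ p = pmul q d, pt q = po d & directed d] |
      ~ (VL p [::] q \/ VL q [::] p)].
Proof.
move=> dp dq; have [/VLP[d [qE pd dd _]]|npq] := pselect (VL p [::] q).
  by apply: Or31; exists d.
have [/VLP[d [qE pd dd _]]|nqp] := pselect (VL q [::] p).
  by apply: Or32; exists d.
by apply: Or33; case.
Qed.

Lemma continuousP_G f : continuous (f : G -> R[i]^o) <->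
  forall g (e : R), 0 < e -> exists p (L : seq (edge E)),
    [/\ prg g p, avoids (pnt g) p L & forall h, basic (lab g) p L h -> rabs (f g - f h) < e].
Proof.
split=> [cf g e e0|cf g U /nbhs_rnormP[e e0 eU]].
  have := cf g [set z | rabs (f g - z) < e]; case.
    by apply/nbhs_rnormP; exists e.
  move=> V [oV Vg] VP.
  have /nbhsG[p [L [gp gL pL]]] : nbhs g V by apply: open_nbhs_nbhs.
  by exists p, L; split=> // h /pL/VP.
have [p [L [gp gL pL]]] := cf g e e0.
by apply/nbhsG; exists p, L; split=> // h /pL/eU.
Qed.

Lemma continuous_locconst f :
  (forall g, exists U, [/\ nbhs g U & forall h, U h -> f h = f g]) ->
  continuous (f : G -> R[i]^o).
Proof.
move=> lf; apply/continuousP_G => g e e0; have [U [gU fU]] := lf g.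
have /nbhsG[p [L [gp gL pL]]] := gU; exists p, L; split=> // h /pL/fU ->.
by rewrite subrr rabs0.
Qed.

Definition good (qp : gpath E * gpath E) :=
  [/\ directed qp.1, directed qp.2 & pt qp.1 = pt qp.2].

(** Compact support is traded for a finite cover by sets [Zset]. Finite unions of these are compact
    and closed, and therefore contain the closure of the support. *)
Lemma CcP f : Cc f <-> continuous (f : G -> R[i]^o) /\
  exists l : seq (gpath E * gpath E), (forall qp, qp \in l -> good qp) /\
    forall g, f g != 0 -> exists2 qp, qp \in l & Zset qp.1 qp.2 g.
Proof.
split=> [[cf]|[cf [l [gl fl]]]].
  move=> /(@compact_seq_cover _ _ (fun qp => Zset qp.1 qp.2) good)[].
    move=> g _; have [q [p [dq dp qp Zg]]] := Zset_cover g.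
    by exists (q, p); split=> //; apply: open_nbhs_nbhs; split=> //; exact: Zset_open.
  move=> l [lg lc]; split=> //; exists l; split=> // g fg.
  by have [qp ql Zg] := lc g (@subset_closure _ [set a : G | f a != 0] g fg); exists qp.
split=> //; pose K := \big[setU/set0]_(qp <- l) Zset qp.1 qp.2.
have KE : K = [set g | exists2 qp, qp \in l & Zset qp.1 qp.2 g].
  rewrite /K -bigcup_seq; apply/seteqP; split=> g.
    by move=> [qp /= ql Zg]; exists qp.
  by move=> [qp ql Zg]; exists qp.
have cK : compact K.
  rewrite /K; elim: l gl {fl K KE} => [|qp l IH] gl; first by rewrite big_nil; exact: compact0.
  rewrite big_cons; apply: compactU; last by apply: IH => qp' ?; apply: gl; rewrite inE orbC; apply/orP; left.
  by have [dq dp h] := gl qp (mem_head _ _); exact: Zset_compact.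
have clK : closed K.
  rewrite /K; elim: l gl {fl K KE cK} => [|qp l IH] gl; first by rewrite big_nil; exact: closed0.
  rewrite big_cons; apply: closedU; last by apply: IH => qp' ?; apply: gl; rewrite inE orbC; apply/orP; left.
  by have [dq dp h] := gl qp (mem_head _ _); exact: Zset_closed.
apply: (subclosed_compact _ cK); first exact: closed_closure.
rewrite closureE; apply: smallest_sub => // g fg; rewrite KE; exact: fl.
Qed.

Lemma Cc_sub f1 f2 : Cc f1 -> continuous (f2 : G -> R[i]^o) ->
  (forall g, f2 g != 0 -> f1 g != 0) -> Cc f2.
Proof.
move=> /CcP[_ [l [gl f1l]]] cf2 f21; apply/CcP; split=> //.
by exists l; split=> // g /f21/f1l.
Qed.

Lemma Cc_suppin f : Cc f -> exists A, suppin A f.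
Proof.
move=> /CcP[_ [l [gl fl]]]; exists (map (fun qp => quot qp.1 qp.2) l) => g /fl[qp ql [-> _]].
by apply/mapP; exists qp.
Qed.

Lemma Cc_chi q p : directed q -> directed p -> pt q = pt p -> Cc (chi q p).
Proof.
move=> dq dp qp; apply/CcP; split; last first.
  exists [:: (q, p)]; split=> [qp'|g]; first by rewrite inE => /eqP ->.
  rewrite /chi indicE; case: (boolP (g \in _)) => [/set_mem Zg _|]; last by rewrite eqxx.
  by exists (q, p) => //; rewrite inE.
apply: continuous_locconst => g.
have [Zg|nZg] := pselect (Zset q p g).
  exists (Zset q p); split; first by apply: open_nbhs_nbhs; split=> //; exact: Zset_open.
  by move=> h Zh; rewrite /chi !indicE !mem_set.
exists (~` Zset q p); split.
  by apply: open_nbhs_nbhs; split=> //; apply: closed_openC; exact: Zset_closed.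
by move=> h nZh; rewrite /chi !indicE !memNset.
Qed.

Lemma CcD f1 f2 : Cc f1 -> Cc f2 -> Cc (f1 \+ f2).
Proof.
move=> /CcP[c1 [l1 [g1 fl1]]] /CcP[c2 [l2 [g2 fl2]]]; apply/CcP; split.
  by move=> g; apply: (@continuousD _ R[i]^o); [exact: c1|exact: c2].
exists (l1 ++ l2); split=> [qp|g]; first by rewrite mem_cat => /orP[/g1|/g2].
move=> fg; have [/eqP f1g|/fl1[qp ql Zg]] := boolP (f1 g == 0); last first.
  by exists qp => //; rewrite mem_cat ql.
have [|qp ql Zg] := fl2 g; first by move: fg; rewrite /= f1g add0r.
by exists qp => //; rewrite mem_cat ql orbT.
Qed.

Lemma CcZ (k : R[i]) f : Cc f -> Cc (fun g => k * f g).
Proof.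
move=> Cf; apply: (Cc_sub Cf); first by move=> g; apply: (@continuous_comp _ R[i]^o R[i]^o f ( *%R k) g);
    [exact: Cf.1|exact: mulrl_continuous].
by move=> g; rewrite mulf_eq0 negb_or => /andP[].
Qed.

Lemma Cc0 : Cc (fun _ : G => 0 : R[i]).
Proof.
apply/CcP; split; first by apply: continuous_locconst => g; exists setT; split=> //; exact: filterT.
by exists [::]; split=> // g; rewrite eqxx.
Qed.

Local Notation coef := (R[i] * (gpath E * gpath E))%type.

(** * Linear combinations and uniform approximation *)

Definition lgood (l : seq coef) := forall t, t \in l -> good t.2.

Definition ev (l : seq coef) : G -> R[i] :=
  fun g => \sum_(t <- l) t.1 * chi t.2.1 t.2.2 g.

Lemma ev_cons t l g : ev (t :: l) g = t.1 * chi t.2.1 t.2.2 g + ev l g.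
Proof. by rewrite /ev big_cons. Qed.

Lemma ev_cat l m g : ev (l ++ m) g = ev l g + ev m g.
Proof. by rewrite /ev big_cat. Qed.

Lemma lgood_cons t l : lgood (t :: l) <-> good t.2 /\ lgood l.
Proof.
split=> [gl|[gt gl] u]; last by rewrite inE => /predU1P[->//|/gl].
by split=> [|u ul]; apply: gl; rewrite inE ?eqxx // ul orbT.
Qed.

Lemma lgood_cat l m : lgood l -> lgood m -> lgood (l ++ m).
Proof. by move=> gl gm t; rewrite mem_cat => /orP[/gl|/gm]. Qed.

Definition step f := exists2 l, lgood l & f = ev l.

Lemma step0 : step (fun=> 0).
Proof. by exists [::] => //; apply/funext => g; rewrite /ev big_nil. Qed.

Lemma stepD f1 f2 : step f1 -> step f2 -> step (f1 \+ f2).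
Proof.
move=> [l gl ->] [m gm ->]; exists (l ++ m); first exact: lgood_cat.
by apply/funext => g; rewrite ev_cat.
Qed.

Lemma stepZ (z : R[i]) f : step f -> step (fun g => z * f g).
Proof.
move=> [l gl ->]; exists (map (fun t => (z * t.1, t.2)) l).
  by move=> _ /mapP[t /gl gt ->].
by apply/funext => g; rewrite /ev big_map mulr_sumr; apply: eq_bigr => t _; rewrite mulrA.
Qed.

Lemma step_chi q p : directed q -> directed p -> pt q = pt p -> step (chi q p).
Proof.
move=> dq dp qp; exists [:: (1, (q, p))]; first by move=> t; rewrite inE => /eqP ->.
by apply/funext => g; rewrite /ev big_seq1 mul1r.
Qed.

(** In general outside [Cc]; it is a multiplier that cuts a [Zset] down to a longer prefix. *)
Definition cyl r : G -> R[i] := \1_[set g : G | prg g r].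

Lemma step_cyl f r : step f -> directed r -> step (fun g => f g * cyl r g).
Proof.
move=> [l gl ->] dr; elim: l gl => [_|[z [q p]] l IH /lgood_cons[/= [dq dp qp] gl]].
  by under eq_fun do rewrite /ev big_nil mul0r; exact: step0.
under eq_fun do rewrite ev_cons mulrDl; apply: stepD; last exact: IH.
rewrite /=; under eq_fun do rewrite -mulrA; apply: stepZ.
have h1 (A : set G) g : Zset q p g -> A g -> chi q p g * \1_A g = 1.
  by move=> Zg Ag; rewrite /chi !indicE !mem_set // mulr1.
have h2 (A : set G) g : ~ (Zset q p `&` A) g -> chi q p g * \1_A g = 0.
  move=> nZ; rewrite /chi !indicE; case: (boolP (g \in A)) => [/set_mem Ag|]; last by rewrite mulr0.
  rewrite memNset ?mul0r // => Zg; exact: nZ.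
have [[d [rE pd dd]]|[d [pE rd dd]]|npr] := directed_compare dp dr.
- rewrite (_ : (fun _ => _) = chi (pmul q d) (pmul p d)).
    have qd : pt q = po d by rewrite qp.
    by apply: step_chi; rewrite ?pt_pmul //; exact: directed_pmul.
  apply/funext => g; rewrite [RHS]indicE.
  have qq : quot (pmul q d) (pmul p d) = quot q p by rewrite quot_pmul.
  case: (boolP (g \in _)) => [/set_mem [lg gr]|/negP nZ].
    apply: h1; last by rewrite /= rE.
    split; first by rewrite lg; exact: qq.
    by apply: (prs_down gr) => //; apply: VL_pmul.
  apply: h2 => -[[lg gp] gr]; apply: nZ; apply/mem_set; split.
    by rewrite lg -/(quot q p) -qq.
  by rewrite -rE.
- rewrite (_ : (fun _ => _) = chi q p); first exact: step_chi.
  apply/funext => g; rewrite [RHS]indicE.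
  case: (boolP (g \in _)) => [/set_mem Zg|/negP nZ].
    apply: h1 => //; apply: (prs_down Zg.2) => //.
    by rewrite [p]pE; apply: VL_pmul.
  by apply: h2 => -[Zg _]; apply: nZ; apply/mem_set.
- rewrite (_ : (fun _ => _) = fun=> 0); first exact: step0.
  apply/funext => g; apply: h2 => -[[_ gp] gr]; apply: npr.
  exact: (prs_total gp gr).
Qed.

(** The product is pointwise, not the convolution. It serves to make the overlapping pieces of a
    cover disjoint. *)
Lemma stepM f1 f2 : step f1 -> step f2 -> step (fun g => f1 g * f2 g).
Proof.
move=> s1 [l gl ->]; elim: l gl => [_|[z [q p]] l IH /lgood_cons[/= [dq dp qp] gl]].
  by under eq_fun do rewrite /ev big_nil mulr0; exact: step0.
under eq_fun do rewrite ev_cons mulrDr; apply: stepD; last exact: IH.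
rewrite /=; under eq_fun do rewrite mulrCA; apply: stepZ.
have [m gm ->] := s1; elim: m gm {s1 f1 IH} => [_|[z' [q' p']] m IHm /lgood_cons[/= [dq' dp' qp'] gm]].
  by under eq_fun do rewrite /ev big_nil mul0r; exact: step0.
under eq_fun do rewrite ev_cons mulrDl; apply: stepD; last exact: IHm.
rewrite /=; under eq_fun do rewrite -mulrA; apply: stepZ.
have [qq|nqq] := eqVneq (quot q p) (quot q' p').
  have := step_cyl (step_chi dq' dp' qp') dp; congr step; apply/funext => g.
  rewrite /chi !indicE; case: (boolP (g \in Zset q' p')) => [/set_mem Zg|]; last by rewrite !mul0r.
  congr (_ * (nat_of_bool _)%:R); apply: asbool_equiv_eq; split=> [gp|[]//].
  by split=> //; rewrite Zg.1 -/(quot q' p').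
rewrite (_ : (fun _ => _) = fun=> 0); first exact: step0.
apply/funext => g; rewrite /chi !indicE.
case: (boolP (g \in Zset q p)) => [/set_mem Zg|]; last by rewrite mulr0.
rewrite memNset ?mul0r // => Zg'; case/eqP: nqq.
by rewrite /quot -Zg.1 -Zg'.1.
Qed.

Lemma indicM (A B : set G) g : \1_(A `&` B) g = \1_A g * \1_B g :> R[i].
Proof. by rewrite indicI. Qed.

Lemma step_basic q p r L : directed q -> directed p -> pt q = pt p -> directed r ->
  step \1_(Zset q p `&` [set g | prg g r /\ avoids (pnt g) r L]).
Proof.
move=> dq dp qp dr.
pose A M := [set g : G | avoids (pnt g) r M].
have -> : Zset q p `&` [set g | prg g r /\ avoids (pnt g) r L] =
    (Zset q p `&` [set g | prg g r]) `&` A L.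
  by apply/seteqP; split=> g; [move=> [? []]|move=> [[? ?] ?]].
have : step \1_(Zset q p `&` [set g : G | prg g r]).
  have := step_cyl (step_chi dq dp qp) dr; congr step.
  by apply/funext => g; rewrite indicM.
move: (Zset q p `&` _) => B sB; elim: L => [|e L IH].
  suff -> : B `&` A [::] = B by [].
  by apply/seteqP; split=> g => [[]//|Bg]; split=> //; exact: avoids_nil.
have [[re de]|nre] := pselect (pt r = eo e /\ dpos e); last first.
  suff -> : A (e :: L) = A L by [].
  apply/seteqP; split=> g gA f fL.
    by apply: gA; rewrite inE fL orbT.
  by move: fL; rewrite inE => /predU1P[->|/gA//] h1 h2; case: nre.
have dre : directed (pmul r (path1 e)) by apply: directed_pmul; rewrite ?directed1.
(* Forbidding one more letter [e] removes the cylinder of [r e]. *)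
have := stepD IH (stepZ (-1) (step_cyl IH dre)); congr step; apply/funext => g /=.
rewrite /cyl mulN1r !indicE.
case: (boolP (g \in B `&` A L)) => [/set_mem[Bg Ag]|/negP nBA]; last first.
  rewrite mul0r subr0 memNset // => -[Bg Ag]; apply: nBA; apply/mem_set.
  by split=> // f fL; apply: Ag; rewrite inE fL orbT.
rewrite mul1r; case: (boolP (g \in [set g : G | prg g _])) => [/set_mem gre|/negP gre].
  by rewrite subrr memNset // => -[_ /(_ e (mem_head _ _) re de)].
rewrite subr0 mem_set //; split=> // f; rewrite inE => /predU1P[-> _ _ gp|/Ag//].
by apply: gre; apply/mem_set.
Qed.

(** [A] comes before [e]: approximants of every precision have labels in one finite set. The closure
    of the support is covered by finitely many basic sets on each of which [f] is within [e] of a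
    constant, and each piece overwrites the values already assigned on it. *)
Lemma step_approx f : Cc f -> exists A : seq (gpath E), suppin A f /\
  forall e : R, 0 < e -> exists l, [/\ lgood l, suppin A (ev l) &
    forall g, rabs (f g - ev l g) <= e].
Proof.
move=> Cf; have [A fA] := Cc_suppin Cf; exists A; split=> // e e0.
pose K := closure [set g : G | f g != 0].
(* Labels are locally constant, so passing to the closure adds none. *)
have KA : K `<=` [set g | lab g \in A].
  rewrite /K closureE; apply: smallest_sub => //.
  rewrite -openC (_ : ~` _ = [set g | lab g \notin A]).
    exact: (lab_open [set a | a \notin A]).
  by apply/seteqP; split=> g /negP.
pose D (j : R[i] * set G) := [/\ step \1_(j.2), forall h, j.2 h -> rabs (f h - j.1) <= e &
   j.2 `<=` [set g | lab g \in A]].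
have := @compact_seq_cover _ _ (fun j => j.2) D K Cf.2.
case=> [g Kg|l [lD lK]].
  have [p [L [gp gL pL]]] := (continuousP_G f).1 Cf.1 g e e0.
  have [q' [p' [dq' dp' qp' Zg]]] := Zset_cover g.
  exists (f g, Zset q' p' `&` [set g | prg g p /\ avoids (pnt g) p L]); split; last first.
    have := filterI (open_nbhs_nbhs (conj (@Zset_open _ q' p') Zg)) (basic_nbhs gp gL).
    move=> /(_ (nbhs_filter g)); apply: (@filterS _ (nbhs g)) => h [Zh [_ h1 h2]].
    by split.
  have dp := prg_directed gp.
  split.
  - exact: (step_basic L dq' dp' qp' dp).
  - move=> h [Zh [hp hL]]; rewrite rabsB; apply: ltW; apply: pL; split=> //.
    by rewrite Zh.1 Zg.1.
  - by move=> h [Zh _]; rewrite /= Zh.1 -Zg.1; exact: KA.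
pose U := [set h | exists2 j, j \in l & j.2 h].
suff [F [[m gm FE] FU Ff]] : exists F, [/\ step F, forall h, F h != 0 -> U h &
    forall h, U h -> rabs (f h - F h) <= e].
  subst F; exists m; split=> //.
    by move=> h /FU[j jl jh]; have [_ _] := lD j jl; apply.
  move=> h; have [Uh|nU] := pselect (U h); first exact: Ff.
  have -> : f h = 0.
    apply/eqP; apply: contrapT => /negP fh; apply: nU.
    exact: lK (@subset_closure _ [set g : G | f g != 0] h fh).
  have -> : ev m h = 0 by apply/eqP; apply: contrapT => /negP /FU.
  by rewrite subrr rabs0 ltW.
rewrite /U; elim: l lD {lK U} => [_|[z V] l IH lD].
  exists (fun=> 0); split; [exact: step0|by move=> h; rewrite eqxx|by move=> h []].
have [|F [sF FU Ff]] := IH; first by move=> j jl; apply: lD; rewrite inE jl orbT.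
have [/= sV Vf _] := lD _ (mem_head _ _).
(* On [V] the old value is subtracted and replaced by [z]; outside [V] nothing changes. *)
exists (fun h => z * \1_V h + (F h + (-1) * (F h * \1_V h))); split.
- apply: stepD; first exact: stepZ.
  by apply: stepD => //; apply: stepZ; exact: stepM.
- move=> h; rewrite indicE; case: (boolP (h \in V)) => [/set_mem Vh _|_].
    by exists (z, V) => //; exact: mem_head.
  rewrite !mulr0 add0r addr0 => /FU[j jl jh]; exists j => //.
  by rewrite inE jl orbT.
- move=> h Uh; rewrite indicE; case: (boolP (h \in V)) => [/set_mem Vh|nV].
    by rewrite !mulr1 mulN1r subrr addr0; exact: Vf.
  rewrite !mulr0 add0r addr0; apply: Ff; move: Uh => [j].
  rewrite inE => /predU1P[-> /= Vh|jl jh]; last by exists j.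
  by rewrite mem_set in nV.
Qed.

Lemma ev_Cc l : lgood l -> Cc (ev l).
Proof.
elim: l => [_|[z [q p]] l IH /lgood_cons[/= [dq dp qp] gl]].
  have := Cc0; congr Cc; apply/funext => g; rewrite /ev big_nil //.
have -> : ev ((z, (q, p)) :: l) = (fun g => z * chi q p g) \+ ev l.
  by apply/funext => g; rewrite ev_cons.
by apply: CcD; [apply: CcZ; exact: Cc_chi|exact: IH].
Qed.

End Convolution.

(** * The operators of a Toeplitz family *)

Section PathOperators.
Variables (R : realType) (E : digraph) (H : hilbert R).
Variable SP : (pedge E -> bop H) * (vertex E -> bop H).
Hypothesis tf : toeplitz_family SP.
Implicit Types (p q r d a : gpath E) (e f : edge E) (u v : vertex E) (x y : H).

Definition proj_at u : bop H := SP.2 u.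
(** Extended by zero to negative edges, so that every word of edges has an operator without a proof
    of directedness. *)
Definition isom_at e : bop H := if insub e is Some e' then SP.1 e' else bzero H.
Local Notation P := proj_at.
Local Notation S := isom_at.

Lemma isom_atE (e' : pedge E) : S (val e') = SP.1 e'.
Proof. by rewrite /isom_at valK. Qed.

Lemma isom_atP e : dpos e -> exists2 e' : pedge E, val e' = e & S e = SP.1 e'.
Proof. by move=> de; exists (exist _ e de) => //; rewrite -isom_atE. Qed.

Lemma PP u x : P u (P u x) = P u x.
Proof. by have /projectionP[h _] := tf_proj tf u; exact: h. Qed.

Lemma P_adj u x y : hdot H (P u x) y = hdot H x (P u y).
Proof. by have /projectionP[_ h] := tf_proj tf u; exact: h. Qed.

Lemma P_orth u v x : u <> v -> P u (P v x) = 0.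
Proof. by move=> uv; exact: (tf_orth tf). Qed.

Lemma SadjS e x : dpos e -> adj (S e) (S e x) = P (et e) x.
Proof. by move=> /isom_atP[e' <- ->]; exact: (tf_init tf). Qed.

Lemma S_P e x : dpos e -> S e (P (et e) x) = S e x.
Proof.
move=> de; rewrite -SadjS //; have [e' _ ->] := isom_atP de.
exact: (tf_isom tf).
Qed.

(** Condition (v) bounds the full sum [Q]; finite partial sums lie below it because the terms are
    positive. One edge gives [P_S], two edges give [SadjS_orth]. *)
Lemma range_sum_le u (F : {fset pedge E}) x : [set` F] `<=` [set f | eo (val f) = u] ->
  \sum_(f <- F) rnorm (adj (SP.1 f) x) ^+ 2 <= rdot (P u x) x.
Proof.
move=> Fu; have [Q Qs QP] := tf_final tf u.
apply/ler_addgt0Pr => e e0.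
have c0 : 0 < rnorm x + 1 by rewrite ltr_wpDl ?rnorm_ge0.
(* The error will be paired with [x], hence the division by [|x| + 1]; the added one keeps the
   divisor positive. *)
have [F0 F0D F0P] := Qs x [set y | rnorm (Q x - y) < e / (rnorm x + 1)] (ltac:(
  by apply/nbhs_rnormP; exists (e / (rnorm x + 1)) => //; rewrite divr_gt0)).
have FF0 : [set` (F0 `|` F)%fset] `<=` [set f | eo (val f) = u].
  by move=> f /fsetUP[/F0D|/Fu].
have := F0P (F0 `|` F)%fset (fsubsetUl _ _) FF0; rewrite /= => h.
have sE (F1 : {fset pedge E}) : rdot (\sum_(f <- F1) SP.1 f (adj (SP.1 f) x)) x =
    \sum_(f <- F1) rnorm (adj (SP.1 f) x) ^+ 2.
  rewrite (big_morph (fun z => rdot z x) (fun y z : H => rdotDl y z x) (id1 := 0)); last first.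
    by rewrite /rdot dot0l.
  by apply: eq_bigr => f _; rewrite -rdot_norm /rdot -adjP.
have h1 : \sum_(f <- F) rnorm (adj (SP.1 f) x) ^+ 2 <=
    \sum_(f <- (F0 `|` F)%fset) rnorm (adj (SP.1 f) x) ^+ 2.
  rewrite [leRHS](bigID (mem F)) /=.
  rewrite [X in _ <= X + _](_ : _ = \sum_(f <- F) rnorm (adj (SP.1 f) x) ^+ 2).
    by rewrite lerDl sumr_ge0 // => f _; exact: sqr_ge0.
  rewrite -big_filter; apply: perm_big; apply: uniq_perm.
  - by rewrite filter_uniq // fset_uniq.
  - exact: fset_uniq.
  - by move=> f; rewrite mem_filter in_fsetU; case: (f \in F); rewrite ?orbT.
apply: le_trans h1 _; rewrite -sE.
set y := \sum_(f <- _) _ in h *.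
have h2 : rdot (Q x) x <= rdot (P u x) x.
  have := QP x; rewrite lecE => /andP[_]; rewrite dotBl /rdot /proj_at.
  by move: (hdot H (SP.2 u x) x) (hdot H (Q x) x) => [? ?] [? ?] /=; rewrite subr_ge0.
have h3 : rdot y x <= rdot (Q x) x + e.
  have -> : y = Q x - (Q x - y) by rewrite subKr.
  rewrite rdotDl lerD2l rdotNl -rdotNl; apply: le_trans (rdot_CS _ _) _.
  rewrite rnormN.
  apply: (@le_trans _ _ (e / (rnorm x + 1) * rnorm x)).
    by rewrite ler_wpM2r ?rnorm_ge0 // ltW.
  rewrite mulrAC -mulrA -[leRHS]mulr1 ler_wpM2l ?(ltW e0) //.
  by rewrite ler_pdivrMr // mul1r lerDl.
lra.
Qed.

(** By [range_sum_le] the adjoint of [S e] kills the kernel of [P], in particular every [y - P y];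
    passing to adjoints, [P] fixes the range of [S e]. *)
Lemma P_S e x : dpos e -> P (eo e) (S e x) = S e x.
Proof.
move=> /isom_atP[e' ee ->]; rewrite -ee.
have pP := tf_proj tf (eo (val e')).
have h z : P (eo (val e')) z = 0 -> adj (SP.1 e') z = 0.
  move=> Pz; apply: rnorm0_eq0; rewrite -(ler_pXn2r (n := 2)) ?nnegrE ?rnorm_ge0 // expr0n /=.
  have := @range_sum_le (eo (val e')) [fset e']%fset z.
  rewrite big_seq_fset1 Pz /rdot dot0l; apply.
  by move=> f /fset1P ->.
apply/esym/subr0_eq; apply: dot_inj => y.
rewrite dot0r dotBr -P_adj -dotBl adjPr.
rewrite (h (y - P _ y)) ?dot0l //.
by rewrite bopB PP subrr.
Qed.

(** Different origins give orthogonal vertex projections. For a common origin, the term of [f] alone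
    exhausts the bound of [range_sum_le] at the vector [S f x], which leaves zero for the term of
    [e]. *)
Lemma SadjS_orth e f x : dpos e -> dpos f -> e <> f -> adj (S e) (S f x) = 0.
Proof.
move=> de df ef.
have [ee|ee] := eqVneq (eo e) (eo f); last first.
  apply: dot_inj => y; rewrite dot0r -adjP -(P_S _ de) -(P_S _ df) P_adj P_orth ?dot0r //.
  exact/eqP.
have [e' e'e Se] := isom_atP de; have [f' f'f Sf] := isom_atP df.
have ef' : e' != f' by apply/eqP => ef'; apply: ef; rewrite -e'e -f'f ef'.
have sub : [set` [fset e'; f']%fset] `<=` [set g | eo (val g) = eo f].
  by move=> g /fset2P[->|->] /=; rewrite ?e'e ?f'f.
have := range_sum_le (S f x) sub.
rewrite big_fsetU1 ?inE //= big_seq_fset1 P_S // rdot_norm -Sf -Se.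
have : rnorm (adj (S f) (S f x)) ^+ 2 = rnorm (S f x) ^+ 2.
  by rewrite SadjS // -!rdot_norm /rdot [in RHS]adjP SadjS // P_adj PP.
move=> ->; rewrite gerDr => h; apply: rnorm0_eq0.
by rewrite -(ler_pXn2r (n := 2)) ?nnegrE ?rnorm_ge0 // expr0n.
Qed.

(** Words end in a vertex projection, so that an empty path gives [P v] and not the identity. *)
Fixpoint word_op v (s : seq (edge E)) : bop H :=
  if s is e :: s' then bcomp (S e) (word_op (et e) s') else P v.

Definition path_op p : bop H := word_op (po p) (pe p).
Local Notation W := path_op.

Lemma path_op0 v : W (path0 v) = P v. Proof. by []. Qed.

Lemma path_op_cons e p x : et e = po p -> dpos e -> directed p ->
  W (pmul (path1 e) p) x = S e (W p x).
Proof.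
move=> ep de dp; rewrite /path_op po_pmul // pe_pmul_dir ?directed1 //=.
by rewrite bcompE ep.
Qed.

Lemma directed_ind (Q : gpath E -> Prop) : (forall v, Q (path0 v)) ->
  (forall e p, dpos e -> directed p -> et e = po p -> Q p -> Q (pmul (path1 e) p)) ->
  forall p, directed p -> Q p.
Proof.
move=> Q0 QS p; have [n] := ubnP (size (pe p)); elim: n p => // n IH p.
case ps : (pe p) => [|e s] /=; first by rewrite (pe0_path0 ps) => _ _; exact: Q0.
have [_ [d [-> d1 d2]]] := gpath_uncons ps; rewrite ltnS => sn dp.
have := dp; rewrite {1}/directed pe_pmul_cat //=; last first.
  by have := pe_reduced p; rewrite ps d2.
move=> /andP[de dd]; apply: QS => //; apply: IH => //.
by rewrite d2.
Qed.

Lemma P_path_op p x : directed p -> P (po p) (W p x) = W p x.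
Proof.
move=> dp; elim/directed_ind: p / dp x => [v|e p de dp ep IH] x; first by rewrite path_op0 PP.
by rewrite path_op_cons // po_pmul // P_S.
Qed.

Lemma path_op_P p x : directed p -> W p (P (pt p) x) = W p x.
Proof.
move=> dp; elim/directed_ind: p / dp x => [v|e p de dp ep IH] x; first by rewrite path_op0 PP.
by rewrite !path_op_cons // pt_pmul // IH.
Qed.

Lemma path_opM p d x : directed p -> directed d -> pt p = po d ->
  W (pmul p d) x = W p (W d x).
Proof.
move=> dp dd; elim/directed_ind: p / dp x => [v|e p de dp ep IH] x pd.
  by rewrite [v]pd pmul0p path_op0 P_path_op.
rewrite pt_pmul // in pd; rewrite pmulA // !path_op_cons // ?IH // ?po_pmul //.
exact: directed_pmul.
Qed.

Lemma path_op_adj p x : directed p -> adj (W p) (W p x) = P (pt p) x.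
Proof.
move=> dp; elim/directed_ind: p / dp x => [v|e p de dp ep IH] x.
  rewrite path_op0; apply: dot_inj => y; rewrite -adjP P_adj PP //.
apply: dot_inj => y; rewrite -adjP !path_op_cons // adjP SadjS // ep P_path_op //.
by rewrite adjP IH pt_pmul.
Qed.

Lemma path_op_orth p q x : directed p -> directed q ->
  ~ (VL p [::] q \/ VL q [::] p) -> adj (W p) (W q x) = 0.
Proof.
move=> dp dq npq; apply: dot_inj => y; rewrite dot0r -adjP.
have [pq|pq] := eqVneq (po p) (po q); last first.
  rewrite -(P_path_op _ dp) -(P_path_op _ dq) P_adj P_orth ?dot0r //; exact/eqP.
elim/directed_ind: p / dp q dq npq pq y x => [v|e p de dp ep IH] q dq npq pq y x.
  by case: npq; left; apply: prefix_VL => //; exact: prefix0s.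
elim/directed_ind: q / dq npq pq => [v|f q df dq fq _] npq pq.
  case: npq; right; apply: prefix_VL => //; last exact: prefix0s.
  by apply: directed_pmul; rewrite ?directed1.
(* A common first edge cancels and the tails still diverge; different first edges have orthogonal
   ranges. *)
rewrite !path_op_cons // adjP; have [ef|/eqP ef] := eqVneq e f; last first.
  by rewrite SadjS_orth // dot0r.
rewrite -ef SadjS // ep -P_adj P_path_op //; apply: IH => //; last by rewrite -ep ef fq.
rewrite -ef in npq fq.
have ed (r r' : gpath E) : et e = po r -> VL r [::] r' -> VL (pmul (path1 e) r) [::] (pmul (path1 e) r').
  move=> er /VLP[d [-> rd dd _]]; apply/VLP; exists d.
  by rewrite pmulA // pt_pmul //; split=> //; case: pe.
by move=> [h|h]; apply: npq; [left|right]; exact: ed.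
Qed.

Definition mx_op q p : bop H := bcomp (W q) (adj (W p)).
Local Notation M := mx_op.

Lemma adjM q p x : adj (M q p) x = M p q x.
Proof. by rewrite adj_comp adjK bcompE. Qed.

Lemma mx_ext q p d r x : directed q -> directed p -> directed d ->
  pt q = pt p -> pt p = po d -> M q p (M (pmul p d) r x) = M (pmul q d) r x.
Proof.
move=> dq dp dd qp pd; rewrite !bcompE !path_opM // ?qp // path_op_adj //.
by rewrite pd P_path_op.
Qed.

Lemma mx_adj q p x y : hdot H (M q p x) y = hdot H x (M p q y).
Proof. by rewrite adjP adjM. Qed.

Lemma mx_restr q p d r x : directed q -> directed p -> directed d -> directed r ->
  pt p = po d -> pt p = pt r -> M q (pmul p d) (M p r x) = M q (pmul r d) x.
Proof.
move=> dq dp dd dr pd pr.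
(* The equation is the adjoint of [mx_ext]. *)
apply: dot_inj => y.
by rewrite [LHS]adjPr adjM [LHS]adjPr adjM mx_ext // [RHS]adjPr adjM.
Qed.

Lemma mx_orth q p p' r x : directed p -> directed p' ->
  ~ (VL p [::] p' \/ VL p' [::] p) -> M q p (M p' r x) = 0.
Proof. by move=> dp dp' npp; rewrite !bcompE path_op_orth // bop0. Qed.

Lemma mx_proj p : directed p -> projection (M p p).
Proof.
move=> dp; apply/projectionP; split=> [x|x y]; last exact: mx_adj.
by rewrite !bcompE path_op_adj // path_op_P.
Qed.

Lemma mx_le q p x : directed q -> directed p -> pt q = pt p -> rnorm (M q p x) <= rnorm x.
Proof.
move=> dq dp qp; rewrite -(ler_pXn2r (n := 2)) ?nnegrE ?rnorm_ge0 //.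
have pp := mx_proj dp.
suff -> : rnorm (M q p x) ^+ 2 = rnorm (M p p x) ^+ 2.
  by rewrite ler_pXn2r ?nnegrE ?rnorm_ge0 //; exact: proj_le.
rewrite -!rdot_norm /rdot !mx_adj; congr (complex.Re (hdot _ _ _)).
by rewrite !bcompE !path_op_adj // qp.
Qed.

Lemma mx_diag q p : directed p -> directed q -> pt q = pt p ->
  forall x, M q p (M p p x) = M q p x.
Proof.
by move=> dp dq qp x; rewrite !bcompE path_op_adj // -qp path_op_P.
Qed.

End PathOperators.

(** * The supremum-norm bound for sums of operators S_q S_p^* *)

Section CoefficientBound.
Variables (R : realType) (E : digraph) (H : hilbert R).
Variable SP : (pedge E -> bop H) * (vertex E -> bop H).
Hypothesis tf : toeplitz_family SP.
Local Notation G := (toeplitz_groupoid E).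
Implicit Types (p q r d a : gpath E) (e f : edge E) (x y : H) (g h : G).
Local Notation M := (mx_op SP).
Local Notation coef := (R[i] * (gpath E * gpath E))%type.
Implicit Types (l m : seq coef) (t : coef).

Lemma quot_transport q p q' p' d : pt q = pt p -> pt q' = pt p' ->
  quot q p = quot q' p' -> p' = pmul p d -> pt p = po d -> q' = pmul q d.
Proof.
move=> qp qp' qq pE pd.
by rewrite -(quotK qp') -qq pE -pmulA // ?quotK // pt_quot.
Qed.

Lemma quot_transportV q p q' p' d : pt q = pt p -> pt q' = pt p' ->
  quot q p = quot q' p' -> q' = pmul q d -> pt q = po d -> p' = pmul p d.
Proof.
move=> qp qp' qq qE qd; apply: (@quot_transport p q p' q') => //.
by rewrite -(quotV qp) -(quotV qp') qq.
Qed.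

(** Left multiplication by the common label carries paths beginning with [p'] to paths beginning
    with [q']; accordingly [M q p] turns the projection of [p'] into that of [q']. *)
Lemma mx_intertwine q p q' p' x : good (q, p) -> good (q', p') ->
  quot q p = quot q' p' -> M q p (M p' p' x) = M q' q' (M q p x).
Proof.
move=> [/= dq dp qp] [/= dq' dp' qp'] qq.
have [[d [pE pd dd]]|[d [pE pd dd]]|npp] := directed_compare dp dp'.
- have qE := quot_transport qp qp' qq pE pd.
  have qd : pt q = po d by rewrite qp.
  have dqd : directed (pmul q d) by exact: directed_pmul.
  by rewrite {1}pE (mx_ext tf) // qE (mx_restr tf) // -pE.
- have qE := quot_transport qp' qp (esym qq) pE pd.
  have qd : pt q' = po d by rewrite qp'.
  have dqd : directed (pmul q' d) by exact: directed_pmul.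
  by rewrite pE qE (mx_restr tf) // (mx_ext tf).
- rewrite (mx_orth tf) // (mx_orth tf) //.
  case=> /VLP[d [qE qd dd _]]; apply: npp; [right|left].
    have pE := quot_transportV qp' qp (esym qq) qE qd.
    by apply/VLP; exists d; rewrite -qp'; split=> //; case: pe.
  have pE := quot_transportV qp qp' qq qE qd.
  by apply/VLP; exists d; rewrite -qp; split=> //; case: pe.
Qed.

Definition lsum l x : H := \sum_(t <- l) t.1 *: M t.2.1 t.2.2 x.

Fixpoint rho l : bop H :=
  if l is t :: l' then badd (bscale t.1 (M t.2.1 t.2.2)) (rho l') else bzero H.

Lemma rhoE l x : rho l x = lsum l x.
Proof.
elim: l => [|t l IH]; first by rewrite /lsum big_nil bzeroE.
by rewrite /= baddE bscaleE IH /lsum big_cons.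
Qed.

(** The arrow over the vertex [p] of the cover. If all terms of [l] have its label, the value of
    [ev l] there is the sum of the coefficients whose path is a prefix of [p]. *)
Lemma vertex_point q p : good (q, p) -> exists g, lab g = quot q p /\
  forall r, directed r -> (prg g r <-> VL r [::] p).
Proof.
move=> [/= dq dp qp].
have [x [Xx xO]] : exists x : spectrum (ucover E), XE x /\ prs x = [set r | directed r /\ VL r [::] p].
  apply: XE_exists.
  - by exists p; split=> //; exact: VL_id.
  - by move=> r [].
  - by move=> r r' [dr rp] dr' r'r; split=> //; apply: VL_trans rp.
  - move=> r r' [dr rp] [dr' r'p]; have [_ h] := VL_prefix dr rp.
    have [_ h'] := VL_prefix dr' r'p; have rr : po r = po r' by rewrite rp.1 r'p.1.
    by have [k|k] := prefix_total h h'; [left|right]; apply: prefix_VL.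
have xp : prs x p by rewrite xO; split=> //; exact: VL_id.
have [g [lg gp] gx] := Zset_exists Xx xp dq qp.
exists g; split=> // r dr; rewrite /prg gx xO; split=> [[]//|rp]; by split.
Qed.

Lemma ev_label l g a : {in l, forall t, quot t.2.1 t.2.2 = a} -> lab g = a ->
  ev l g = \sum_(t <- l | `[< prg g t.2.2 >]) t.1.
Proof.
move=> la ga; rewrite /ev [RHS]big_mkcond /=; apply: eq_big_seq => t tl.
rewrite /chi indicE; case: asboolP => [gp|ngp]; last first.
  by rewrite memNset ?mulr0 // => -[].
by rewrite mem_set ?mulr1 //; split=> //; rewrite ga -(la t tl).
Qed.

(* The projections [M p p] commute and are intertwined by the terms of the sum, so
   [x] can be split orthogonally into joint eigenvectors. *)
Lemma lsum_bound1 l a (B : R) : lgood l -> {in l, forall t, quot t.2.1 t.2.2 = a} ->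
  0 <= B -> (forall g, lab g = a -> rabs (ev l g) <= B) -> obound (lsum l) B.
Proof.
move=> gl la B0 lB.
(* [m] lists the terms whose projection is not yet known to act on [x] as one or zero. *)
suff split_ind (m : seq coef) x : {subset m <= l} ->
    {in l, forall t, [\/ t \in m, M t.2.2 t.2.2 x = x | M t.2.2 t.2.2 x = 0]} ->
    rnorm (lsum l x) <= B * rnorm x.
  by move=> x; apply: (split_ind l) => // t tl; apply: Or31.
elim: m x => [|t m IH] x ml dec.
  (* Here [x] is a joint eigenvector of the projections [M p p], and [lsum l x] is
     the value of [ev l] at the vertex of the longest [p] with [M p p x = x], times
     [M q p x]. *)
  have {}dec t : t \in l -> M t.2.2 t.2.2 x = x \/ M t.2.2 t.2.2 x = 0.
    by move=> /dec[//|h|h]; [left|right].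
  have [->|x0] := eqVneq x 0.
    rewrite /lsum big1 ?rnorm0 ?mulr0 // => t _; by rewrite bop0 scaler0.
  have zero t : t \in l -> M t.2.2 t.2.2 x = 0 -> M t.2.1 t.2.2 x = 0.
    move=> tl t0; have [dq dp qp] := gl t tl.
    by rewrite -(mx_diag tf) // t0 bop0.
  pose P t := M t.2.2 t.2.2 x == x.
  have [/hasP[t0 t0l Pt0]|/hasPn noP] := boolP (has P l); last first.
    rewrite /lsum big_seq big1 ?rnorm0 ?mulr_ge0 ?rnorm_ge0 // => t tl.
    have [h|h] := dec t tl; first by have := noP t tl; rewrite /P h eqxx.
    by rewrite zero // scaler0.
  (* The longest [p] that fixes [x]; by [PE] the terms fixing [x] are those whose path is a prefix
     of it. *)
  have [tm [tml tmP tmmax]] : exists tm, [/\ tm \in l, P tm &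
      forall t, t \in l -> P t -> (size (pe t.2.2) <= size (pe tm.2.2))%N].
    pose Q n := has (fun t => P t && (size (pe t.2.2) == n)) l.
    have exQ : exists n, Q n.
      by exists (size (pe t0.2.2)); apply/hasP; exists t0 => //; rewrite Pt0 eqxx.
    have ubQ n : Q n -> (n <= \max_(t <- l) size (pe t.2.2))%N.
      by move=> /hasP[t tl /andP[_ /eqP <-]]; apply: leq_bigmax_seq.
    case: (ex_maxnP exQ ubQ) => n /hasP[tm tml /andP[tmP /eqP <-]] nmax.
    exists tm; split=> // t tl Pt; apply: nmax; apply/hasP; exists t => //.
    by rewrite Pt eqxx.
  have [dqm dpm qpm] := gl tm tml; have /eqP xm := tmP.
  have PE t : t \in l -> P t = `[< VL t.2.2 [::] tm.2.2 >].
    move=> tl; have [dq dp qp] := gl t tl; apply/eqP/asboolP => [xt|tm'].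
      have [[d [pE pd dd]]|[d [pE pd dd]]|npp] := directed_compare dp dpm.
      - by rewrite pE; apply: VL_pmul.
      - have := tmmax t tl; rewrite /P xt eqxx => /(_ isT).
        rewrite pE pe_pmul_dir // size_cat -{2}[size (pe tm.2.2)]addn0 leq_add2l leqn0.
        move=> /eqP/size0nil d0; rewrite (pe0_path0 d0) -pd pmulp0; exact: VL_id.
      - case/eqP: x0; rewrite -xt -xm (mx_orth tf) //.
    have /VLP[d [pE pd dd _]] := tm'.
    by rewrite -xm pE (mx_ext tf).
  have Mm t : t \in l -> P t -> M t.2.1 t.2.2 x = M tm.2.1 tm.2.2 x.
    move=> tl Pt; have [dq dp qp] := gl t tl.
    move: Pt; rewrite PE // => /asboolP/VLP[d [pE pd dd _]].
    have qE : tm.2.1 = pmul t.2.1 d.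
      by apply: (quot_transport qp qpm _ pE pd); rewrite la // la.
    by rewrite -{1}xm pE (mx_ext tf) // -pE -qE.
  have -> : lsum l x = (\sum_(t <- l | P t) t.1) *: M tm.2.1 tm.2.2 x.
    rewrite scaler_suml /lsum [RHS]big_mkcond /=; apply: eq_big_seq => t tl.
    case: ifP => Pt; first by rewrite Mm.
    have [h|h] := dec t tl; last by rewrite zero // scaler0.
    by move: Pt; rewrite /P h eqxx.
  rewrite rnormZ; have [g [lg gp]] := vertex_point (gl tm tml).
  rewrite ler_pM ?rabs_ge0 ?rnorm_ge0 //; last exact: (mx_le tf).
  have lga : lab g = a by rewrite lg la.
  have := lB g lga; rewrite (ev_label la lga); congr (rabs _ <= _).
  rewrite big_seq_cond [RHS]big_seq_cond; apply: eq_bigl => t.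
  case tl : (t \in l) => //=; rewrite PE //; have [_ dp _] := gl t tl.
  by apply: asbool_equiv_eq; exact: gp.
have tl : t \in l by apply: ml; exact: mem_head.
have [dq dp qp] := gl t tl.
have pp := mx_proj tf dp; have pq := mx_proj tf dq.
have [pi ps] := (projectionP _).1 pp; have [qi qs] := (projectionP _).1 pq.
(* Splitting along one projection decides it on both parts, and commutation preserves what was
   decided before. *)
pose x1 := M t.2.2 t.2.2 x; pose x2 := x - x1.
have comm t' y : t' \in l -> M t'.2.2 t'.2.2 (M t.2.2 t.2.2 y) = M t.2.2 t.2.2 (M t'.2.2 t'.2.2 y).
  move=> tl'; have [dq' dp' qp'] := gl t' tl'.
  apply: mx_intertwine; [by split|by split|].
  rewrite /quot !pmulVr; have := la t tl; rewrite -(la t' tl') => qq.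
  by have := congr1 (@pt E) qq; rewrite !pt_quot // => ->.
have lin y : lsum l (M t.2.2 t.2.2 y) = M t.2.1 t.2.1 (lsum l y).
  rewrite /lsum linear_sum /=; apply: eq_big_seq => t' tl'; rewrite bopZ; congr (_ *: _).
  by apply: mx_intertwine; [exact: gl|exact: gl|rewrite la // la].
have lD y z : lsum l (y - z) = lsum l y - lsum l z.
  by rewrite -!rhoE bopB.
have b1 : rnorm (lsum l x1) <= B * rnorm x1.
  apply: IH => [u um|t' tl']; first by apply: ml; rewrite inE um orbT.
  have := dec t' tl'; rewrite inE => -[/predU1P[->|tm]|h|h].
  - by apply: Or32; rewrite /x1 pi.
  - exact: Or31.
  - by apply: Or32; rewrite /x1 comm // h.
  - by apply: Or33; rewrite /x1 comm // h bop0.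
have b2 : rnorm (lsum l x2) <= B * rnorm x2.
  apply: IH => [u um|t' tl']; first by apply: ml; rewrite inE um orbT.
  have := dec t' tl'; rewrite inE => -[/predU1P[->|tm]|h|h].
  - by apply: Or33; rewrite /x2 bopB /x1 pi subrr.
  - exact: Or31.
  - by apply: Or32; rewrite /x2 bopB /x1 comm // h.
  - by apply: Or33; rewrite /x2 bopB /x1 comm // h bop0 subrr.
rewrite -(ler_pXn2r (n := 2)) ?nnegrE ?rnorm_ge0 ?mulr_ge0 ?rnorm_ge0 //.
(* By [lin] the images of the two parts are the components of [lsum l x] along [M q q]; Pythagoras
   on both sides adds the bounds without loss. *)
rewrite exprMn (proj_pyth x pp) (proj_pyth (lsum l x) pq) -lin -/x1.
have -> : lsum l x - lsum l x1 = lsum l x2 by rewrite /x2 lD.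
rewrite mulrDr -!exprMn lerD //.
  by rewrite ler_pXn2r ?nnegrE ?mulr_ge0 ?rnorm_ge0.
by rewrite ler_pXn2r ?nnegrE ?mulr_ge0 ?rnorm_ge0.
Qed.

Lemma lsum_bound l (A : seq (gpath E)) (B : R) : lgood l -> suppin A (ev l) -> 0 <= B ->
  (forall g, rabs (ev l g) <= B) -> obound (lsum l) ((size A)%:R * B).
Proof.
move=> gl lA B0 lB x.
pose key t := quot t.2.1 t.2.2; pose K := undup (map key l).
have -> : lsum l x = \sum_(a <- K) lsum [seq t <- l | key t == a] x.
  rewrite /lsum; under [RHS]eq_bigr do rewrite big_filter.
  rewrite (exchange_big_dep xpredT) //=; apply: eq_big_seq => t tl.
  rewrite big_mkcond (bigD1_seq (key t)) ?undup_uniq ?mem_undup ?map_f //= eqxx.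
  by rewrite big1 ?addr0 // => a; rewrite eq_sym => /negbTE ->.
(* A label outside [A] carries the zero function, so the bound for one label holds with constant
   zero. *)
have kB a : rnorm (lsum [seq t <- l | key t == a] x) <= (if a \in A then B else 0) * rnorm x.
  apply: (@lsum_bound1 _ a).
  - by move=> t; rewrite mem_filter => /andP[_ /gl].
  - by move=> t; rewrite mem_filter => /andP[/eqP].
  - by case: ifP.
  move=> g ga; have -> : ev [seq t <- l | key t == a] g = ev l g.
    rewrite /ev big_filter [RHS](bigID (fun t => key t == a)) /= [X in _ = _ + X]big1 ?addr0 //.
    move=> t ta; rewrite /chi indicE memNset ?mulr0 // => -[tg _].
    by case/eqP: ta; rewrite -ga tg.
  case: ifP => [_|aA]; first exact: lB.
  have [->|/lA] := eqVneq (ev l g) 0; first by rewrite rabs0.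
  by rewrite ga aA.
have -> : (size A)%:R * B * rnorm x = \sum_(a <- A) B * rnorm x.
  by rewrite big_const_seq count_predT iter_addr_0 -mulrA mulr_natl.
apply: le_trans (_ : \sum_(a <- K) (if a \in A then B else 0) * rnorm x <= _).
  elim: K => [|a K IH]; first by rewrite !big_nil rnorm0.
  by rewrite !big_cons (le_trans (rnormD _ _)) // lerD.
under eq_bigr => a _ do rewrite (fun_if (fun b => b * rnorm x)) mul0r.
rewrite -big_mkcond -big_filter /=.
have : {subset [seq a <- K | a \in A] <= A} by move=> a; rewrite mem_filter => /andP[].
have : uniq [seq a <- K | a \in A] by rewrite filter_uniq // undup_uniq.
move: [seq a <- K | a \in A] => K' uK sK.
rewrite !big_const_seq !count_predT !iter_addr_0.
by rewrite ler_wpMn2l ?mulr_ge0 ?rnorm_ge0 // uniq_leq_size.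
Qed.

End CoefficientBound.

(** * Bilinearity and estimates of the convolution *)

Section ConvolutionBilinear.
Variables (R : realType) (E : digraph).
Local Notation G := (toeplitz_groupoid E).
Implicit Types (f : G -> R[i]) (c g h : G) (A : seq (gpath E)).
Local Notation coef := (R[i] * (gpath E * gpath E))%type.
Implicit Types (l m : seq coef) (t : coef).

Lemma suppin_undup A f : suppin A f -> suppin (undup A) f.
Proof. by move=> fA g /fA; rewrite mem_undup. Qed.

Lemma suppin_sub A B f : {subset A <= B} -> suppin A f -> suppin B f.
Proof. by move=> AB fA g /fA/AB. Qed.

Lemma suppin_comb A f1 f2 (k : R[i]) : suppin A f1 -> suppin A f2 ->
  suppin A (fun g => f1 g + k * f2 g).
Proof.
move=> h1 h2 g; have [e1|/h1//] := eqVneq (f1 g) 0.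
by have [e2|/h2//] := eqVneq (f2 g) 0; rewrite e1 e2 mulr0 addr0 eqxx.
Qed.

Lemma conv_atDl f1 f2 f (k : R[i]) c b :
  conv_at (fun g => f1 g + k * f2 g) f c b = conv_at f1 f c b + k * conv_at f2 f c b.
Proof. by rewrite /conv_at; case: pselect => [H|_]; rewrite ?mulr0 ?addr0 // mulrDl mulrA. Qed.

Lemma conv_atDr f1 f2 f (k : R[i]) c b :
  conv_at f (fun g => f1 g + k * f2 g) c b = conv_at f f1 c b + k * conv_at f f2 c b.
Proof. by rewrite /conv_at; case: pselect => [H|_]; rewrite ?mulr0 ?addr0 // mulrDr mulrCA. Qed.

Lemma gconvDl A f1 f2 f (k : R[i]) c : suppin A f ->
  gconv (fun g => f1 g + k * f2 g) f c = gconv f1 f c + k * gconv f2 f c.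
Proof.
move=> /suppin_undup fA; rewrite !(gconvE _ _ (undup_uniq A) fA) mulr_sumr -big_split /=.
by apply: eq_bigr => b _; exact: conv_atDl.
Qed.

Lemma gconvDr A f1 f2 f (k : R[i]) c : suppin A f1 -> suppin A f2 ->
  gconv f (fun g => f1 g + k * f2 g) c = gconv f f1 c + k * gconv f f2 c.
Proof.
move=> /suppin_undup h1 /suppin_undup h2; have h := suppin_comb (k := k) h1 h2.
rewrite !(gconvE _ _ (undup_uniq A)) // mulr_sumr -big_split /=.
by apply: eq_bigr => b _; exact: conv_atDr.
Qed.

Lemma gconv_bound A f1 f2 (b1 b2 : R) c : suppin A f2 -> (forall g, rabs (f1 g) <= b1) ->
  (forall g, rabs (f2 g) <= b2) -> rabs (gconv f1 f2 c) <= (size A)%:R * (b1 * b2).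
Proof.
move=> /suppin_undup fA h1 h2; rewrite (gconvE _ _ (undup_uniq A) fA).
have b12 : 0 <= b1 * b2.
  by rewrite mulr_ge0 // (le_trans (rabs_ge0 _) (h1 c), le_trans (rabs_ge0 _) (h2 c)).
apply: (@le_trans _ _ (\sum_(b <- undup A) b1 * b2)).
  elim: (undup A) => [|b s IH]; first by rewrite !big_nil rabs0.
  rewrite !big_cons (le_trans (rabsD _ _)) // lerD //.
  rewrite /conv_at; case: pselect => [H|_]; last by rewrite rabs0.
  by rewrite rabsM ler_pM ?rabs_ge0.
rewrite big_const_seq count_predT iter_addr_0 mulr_natl.
by rewrite ler_wpMn2l // size_undup.
Qed.

Lemma gconv_suppin A B f1 f2 : suppin A f1 -> suppin B f2 ->
  suppin [seq pmul a b | a <- A, b <- B] (gconv f1 f2).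
Proof.
move=> h1 h2 c cn0; have [b bB cb] : exists2 b, b \in undup B & conv_at f1 f2 c b != 0.
  apply: contrapT => nb; case/eqP: cn0; rewrite (gconvE _ _ (undup_uniq B) (suppin_undup h2)).
  rewrite big_seq big1 // => b bB; apply/eqP; apply: contrapT => /negP cb.
  by apply: nb; exists b.
move: cb; rewrite /conv_at; case: pselect => [H|_]; last by rewrite eqxx.
case: cid => h /= [hb ch]; rewrite mulf_eq0 negb_or => /andP[/h1 l1 /h2 l2].
apply/allpairsP; exists (lab (gmul c (ginv h)), lab h); split=> //=.
have [e1 e2 e3 e4] := gdivE ch.
by have [<- _] := gmulE e1; rewrite e2.
Qed.

Lemma ev_suppin l : suppin (map (fun t => quot t.2.1 t.2.2) l) (ev l).
Proof.
move=> g; apply: contraR => gl; apply/eqP; rewrite /ev big_seq big1 // => t tl.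
rewrite /chi indicE memNset ?mulr0 // => -[tg _]; case/mapP: gl.
by exists t.
Qed.

Lemma ev_bounded l : exists2 b : R, 0 <= b & forall g, rabs (ev l g) <= b.
Proof.
elim: l => [|t l [b b0 IH]]; first by exists 0 => // g; rewrite /ev big_nil rabs0.
exists (rabs t.1 + b) => [|g]; first by rewrite addr_ge0 ?rabs_ge0.
rewrite ev_cons (le_trans (rabsD _ _)) // lerD // rabsM -[leRHS]mulr1 ler_wpM2l ?rabs_ge0 //.
by rewrite /chi indicE; case: (_ \in _); rewrite ?rabs1 ?rabs0.
Qed.

Definition lres A l := [seq t <- l | quot t.2.1 t.2.2 \in A].

Lemma ev_lres A l g : ev (lres A l) g = if lab g \in A then ev l g else 0.
Proof.
rewrite /lres; elim: l => [|t l IH] /=; first by rewrite /ev !big_nil if_same.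
have ct : lab g != quot t.2.1 t.2.2 -> chi R t.2.1 t.2.2 g = 0.
  by move=> h; rewrite /chi indicE memNset // => -[tg _]; case/eqP: h.
case: ifP => tA; rewrite !ev_cons IH; case: ifP => gA //.
  by rewrite ct ?mulr0 ?addr0 //; apply: contraFneq gA => ->.
by rewrite ct ?mulr0 ?add0r //; apply: contraTneq gA => ->; rewrite tA.
Qed.

Lemma lres_good A l : lgood l -> lgood (lres A l).
Proof. by move=> gl t; rewrite mem_filter => /andP[_ /gl]. Qed.

Definition lscale (k : R[i]) l : seq coef := [seq (k * t.1, t.2) | t <- l].
Lemma ev_lscale k l g : ev (lscale k l) g = k * ev l g.
Proof. by rewrite /ev big_map /= mulr_sumr; apply: eq_bigr => t _; rewrite mulrA. Qed.
Lemma lscale_good k l : lgood l -> lgood (lscale k l).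
Proof. by move=> gl _ /mapP[t /gl gt ->]. Qed.

Definition lstar l : seq coef := [seq (Num.conj t.1, (t.2.2, t.2.1)) | t <- l].
Lemma ev_lstar l g : lgood l -> ev (lstar l) g = ginvol (ev l) g.
Proof.
move=> gl; rewrite /ev big_map /= /ginvol raddf_sum; apply: eq_big_seq => t tl.
have [dq dp qp] := gl t tl.
by rewrite -ginvol_chi //; exact: (esym (rmorphM Num.conj _ _)).
Qed.
Lemma lstar_good l : lgood l -> lgood (lstar l).
Proof. by move=> gl _ /mapP[t /gl [? ? ?] ->]. Qed.

End ConvolutionBilinear.

Section CoefficientSums.
Variables (R : realType) (E : digraph) (H : hilbert R).
Variable SP : (pedge E -> bop H) * (vertex E -> bop H).
Local Notation G := (toeplitz_groupoid E).
Implicit Types (p q r d a : gpath E) (x y : H) (g h : G) (f : G -> R[i]).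
Local Notation coef := (R[i] * (gpath E * gpath E))%type.
Implicit Types (l m : seq coef) (t : coef) (A B : seq (gpath E)).
Local Notation M := (mx_op SP).
Local Notation lsum := (lsum SP).

Lemma lsum_cat l m x : lsum (l ++ m) x = lsum l x + lsum m x.
Proof. by rewrite /lsum big_cat. Qed.
Lemma lsum_lscale k l x : lsum (lscale k l) x = k *: lsum l x.
Proof. by rewrite /lsum big_map /= scaler_sumr; apply: eq_bigr => t _; rewrite scalerA. Qed.
Lemma lsum_lstar l x y : hdot H (lsum l x) y = hdot H x (lsum (lstar l) y).
Proof.
rewrite /lsum big_map; elim: l => [|t l IH]; first by rewrite !big_nil dot0l dot0r.
by rewrite !big_cons dotDl dotDr IH dotZl dotZr /= conjCK mx_adj.
Qed.

End CoefficientSums.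

(** * Products of linear combinations *)

Section Product.
Variables (R : realType) (E : digraph).
Local Notation G := (toeplitz_groupoid E).
Implicit Types (p q r d a : gpath E) (g h : G) (f : G -> R[i]).
Local Notation coef := (R[i] * (gpath E * gpath E))%type.
Implicit Types (l m : seq coef) (t : coef) (A B : seq (gpath E)).
Local Notation family H := ((pedge E -> bop H) * (vertex E -> bop H))%type.

(** [n] is chosen before the Hilbert space and the family: the same comparison of prefixes governs
    convolution and composition. *)
Lemma lmul_exists l m : lgood l -> lgood m -> exists n, [/\ lgood n,
  forall c, ev n c = gconv (ev l) (ev m) c &
  forall (H : hilbert R) (SP : family H), toeplitz_family SP ->
    forall x : H, lsum SP n x = lsum SP l (lsum SP m x)].
Proof.
move=> gl gm; elim: l gl => [_|t l IH /lgood_cons[gt /IH[n [gn nE nS]]]].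
  exists [::]; split=> // [c|H SP tf x]; last by rewrite /lsum !big_nil.
  rewrite (gconvE _ _ (undup_uniq _) (suppin_undup (ev_suppin (l := m)))).
  rewrite big1 => [|b _]; first by rewrite /ev big_nil.
  by rewrite /conv_at; case: pselect => // ?; rewrite /ev big_nil mul0r.
suff [n' [gn' nE' nS']] : exists n', [/\ lgood n',
    forall c, ev n' c = gconv (chi R t.2.1 t.2.2) (ev m) c &
    forall (H : hilbert R) (SP : family H), toeplitz_family SP ->
      forall x : H, lsum SP n' x = mx_op SP t.2.1 t.2.2 (lsum SP m x)].
  exists (n ++ lscale t.1 n'); split.
  - by apply: lgood_cat => //; exact: lscale_good.
  - move=> c; rewrite ev_cat ev_lscale nE nE' -(gconvDl _ _ _ _ (ev_suppin (l := m))).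
    by congr (gconv _ _ c); apply/funext => g; rewrite ev_cons addrC.
  - by move=> H SP tf x; rewrite lsum_cat lsum_lscale nS // nS' // /lsum big_cons addrC.
have [dq dp qp] := gt; move: t.2.1 t.2.2 dq dp qp => q p dq dp qp {t gt l IH n gn nE nS}.
elim: m gm => [_|t m IH /lgood_cons[[dq' dp' qp'] gm]].
  exists [::]; split=> // [c|H SP tf x]; last by rewrite /lsum !big_nil bop0.
  rewrite (@gconvE _ _ _ _ _ [::]) //; first by rewrite /ev !big_nil.
  by move=> g; rewrite /ev big_nil eqxx.
have [n [gn nE nS]] := IH gm.
suff [n' [gn' nE' nS']] : exists n', [/\ lgood n',
    forall c, ev n' c = gconv (chi R q p) (chi R t.2.1 t.2.2) c &
    forall (H : hilbert R) (SP : family H), toeplitz_family SP ->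
      forall x : H, lsum SP n' x = mx_op SP q p (mx_op SP t.2.1 t.2.2 x)].
  exists (n ++ lscale t.1 n'); split.
  - by apply: lgood_cat => //; exact: lscale_good.
  - move=> c; rewrite ev_cat ev_lscale nE nE'.
    pose A := map (fun t => quot t.2.1 t.2.2) (t :: m).
    have Am : suppin A (ev m).
      by apply: (suppin_sub _ (ev_suppin (l := m))) => a am; rewrite inE am orbT.
    have At : suppin A (chi R t.2.1 t.2.2).
      move=> g; rewrite /chi indicE; case: (boolP (g \in _)) => [/set_mem[-> _] _|]; last by rewrite eqxx.
      exact: mem_head.
    rewrite -(gconvDr _ _ _ Am At).
    by congr (gconv _ _ c); apply/funext => g; rewrite ev_cons addrC.
  - by move=> H SP tf x; rewrite lsum_cat lsum_lscale nS // nS' // /lsum big_cons bopD bopZ addrC.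
move: t.2.1 t.2.2 dq' dp' qp' => q' p' dq' dp' qp' {t m IH gm n gn nE nS}.
have one q0 p0 : good (q0, p0) -> gconv (chi R q p) (chi R q' p') = chi R q0 p0 ->
    (forall (H : hilbert R) (SP : family H), toeplitz_family SP ->
      forall x : H, mx_op SP q p (mx_op SP q' p' x) = mx_op SP q0 p0 x) -> exists n', [/\ lgood n',
    forall c, ev n' c = gconv (chi R q p) (chi R q' p') c &
    forall (H : hilbert R) (SP : family H), toeplitz_family SP ->
      forall x : H, lsum SP n' x = mx_op SP q p (mx_op SP q' p' x)].
  move=> g0 cE mE; exists [:: (1, (q0, p0))]; split.
  - by move=> t; rewrite inE => /eqP ->.
  - by move=> c; rewrite /ev big_seq1 mul1r cE.
  - by move=> H SP tf x; rewrite /lsum big_seq1 scale1r mE.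
have [[d [pE pd dd]]|[d [pE pd dd]]|npp] := directed_compare dp dq'.
- have dp'' : pt d = pt p' by rewrite -qp' pE pt_pmul.
  have qd : pt q = po d by rewrite qp.
  apply: (one (pmul q d) p').
  + by split=> //=; [exact: directed_pmul|rewrite pt_pmul].
  + by rewrite pE chi_mul_ext.
  + by move=> H SP tf x; rewrite pE (mx_ext tf).
- have qd : pt q = pt d by rewrite qp pE pt_pmul.
  have pd' : pt p' = po d by rewrite -qp'.
  apply: (one q (pmul p' d)).
  + by split=> //=; [exact: directed_pmul|rewrite pt_pmul].
  + by rewrite pE chi_mul_restr.
  + by move=> H SP tf x; rewrite pE (mx_restr tf).
- exists [::]; split=> //.
  + by move=> c; rewrite chi_mul_orth // /ev big_nil.
  + by move=> H SP tf x; rewrite (mx_orth tf) // /lsum big_nil.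
Qed.

(** The difference is [(f1 - l1) f2 + l1 (f2 - l2)], and [d <= 1] bounds [ev l1] by [b1 + 1]. *)
Lemma gconv_approx f1 f2 A l1 l2 (b1 b2 d : R) c : 0 <= d -> d <= 1 ->
  suppin A f2 -> suppin A (ev l2) ->
  (forall g, rabs (f1 g) <= b1) -> (forall g, rabs (f2 g) <= b2) ->
  (forall g, rabs (f1 g - ev l1 g) <= d) -> (forall g, rabs (f2 g - ev l2 g) <= d) ->
  rabs (gconv f1 f2 c - gconv (ev l1) (ev l2) c) <= (size A)%:R * (b2 + (b1 + 1)) * d.
Proof.
move=> d0 d1 fA2 Al2 fb1 fb2 fl1 fl2.
have lb1 g : rabs (ev l1 g) <= b1 + 1.
  have -> : ev l1 g = f1 g - (f1 g - ev l1 g) by rewrite subKr.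
  by rewrite (le_trans (rabsD _ _)) // rabsN lerD // (le_trans (fl1 g)).
have -> : gconv f1 f2 c - gconv (ev l1) (ev l2) c =
    gconv (fun g => f1 g + (-1) * ev l1 g) f2 c + gconv (ev l1) (fun g => f2 g + (-1) * ev l2 g) c.
  by rewrite (gconvDl _ _ _ _ fA2) (gconvDr _ _ _ fA2 Al2) !mulN1r addrA subrK.
apply: le_trans (rabsD _ _) _.
have -> : (size A)%:R * (b2 + (b1 + 1)) * d =
  (size A)%:R * (d * b2) + (size A)%:R * ((b1 + 1) * d) by ring.
rewrite lerD //.
  by apply: gconv_bound => // g; rewrite mulN1r; exact: fl1.
apply: gconv_bound => //; first exact: suppin_comb.
by move=> g; rewrite mulN1r; exact: fl2.
Qed.

End Product.

(** * Extension of a family to Cc *)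

Section CcExtension.
Variables (R : realType) (E : digraph) (H : hilbert R).
Variable SP : (pedge E -> bop H) * (vertex E -> bop H).
Hypothesis tf : toeplitz_family SP.
Local Notation G := (toeplitz_groupoid E).
Implicit Types (p q r d a : gpath E) (x y : H) (g h : G) (f : G -> R[i]).
Local Notation coef := (R[i] * (gpath E * gpath E))%type.
Implicit Types (l m : seq coef) (t : coef) (A B : seq (gpath E)) (T : bop H).
Local Notation M := (mx_op SP).
Local Notation lsum := (lsum SP).
Local Notation rho := (rho SP).

(** The value at [f] is first a relation, so that its compatibility with the operations can be shown
    on any approximation. [A] and [K] do not depend on [e]; this makes [T] unique and lets errors
    combine. *)
Definition apx f T := exists A K, suppin A f /\ forall e : R, 0 < e -> exists l,
  [/\ lgood l, suppin A (ev l), forall g, rabs (f g - ev l g) <= e &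
      obound (fun x => T x - lsum l x) (K * e)].

Lemma lsum_dist A l m (e : R) : lgood l -> lgood m -> suppin A (ev l) -> suppin A (ev m) ->
  0 <= e -> (forall g, rabs (ev l g - ev m g) <= e) ->
  obound (fun x => lsum l x - lsum m x) ((size A)%:R * e).
Proof.
move=> gl gm Al Am e0 lm x; rewrite -scaleN1r -lsum_lscale -lsum_cat.
have evE g : ev (l ++ lscale (-1) m) g = ev l g - ev m g by rewrite ev_cat ev_lscale mulN1r.
apply: (lsum_bound tf) => //.
- exact: lgood_cat gl (lscale_good gm).
- move=> g; rewrite evE; have := suppin_comb (k := -1) Al Am (g := g).
  by rewrite mulN1r.
- by move=> g; rewrite evE.
Qed.

Lemma apx_unique f T T' : apx f T -> apx f T' -> T = T'.
Proof.
move=> [A [K [fA fT]]] [A' [K' [fA' fT']]]; apply: bop_ext => x; apply/subr0_eq.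
pose B := A ++ A'.
(* [K] and [K'] account for the two approximations; the lists differ by at most [2 e] in the
   supremum norm, which costs the number of labels. *)
apply: (obound_eq0 (f := fun x => T x - T' x) (K := K + (size B)%:R * 2 + K')) => e e0 {}x.
have [l [gl Al fl Tl]] := fT e e0; have [m [gm Am fm Tm]] := fT' e e0.
have lB : suppin B (ev l) by apply: suppin_sub Al => a aA; rewrite mem_cat aA.
have mB : suppin B (ev m) by apply: suppin_sub Am => a aA; rewrite mem_cat aA orbT.
have e2 : 0 <= e * 2 by rewrite mulr_ge0 // ltW.
have lm g : rabs (ev l g - ev m g) <= e * 2.
  have -> : ev l g - ev m g = (f g - ev m g) - (f g - ev l g) by rewrite opprB [RHS]addrC subrKA.
  by rewrite (le_trans (rabsD _ _)) // rabsN mulr_natr mulr2n lerD.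
have h := lsum_dist gl gm lB mB e2 lm x.
have -> : T x - T' x = (T x - lsum l x) + ((lsum l x - lsum m x) - (T' x - lsum m x)).
  by rewrite opprB subrKA addrA subrK.
apply: le_trans (rnormD _ _) _; have := rnormD (lsum l x - lsum m x) (- (T' x - lsum m x)).
rewrite rnormN; have := Tl x; have := Tm x; move: h.
rewrite !mulrDl !mulrA; lra.
Qed.

Lemma apx_exists f : Cc f -> exists T, apx f T.
Proof.
move=> Cf; have [A [fA fl]] := step_approx Cf.
pose app l (e : R) := [/\ 0 <= e, lgood l, suppin A (ev l) & forall g, rabs (f g - ev l g) <= e].
have [||i j e d [e0 gi Ai fi] [d0 gj Aj fj] x|T TP] := @limit_operator _ H _ app rho (size A)%:R.
- exact: ler0n.
- by move=> e e0; have [l [gl Al lP]] := fl e e0; exists l; split=> //; exact: ltW.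
- rewrite !rhoE; apply: lsum_dist => //; first exact: addr_ge0.
  move=> g; have -> : ev i g - ev j g = (f g - ev j g) - (f g - ev i g) by rewrite opprB [RHS]addrC subrKA.
  by rewrite (le_trans (rabsD _ _)) // rabsN addrC lerD.
exists T, A, (size A)%:R; split=> // e e0; have [l [gl Al lP]] := fl e e0.
exists l; split=> // x; rewrite -rhoE; apply: TP; split=> //; exact: ltW.
Qed.

Lemma apx_comb f1 f2 (k : R[i]) T1 T2 : apx f1 T1 -> apx f2 T2 ->
  apx (fun g => f1 g + k * f2 g) (badd T1 (bscale k T2)).
Proof.
move=> [A1 [K1 [fA1 fT1]]] [A2 [K2 [fA2 fT2]]].
have sA1 : {subset A1 <= A1 ++ A2} by move=> a aA; rewrite mem_cat aA.
have sA2 : {subset A2 <= A1 ++ A2} by move=> a aA; rewrite mem_cat aA orbT.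
exists (A1 ++ A2), (`|K1| + rabs k * `|K2|); split.
  by apply: suppin_comb; [exact: suppin_sub fA1|exact: suppin_sub fA2].
move=> e e0; have c0 : 0 < 1 + rabs k by rewrite ltr_pwDl ?rabs_ge0.
have e1 : 0 < e / (1 + rabs k) by rewrite divr_gt0.
have ee : e / (1 + rabs k) * (1 + rabs k) = e by rewrite divfK // gt_eqF.
have le1 : e / (1 + rabs k) <= e by rewrite ler_pdivrMr // ler_peMr ?(ltW e0) // lerDl rabs_ge0.
move: (e / _) e1 ee le1 => d d0 de led.
have [l1 [g1 Al1 fl1 Tl1]] := fT1 d d0; have [l2 [g2 Al2 fl2 Tl2]] := fT2 d d0.
have evE g : ev (l1 ++ lscale k l2) g = ev l1 g + k * ev l2 g by rewrite ev_cat ev_lscale.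
exists (l1 ++ lscale k l2); split.
- exact: lgood_cat g1 (lscale_good g2).
- move=> g; rewrite evE; apply: suppin_comb; [exact: suppin_sub Al1|exact: suppin_sub Al2].
- move=> g; rewrite evE.
  have -> : f1 g + k * f2 g - (ev l1 g + k * ev l2 g) = (f1 g - ev l1 g) + k * (f2 g - ev l2 g) by ring.
  rewrite (le_trans (rabsD _ _)) // rabsM -de mulrDr mulr1 lerD // mulrC.
  by rewrite ler_wpM2r ?rabs_ge0.
- move=> x; rewrite baddE bscaleE lsum_cat lsum_lscale.
  rewrite opprD addrACA -scalerBr (le_trans (rnormD _ _)) // rnormZ.
  rewrite !mulrDl lerD //.
    apply: le_trans (Tl1 x) _; rewrite ler_wpM2r ?rnorm_ge0 //.
    by rewrite (le_trans (ler_wpM2r (ltW d0) (ler_norm K1))) // ler_wpM2l ?normr_ge0.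
  rewrite -!mulrA ler_wpM2l ?rabs_ge0 // mulrA (le_trans (Tl2 x)) // ler_wpM2r ?rnorm_ge0 //.
  by rewrite (le_trans (ler_wpM2r (ltW d0) (ler_norm K2))) // ler_wpM2l ?normr_ge0.
Qed.

Lemma obound_adj (S S' : H -> H) (K : R) : 0 <= K ->
  (forall x y, hdot H (S x) y = hdot H x (S' y)) -> obound S K -> obound S' K.
Proof.
move=> K0 SS' SK x; have [T0|T0] := eqVneq (rnorm (S' x)) 0.
  by rewrite T0 mulr_ge0 ?rnorm_ge0.
have T1 : 0 < rnorm (S' x) by rewrite lt_def T0 rnorm_ge0.
rewrite -(ler_pM2l T1) -expr2 -rdot_norm /rdot -SS'.
apply: le_trans (rdot_CS _ _) _; rewrite mulrA ler_wpM2r ?rnorm_ge0 // mulrC.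
exact: SK.
Qed.

Lemma apx_star f T : apx f T -> apx (ginvol f) (adj T).
Proof.
move=> [A [K [fA fT]]]; exists (map (@pinv E) A), `|K|.
have supinv (f' : G -> R[i]) : suppin A f' -> suppin (map (@pinv E) A) (ginvol f').
  move=> f'A g; rewrite /ginvol conjC_eq0 => /f'A h.
  by apply/mapP; exists (lab (ginv g)) => //; rewrite (ginvE g).1 pinvK.
split; first exact: supinv.
move=> e e0; have [l [gl Al fl Tl]] := fT e e0; exists (lstar l); split.
- exact: lstar_good.
- by move=> g; rewrite ev_lstar //; exact: supinv.
- by move=> g; rewrite ev_lstar // /ginvol -raddfB rabs_conj.
- apply: (@obound_adj (fun x => T x - lsum l x)).
  + by rewrite mulr_ge0 // ltW.
  + by move=> x y; rewrite dotBl dotBr adjP lsum_lstar.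
  + move=> x; apply: le_trans (Tl x) _; rewrite ler_wpM2r ?rnorm_ge0 //.
    by rewrite ler_wpM2r ?ler_norm // ltW.
Qed.

Lemma apx_mul f1 f2 T1 T2 : apx f1 T1 -> apx f2 T2 -> apx (gconv f1 f2) (bcomp T1 T2).
Proof.
move=> [A1 [K1 [fA1 fT1]]] [A2 [K2 [fA2 fT2]]].
have bnd f T : apx f T -> exists2 b : R, 0 <= b & forall g, rabs (f g) <= b.
  move=> [A [K [fA fT]]]; have [l [gl Al fl _]] := fT 1 ltr01.
  have [b b0 lb] := ev_bounded l; exists (1 + b); first by rewrite addr_ge0.
  by move=> g; rewrite -(subrK (ev l g) (f g)) (le_trans (rabsD _ _)) // lerD.
have [b1 b10 fb1] : exists2 b : R, 0 <= b & forall g, rabs (f1 g) <= b by apply: (bnd _ T1); exists A1, K1.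
have [b2 b20 fb2] : exists2 b : R, 0 <= b & forall g, rabs (f2 g) <= b by apply: (bnd _ T2); exists A2, K2.
have [N1 N10 TN1] := bop_bounded T1; have [N2 N20 TN2] := bop_bounded T2.
(* The error is [T1 (T2 - l2) + (T1 - l1) l2], with [l2] bounded by [N2 + |K2|]. *)
pose K := `|K1| * (N2 + `|K2|) + N1 * `|K2|.
exists [seq pmul a b | a <- A1, b <- A2], K; split; first exact: gconv_suppin.
(* With this [C], [gconv_approx] gives an error of at most [e]; the added one ensures [C >= 1],
   hence [d <= e]. *)
move=> e e0; pose C := (size A2)%:R * (b2 + (b1 + 1)) + 1.
have C1 : 1 <= C by rewrite lerDr mulr_ge0 ?ler0n // !addr_ge0.
pose d := Num.min 1 (e / C).
have C0 : 0 < C by exact: lt_le_trans C1.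
have d0 : 0 < d by rewrite lt_min ltr01 divr_gt0.
have d1 : d <= 1 by rewrite ge_min lexx.
have dC : C * d <= e by rewrite mulrC -ler_pdivlMr // ge_min lexx orbT.
have de : d <= e by apply: le_trans dC; rewrite ler_peMl // ltW.
have [l1 [g1 Al1 fl1 Tl1]] := fT1 d d0; have [l2 [g2 Al2 fl2 Tl2]] := fT2 d d0.
have [n [gn nE nS]] := lmul_exists g1 g2.
exists n; split=> //.
- move=> c; rewrite nE; apply: gconv_suppin => //.
- move=> c; rewrite nE.
  apply: le_trans dC; apply: le_trans (gconv_approx _ (ltW d0) d1 fA2 Al2 fb1 fb2 fl1 fl2) _.
  by rewrite ler_wpM2r ?(ltW d0) // lerDl.
- move=> x; rewrite bcompE nS //.
  have h1 y : rnorm (T1 y - lsum l1 y) <= `|K1| * e * rnorm y.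
    apply: le_trans (Tl1 y) _; rewrite ler_wpM2r ?rnorm_ge0 //.
    by rewrite (le_trans (ler_wpM2r (ltW d0) (ler_norm K1))) // ler_wpM2l ?normr_ge0.
  have h2 : rnorm (T2 x - lsum l2 x) <= `|K2| * d * rnorm x.
    apply: le_trans (Tl2 x) _; rewrite ler_wpM2r ?rnorm_ge0 //.
    by rewrite ler_wpM2r ?ler_norm // ltW.
  have h3 : rnorm (lsum l2 x) <= (N2 + `|K2|) * rnorm x.
    have -> : lsum l2 x = T2 x - (T2 x - lsum l2 x) by rewrite subKr.
    rewrite (le_trans (rnormD _ _)) // rnormN mulrDl lerD //.
    apply: le_trans h2 _; rewrite ler_wpM2r ?rnorm_ge0 //.
    by rewrite -[leRHS]mulr1 ler_wpM2l ?normr_ge0.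
  have -> : T1 (T2 x) - lsum l1 (lsum l2 x) =
     T1 (T2 x - lsum l2 x) + (T1 (lsum l2 x) - lsum l1 (lsum l2 x)).
    by rewrite bopB addrA subrK.
  apply: le_trans (rnormD _ _) _; rewrite /K !mulrDl addrC lerD //.
    apply: le_trans (h1 _) _.
    rewrite -!mulrA ler_wpM2l ?normr_ge0 // (mulrCA _ e) ler_wpM2l ?(ltW e0) //.
  apply: le_trans (TN1 _) _; rewrite -!mulrA ler_pM2l //.
  apply: le_trans h2 _; rewrite -!mulrA ler_wpM2l ?normr_ge0 // ler_wpM2r ?rnorm_ge0 //.
Qed.

Definition pi0 f : bop H := xget (bzero H) [set T | apx f T].

Lemma pi0_eq f T : apx f T -> pi0 f = T.
Proof.
move=> fT; rewrite /pi0; case: xgetP => [T' _ fT'|/(_ T)//].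
exact: apx_unique fT' fT.
Qed.

Lemma pi0P f : Cc f -> apx f (pi0 f).
Proof. by move=> /apx_exists[T fT]; rewrite (pi0_eq fT). Qed.

Lemma apx_ev l : lgood l -> apx (ev l) (rho l).
Proof.
move=> gl; exists (map (fun t => quot t.2.1 t.2.2) l), 0; split; first exact: ev_suppin.
move=> e e0; exists l; split=> //; first exact: ev_suppin.
  by move=> g; rewrite subrr rabs0 ltW.
by move=> x; rewrite rhoE subrr rnorm0 !mul0r.
Qed.

Lemma pi0_rep : Cc_representation pi0.
Proof.
split.
- move=> f1 f2 x C1 C2; have := apx_comb 1 (pi0P C1) (pi0P C2).
  have -> : (fun g => f1 g + 1 * f2 g) = f1 \+ f2 by apply/funext => g; rewrite mul1r.
  by move=> /pi0_eq ->; rewrite baddE bscaleE scale1r.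
(* Multiplication by a scalar is [apx_comb] with zero as first function. *)
- move=> k f x Cf; have z0 : apx (fun=> 0) (bzero H).
    have := apx_ev (l := [::]) (fun t => ltac:(by [])); congr apx.
    by apply/funext => g; rewrite /ev big_nil.
  have := apx_comb k z0 (pi0P Cf).
  have -> : (fun g => 0 + k * f g) = (fun g => k * f g) by apply/funext => g; rewrite add0r.
  by move=> /pi0_eq ->; rewrite baddE bscaleE bzeroE add0r.
- move=> f1 f2 x C1 C2; have := apx_mul (pi0P C1) (pi0P C2).
  by move=> /pi0_eq ->; rewrite bcompE.
- by move=> f Cf; apply: pi0_eq; apply: apx_star; exact: pi0P.
Qed.

End CcExtension.

(** * Representations of the convolution algebra *)

Section INorm.
Variables (R : realType) (E : digraph).
Local Notation G := (toeplitz_groupoid E).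
Implicit Types (p q r d a : gpath E) (g h k c : G) (f : G -> R[i]).
Local Notation coef := (R[i] * (gpath E * gpath E))%type.
Implicit Types (l m : seq coef) (t : coef) (A B : seq (gpath E)).

(** Gives the continuity of involution, convolution and restriction to labels without that of the
    groupoid operations, since each carries step approximations to step approximations. *)
Lemma uniform_continuous f : (forall e : R, 0 < e -> exists l, lgood l /\
    forall g, rabs (f g - ev l g) <= e) -> continuous (f : G -> R[i]^o).
Proof.
move=> fu; apply/continuousP_G => g e e0.
have e3 : 0 < e / 3 by rewrite divr_gt0.
have [l [gl fl]] := fu _ e3; have [cl _] := ev_Cc gl.
have [p [L [gp gL pL]]] := (continuousP_G _).1 cl g _ e3.
exists p, L; split=> // h /pL hl.
have -> : f g - f h = (f g - ev l g) + ((ev l g - ev l h) - (f h - ev l h)) by ring.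
apply: le_lt_trans (rabsD _ _) _; have := rabsD (ev l g - ev l h) (- (f h - ev l h)).
rewrite rabsN; have := fl g; have := fl h; lra.
Qed.

Lemma Cc_ginvol f : Cc f -> Cc (ginvol f).
Proof.
move=> Cf; have /CcP[_ [l [gl fl]]] := Cf; apply/CcP; split.
  apply: uniform_continuous => e e0; have [A [_ fA]] := step_approx Cf.
  have [m [gm _ fm]] := fA e e0; exists (lstar m); split; first exact: lstar_good.
  by move=> g; rewrite ev_lstar // /ginvol -raddfB rabs_conj.
exists (map (fun qp => (qp.2, qp.1)) l); split=> [_ /mapP[qp /gl [dq dp qp'] ->]|g]; first by split.
rewrite /ginvol conjC_eq0 => /fl[[q p] ql /= [lg gp]]; exists (p, q); first exact: (map_f _ ql).
have [/= dq dp qp] := gl _ ql.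
have Zg : Zset q p (ginv g) by split.
rewrite -(ginvK g) /=; split; last exact: Zset_rng Zg.
by rewrite (ginvE (ginv g)).1 lg -/(quot q p) quotV.
Qed.

(** Read off at [c] from the product formulas for [chi], which show that the product set lies in one
    [Zset] or is empty. *)
Lemma setprod_Zset (qp qp' : gpath E * gpath E) : good qp -> good qp' -> exists s : seq (gpath E * gpath E),
  (forall u, u \in s -> good u) /\ forall c, setprod (Zset qp.1 qp.2) (Zset qp'.1 qp'.2) c ->
  exists2 u, u \in s & Zset u.1 u.2 c.
Proof.
case: qp qp' => [q p] [q' p'] [/= dq dp qp] [/= dq' dp' qp'].
have key q0 p0 : good (q0, p0) -> gconv (chi R q p) (chi R q' p') = chi R q0 p0 ->
    exists s : seq (gpath E * gpath E),
    (forall u, u \in s -> good u) /\ forall c, setprod (Zset q p) (Zset q' p') c ->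
    exists2 u, u \in s & Zset u.1 u.2 c.
  move=> g0 cE; exists [:: (q0, p0)]; split=> [u|c Sc]; first by rewrite inE => /eqP ->.
  exists (q0, p0); first exact: mem_head.
  have := congr1 (fun f => f c) cE; rewrite /chi (@gconv_indic _ _ _ _ (quot q' p')); last by move=> h [].
  rewrite !indicE mem_set //; case: (boolP (c \in Zset q0 p0)) => [/set_mem //|_] /eqP.
  by rewrite oner_eq0.
have [[d [pE pd dd]]|[d [pE pd dd]]|npp] := directed_compare dp dq'.
- have dp'' : pt d = pt p' by rewrite -qp' pE pt_pmul.
  have qd : pt q = po d by rewrite qp.
  apply: (key (pmul q d) p'); last by rewrite pE chi_mul_ext.
  by split=> //=; [exact: directed_pmul|rewrite pt_pmul].
- have qd : pt q = pt d by rewrite qp pE pt_pmul.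
  have pd' : pt p' = po d by rewrite -qp'.
  apply: (key q (pmul p' d)); last by rewrite pE chi_mul_restr.
  by split=> //=; [exact: directed_pmul|rewrite pt_pmul].
- exists [::]; split=> // c Sc.
  have := congr1 (fun f => f c) (@chi_mul_orth R _ q _ _ _ dq' qp' npp).
  rewrite /chi (@gconv_indic _ _ _ _ (quot q' p')); last by move=> h [].
  by rewrite indicE mem_set // => /eqP; rewrite oner_eq0.
Qed.

Lemma Cc_bounded f : Cc f -> exists2 b : R, 0 <= b & forall g, rabs (f g) <= b.
Proof.
move=> Cf; have [A [_ fA]] := step_approx Cf; have [l [gl _ fl]] := fA 1 ltr01.
have [b b0 lb] := ev_bounded l; exists (1 + b); first by rewrite addr_ge0.
by move=> g; rewrite -(subrK (ev l g) (f g)) (le_trans (rabsD _ _)) // lerD.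
Qed.

Lemma Cc_gconv f1 f2 : Cc f1 -> Cc f2 -> Cc (gconv f1 f2).
Proof.
move=> C1 C2; apply/CcP; split.
  have [A1 [fA1 sA1]] := step_approx C1; have [A2 [fA2 sA2]] := step_approx C2.
  have [b1 b10 fb1] := Cc_bounded C1; have [b2 b20 fb2] := Cc_bounded C2.
  apply: uniform_continuous => e e0; pose K := (size A2)%:R * (b2 + (b1 + 1)) + 1.
  have K0 : 0 < K by rewrite ltr_wpDl // mulr_ge0 ?ler0n // !addr_ge0.
  pose d := Num.min 1 (e / K).
  have d0 : 0 < d by rewrite lt_min ltr01 divr_gt0.
  have d1 : d <= 1 by rewrite ge_min lexx.
  have dK : K * d <= e by rewrite mulrC -ler_pdivlMr // ge_min lexx orbT.
  have [l1 [g1 Al1 fl1]] := sA1 d d0; have [l2 [g2 Al2 fl2]] := sA2 d d0.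
  have [n [gn nE _]] := lmul_exists g1 g2; exists n; split=> // c; rewrite nE.
  apply: le_trans dK; apply: le_trans (gconv_approx _ (ltW d0) d1 fA2 Al2 fb1 fb2 fl1 fl2) _.
  by rewrite ler_wpM2r ?(ltW d0) // lerDl.
have /CcP[_ [l1 [g1 fl1]]] := C1; have /CcP[_ [l2 [g2 fl2]]] := C2.
have [A2 fA2] := Cc_suppin C2.
have supp c : gconv f1 f2 c != 0 -> exists2 qp, qp \in l1 & exists2 qp', qp' \in l2 &
    setprod (Zset qp.1 qp.2) (Zset qp'.1 qp'.2) c.
  move=> cn0; have [b cb] : exists b, conv_at f1 f2 c b != 0.
    apply: contrapT => nb; case/eqP: cn0; rewrite (gconvE _ _ (undup_uniq A2) (suppin_undup fA2)).
    rewrite big1 // => b _; apply/eqP; apply: contrapT => /negP cb.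
    by apply: nb; exists b.
  move: cb; rewrite /conv_at; case: pselect => [H|_]; last by rewrite eqxx.
  case: cid => h /= [hb ch]; rewrite mulf_eq0 negb_or => /andP[/fl1[qp ql Zg] /fl2[qp' ql' Zh]].
  exists qp => //; exists qp' => //; exists (gmul c (ginv h)), h.
  by have [e1 e2 _ _] := gdivE ch.
have [s [gs sP]] : exists s : seq (gpath E * gpath E), (forall u, u \in s -> good u) /\
    forall qp qp' c, qp \in l1 -> qp' \in l2 ->
    setprod (Zset qp.1 qp.2) (Zset qp'.1 qp'.2) c -> exists2 u, u \in s & Zset u.1 u.2 c.
  elim: l1 g1 {fl1 supp} => [|qp l1 IH] g1; first by exists [::].
  have [|s [gs sP]] := IH; first by move=> u ul; apply: g1; rewrite inE ul orbT.
  have [s' [gs' sP']] : exists s' : seq (gpath E * gpath E), (forall u, u \in s' -> good u) /\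
      forall qp' c, qp' \in l2 ->
      setprod (Zset qp.1 qp.2) (Zset qp'.1 qp'.2) c -> exists2 u, u \in s' & Zset u.1 u.2 c.
    elim: l2 g2 {IH fl2 sP} => [|qp' l2 IH2] g2; first by exists [::].
    have [|s2 [gs2 sP2]] := IH2; first by move=> u ul; apply: g2; rewrite inE ul orbT.
    have [s3 [gs3 sP3]] := setprod_Zset (g1 _ (mem_head _ _)) (g2 _ (mem_head _ _)).
    exists (s2 ++ s3); split=> [u|qp0 c]; first by rewrite mem_cat => /orP[/gs2|/gs3].
    rewrite inE => /predU1P[->|ql] Sc.
      by have [u us Zu] := sP3 c Sc; exists u => //; rewrite mem_cat us orbT.
    by have [u us Zu] := sP2 _ _ ql Sc; exists u => //; rewrite mem_cat us.
  exists (s ++ s'); split=> [u|qp0 qp' c]; first by rewrite mem_cat => /orP[/gs|/gs'].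
  rewrite inE => /predU1P[->|ql] ql' Sc.
    by have [u us Zu] := sP' _ _ ql' Sc; exists u => //; rewrite mem_cat us orbT.
  by have [u us Zu] := sP _ _ _ ql ql' Sc; exists u => //; rewrite mem_cat us.
exists s; split=> // c /supp[qp ql [qp' ql']]; exact: sP.
Qed.

Lemma lab_gid c : lab (gid (gsrc c)) = path0 (pt (lab c)).
Proof. by rewrite pt_lab. Qed.

Lemma unit_lab c : pe (lab c) = [::] -> c = gid (gsrc c).
Proof.
move=> c0; apply: (@arrow_unique _ c) => //; first by rewrite gsrc_id.
by rewrite lab_gid [LHS](pe0_path0 c0) (pt_pe0 c0).
Qed.

(** If the right factor of [c] is a unit, the left factor is [c] itself; so for functions on units
    the convolution is pointwise. *)
Lemma gconv_units (b : G -> R[i]) A c : suppin A b ->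
  (forall g, b g != 0 -> g = gid (gsrc g)) -> gconv b b c = b c * b c.
Proof.
move=> bA bu; rewrite (gconvE _ _ (undup_uniq A) (suppin_undup bA)).
have bid : b (gid (gsrc c)) != 0 -> lab (gid (gsrc c)) \in undup A by move=> /bA; rewrite mem_undup.
have cE : conv_at b b c (lab (gid (gsrc c))) = b c * b (gid (gsrc c)).
  have e : gsrc c = gsrc (gid (gsrc c)) by rewrite gsrc_id.
  rewrite conv_atE //; congr (b _ * _).
  have := gmul_id (gmul c (ginv (gid (gsrc c)))).
  by rewrite (gsrc_div e) grng_id (gdivK e) => <-.
have zero a : a != lab (gid (gsrc c)) -> conv_at b b c a = 0.
  move=> ac; rewrite /conv_at; case: pselect => // H; case: cid => h /= [ha ch].
  have [->|/bu hE] := eqVneq (b h) 0; first by rewrite mulr0.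
  by case/eqP: ac; rewrite -ha {1}hE; congr (lab (gid _)); exact: esym ch.
have -> : \sum_(a <- undup A) conv_at b b c a = b c * b (gid (gsrc c)).
  have [idA|idA] := boolP (lab (gid (gsrc c)) \in undup A).
    by rewrite (bigD1_seq _ idA) ?undup_uniq //= cE big1 ?addr0.
  have -> : b (gid (gsrc c)) = 0 by apply/eqP; apply: contrapT => /negP/bid; apply/negP.
  rewrite mulr0 big_seq big1 // => a aA; apply: zero.
  by apply: contraNneq idA => <-.
by have [->|/bu <-//] := eqVneq (b c) 0; rewrite !mul0r.
Qed.

(** Both values entering [f^* f] at [c] are taken at arrows of label [a], so the label of [c] is
    trivial and the two arrows coincide. *)
Lemma square_values f a c : suppin [:: a] f -> gconv (ginvol f) f c != 0 ->
  c = gid (gsrc c) /\ exists k, gconv (ginvol f) f c = (rabs (f k) ^+ 2)%:C.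
Proof.
move=> fa; rewrite (@gconvE _ _ _ _ _ [:: a]) // big_seq1 /conv_at.
case: pselect => [H|_]; last by rewrite eqxx.
case: cid => k /= [ka ck]; rewrite mulf_eq0 negb_or => /andP[].
rewrite {1}/ginvol conjC_eq0 => /fa; rewrite inE => /eqP lk _.
have [e1 e2 e3 e4] := gdivE ck.
rewrite (ginvE _).1 e3 ka in lk.
have ca : pt (lab c) = po (pinv a) by rewrite -ka pt_lab po_pinv pt_lab; congr lam; apply/gsrcE.
have lc : lab c = path0 (pt a).
  have := congr1 (@pinv E) lk; rewrite pinvK => h.
  by rewrite -(pmulp0 (lab c)) ca po_pinv -pmulV -pmulA ?pt_pinv // h pmulV.
have cu : c = gid (gsrc c) by apply: unit_lab; rewrite lc.
split=> //; exists k; rewrite -rabs_sq mulrC; congr (_ * _).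
have ck' : c = gid (gsrc k) by rewrite cu; congr (gid _); exact: ck.
have ckV : gmul c (ginv k) = ginv k by rewrite ck' -{1}(grng_inv k) gid_mul.
by rewrite /ginvol; congr (Num.conj (f _)); rewrite -[RHS]ginvK; congr (ginv _).
Qed.

(** Transfers continuity from [f^* f] to the square root: a tolerance [e^2] under the root gives
    [e]. *)
Lemma sqrt_dist (s t : R) : 0 <= s -> 0 <= t ->
  `|Num.sqrt s - Num.sqrt t| ^+ 2 <= `|s - t|.
Proof.
wlog st : s t / t <= s => [hw|s0 t0].
  case/orP: (le_total t s) => [ts|st]; first exact: hw.
  by move=> s0 t0; rewrite distrC (distrC s); apply: hw.
have h : Num.sqrt t <= Num.sqrt s by rewrite ler_sqrt.
rewrite !ger0_norm ?subr_ge0 // -{2}(sqr_sqrtr s0) -{2}(sqr_sqrtr t0) subr_sqr expr2.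
rewrite ler_wpM2l ?subr_ge0 // lerD2l; have := sqrtr_ge0 t; lra.
Qed.

Variables (H : hilbert R) (pi : (G -> R[i]) -> bop H).
Hypothesis pirep : Cc_representation pi.
Implicit Types x y : H.

(* The function [b = B - sqrt (B^2 - f^* f)], supported on units, satisfies
   [b^2 = 2 B b - f^* f], whence [|B x|^2 - |pi f x|^2 = |B x - pi b x|^2]. *)
Lemma Cc_rep_bound1 f a (B : R) : 0 <= B -> Cc f -> suppin [:: a] f ->
  (forall g, rabs (f g) <= B) -> obound (pi f) B.
Proof.
move=> B0 Cf fa fB; pose u := gconv (ginvol f) f.
have Cu : Cc u by apply: Cc_gconv => //; exact: Cc_ginvol.
have uP c : exists r : R, [/\ u c = r%:C, 0 <= r & r <= B ^+ 2].
  have [->|uc] := eqVneq (u c) 0; first by exists 0; rewrite sqr_ge0.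
  have [_ [k uk]] := square_values fa uc; exists (rabs (f k) ^+ 2); split; first exact: uk.
    exact: sqr_ge0.
  by rewrite ler_pXn2r ?nnegrE ?rabs_ge0.
pose b : G -> R[i] := fun c => (B - Num.sqrt (B ^+ 2 - complex.Re (u c)))%:C.
(* [B] is nonnegative, hence the root of its own square; so [b] vanishes where [f^* f] does and
   inherits compact support. *)
have bu c : b c != 0 -> u c != 0.
  apply: contraNneq => uc; rewrite /b uc /= subr0 sqrtr_sqr ger0_norm // subrr.
  by [].
have Cb : Cc b.
  apply: (Cc_sub Cu) => //; apply/continuousP_G => g e e0.
  have e2 : 0 < e ^+ 2 by rewrite exprn_gt0.
  have [p [L [gp gL pL]]] := (continuousP_G _).1 Cu.1 g _ e2.
  exists p, L; split=> // h /pL; rewrite /b.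
  have [r [-> r0 rB]] := uP g; have [s [-> s0 sB]] := uP h.
  rewrite -rmorphB rabs_real /= => rs.
  have -> : forall z w : R, z%:C - w%:C = (z - w)%:C :> R[i] by move=> z w; rewrite rmorphB.
  rewrite rabs_real opprB addrC subrKA.
  rewrite -(ltr_pXn2r (n := 2)) ?nnegrE ?normr_ge0 ?(ltW e0) //.
  apply: le_lt_trans (sqrt_dist _ _) _; rewrite ?subr_ge0 //.
  by rewrite opprB addrC subrKA.
have bunit c : b c != 0 -> c = gid (gsrc c) by move=> /bu/(square_values fa)[].
have [A bA] := Cc_suppin Cb.
have bb : gconv b b = (fun c => (2 * B)%:C * b c) \+ (fun c => (-1) * u c).
  apply/funext => c; rewrite (gconv_units _ bA bunit) /= /b.
  have [r [-> r0 rB]] := uP c; rewrite /= mulN1r -!rcM.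
  have -> : - r%:C = (- r)%:C :> R[i] by rewrite rmorphN.
  rewrite -rcD; congr (_%:C).
  have : Num.sqrt (B ^+ 2 - r) ^+ 2 = B ^+ 2 - r by rewrite sqr_sqrtr // subr_ge0.
  move: (Num.sqrt _) => w hw; have -> : r = B ^+ 2 - w ^+ 2 by rewrite hw subKr.
  ring.
(* [b] is real and lives on units, which are their own inverses. *)
have bstar : ginvol b = b.
  apply/funext => c; rewrite /ginvol.
  have bconj z : Num.conj (b z) = b z by rewrite /b; exact: conjc_real.
  rewrite bconj.
  have inv_unit g : b g != 0 -> ginv g = g.
    move=> /bunit gE; rewrite gE; set v := gsrc g.
    by rewrite -[LHS]gmul_id gsrc_inv grng_id ginv_mul gsrc_id.
  have [b0|/inv_unit -> //] := eqVneq (b c) 0.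
  have [->//|bc] := eqVneq (b (ginv c)) 0.
  by have := inv_unit _ bc; rewrite ginvK => <-.
have pib x y : hdot H (pi b x) y = hdot H x (pi b y).
  by rewrite adjP -(Cc_rep_star pirep) // bstar.
have piu x : pi u x = (2 * B)%:C *: pi b x - pi b (pi b x).
  rewrite -(Cc_repM pirep) // bb (Cc_repD pirep) ?(Cc_repZ pirep) ?scaleN1r //.
  - by rewrite opprD opprK addrA subrr add0r.
  - exact: CcZ.
  - exact: CcZ.
move=> x; rewrite -(ler_pXn2r (n := 2)) ?nnegrE ?mulr_ge0 ?rnorm_ge0 //.
have -> : rnorm (pi f x) ^+ 2 = rdot (pi u x) x.
  rewrite -rdot_norm /rdot (Cc_repM pirep) //; last exact: Cc_ginvol.
  by rewrite (Cc_rep_star pirep) // -adjPr.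
rewrite piu rdotDl rdotZl rdotNl.
have -> : rdot (pi b (pi b x)) x = rnorm (pi b x) ^+ 2.
  by rewrite -rdot_norm /rdot pib.
have := sqr_ge0 (rnorm (B%:C *: x - pi b x)).
rewrite rnormD_sq rnormN rnormZ rabs_real rdotNr rdotZl (rdotC x) ger0_norm // => hh.
by rewrite exprMn in hh *; lra.
Qed.

End INorm.

(** * Norm estimates in the full algebra *)

Section FullNorm.
Variables (R : realType) (E : digraph).
Local Notation G := (toeplitz_groupoid E).
Implicit Types (g h : G) (f : G -> R[i]) (A : seq (gpath E)).

Lemma Cc_cut A f : Cc f -> Cc (fun g => if lab g \in A then f g else 0).
Proof.
move=> Cf; apply: (Cc_sub Cf) => [|g]; last by case: ifP => // _; rewrite eqxx.
apply: uniform_continuous => e e0; have [B [_ fB]] := step_approx Cf.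
have [l [gl _ fl]] := fB e e0; exists (lres A l); split; first exact: lres_good.
move=> g; rewrite ev_lres; case: ifP => // _; by rewrite subr0 rabs0 ltW.
Qed.

Lemma Cc_rep0 (H : hilbert R) (pi : (G -> R[i]) -> bop H) x :
  Cc_representation pi -> pi (fun=> 0) x = 0.
Proof.
move=> pirep; have := Cc_repZ pirep 0 x (@Cc0 R E); rewrite scale0r => <-.
by congr (pi _ x); apply/funext => g; rewrite mulr0.
Qed.

(** Slices are split off one at a time; each contributes [B] by [Cc_rep_bound1]. *)
Lemma Cc_rep_bound (H : hilbert R) (pi : (G -> R[i]) -> bop H) f A (B : R) :
  Cc_representation pi -> 0 <= B -> Cc f -> suppin A f ->
  (forall g, rabs (f g) <= B) -> obound (pi f) ((size A)%:R * B).
Proof.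
move=> pirep B0; elim: A f => [|a A IH] f Cf fA fB x.
  have -> : f = fun=> 0.
    by apply/funext => g; apply/eqP; apply: contrapT => /negP/fA.
  by rewrite Cc_rep0 // rnorm0 !mul0r.
pose f1 g := if lab g \in [:: a] then f g else 0.
pose f2 g := f g + (-1) * f1 g.
have C1 : Cc f1 := Cc_cut _ Cf.
have C2 : Cc f2 := CcD Cf (CcZ (-1) C1).
have fE : f = f1 \+ f2 by apply/funext => g; rewrite /f2 /= mulN1r addrC subrK.
have f1z g : f1 g = if lab g == a then f g else 0 by rewrite /f1 inE.
have f2z g : f2 g = if lab g == a then 0 else f g.
  by rewrite /f2 f1z mulN1r; case: ifP => _; rewrite ?subrr ?subr0.
have b1 : obound (pi f1) B.
  apply: (Cc_rep_bound1 pirep (a := a)) => // g; rewrite f1z.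
    by case: ifP => [/eqP -> _|_]; rewrite ?mem_head ?eqxx.
  by case: ifP; rewrite ?rabs0.
have b2 : obound (pi f2) ((size A)%:R * B).
  apply: IH => // g; rewrite f2z.
    by case: ifP => [_|ga /fA]; rewrite ?eqxx // inE ga.
  by case: ifP; rewrite ?rabs0.
rewrite {1}fE (Cc_repD pirep) // (le_trans (rnormD _ _)) //= mulrS mulrDl mul1r mulrDl.
by rewrite lerD.
Qed.

Variable TO : full_cstar R G.
Local Notation emb := (full_emb TO).

Lemma full_bound f A (B : R) : 0 <= B -> Cc f -> suppin A f ->
  (forall g, rabs (f g) <= B) -> rnorm (emb f) <= (size A)%:R * B.
Proof.
move=> B0 Cf fA fB; rewrite -lecR rnormE; apply: full_norm_lub => //.
  by rewrite lecR mulr_ge0.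
move=> H pi pirep x; rewrite -!rnormE -rcM lecR.
exact: (Cc_rep_bound pirep).
Qed.

Lemma full_emb_comb f1 f2 (k : R[i]) : Cc f1 -> Cc f2 ->
  emb (fun g => f1 g + k * f2 g) = emb f1 + k *: emb f2.
Proof.
move=> C1 C2; rewrite -full_embZ // -full_embD //; exact: CcZ.
Qed.

(** [full_bound] turns uniform approximation into approximation in norm, because [step_approx] keeps
    the labels in a fixed set. *)
Lemma ev_dense (a : TO) (e : R) : 0 < e ->
  exists2 l, lgood l & rnorm (a - emb (ev l)) <= e.
Proof.
move=> e0; have e2 : 0 < e / 2 by rewrite divr_gt0.
have /closure_rnormP/(_ _ e2)[_ [f Cf <-] af] : closure (emb @` @Cc R G) a.
  by rewrite full_emb_dense.
have [A [fA sA]] := step_approx Cf.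
have e3 : 0 < e / 2 / ((size A)%:R + 1) by rewrite divr_gt0 // ltr_wpDl.
have [l [gl Al fl]] := sA _ e3; exists l => //.
have Cl := ev_Cc gl.
have fle : rnorm (emb f - emb (ev l)) <= e / 2.
  rewrite -scaleN1r -full_emb_comb //.
  apply: le_trans (full_bound (A := A) (ltW e3) _ _ _) _.
  - exact: CcD Cf (CcZ (-1) Cl).
  - exact: suppin_comb.
  - by move=> g; rewrite mulN1r.
  - rewrite mulrCA ler_piMr ?(ltW e2) // ler_pdivrMr ?mul1r ?lerDl //.
have := rnorm_dist a (emb f) (emb (ev l)); lra.
Qed.

End FullNorm.

(** * Automatic boundedness of representations of a C*-algebra *)

Section RepBounded.
Variables (R : realType) (A : cstar_algebra R).
Implicit Types a b c : A.

Lemma cnormM_r a b : rnorm (cmul a b) <= rnorm a * rnorm b.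
Proof. by rewrite -lecR rcM !rnormE cnormM. Qed.

Lemma cnorm_star_r a : rnorm (cmul (cstar a) a) = rnorm a ^+ 2.
Proof. by apply: complexI; rewrite rcX !rnormE cnorm_star. Qed.

Lemma cstar_isom a : rnorm (cstar a) = rnorm a.
Proof.
have le b : rnorm b <= rnorm (cstar b).
  have [->|b0] := eqVneq (rnorm b) 0; first exact: rnorm_ge0.
  have b1 : 0 < rnorm b by rewrite lt_def b0 rnorm_ge0.
  by rewrite -(ler_pM2r b1) -expr2 -cnorm_star_r cnormM_r.
by apply/eqP; rewrite eq_le le andbT -{2}[a]cstarK le.
Qed.

Lemma cstarN a : cstar (- a) = - cstar a.
Proof. by rewrite -scaleN1r cstarZ rmorphN1 scaleN1r. Qed.

Lemma cmulNl a b : cmul (- a) b = - cmul a b.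
Proof. by rewrite -scaleN1r cmulZl scaleN1r. Qed.
Lemma cmulNr a b : cmul a (- b) = - cmul a b.
Proof. by rewrite -scaleN1r cmulZr scaleN1r. Qed.

Lemma csquareB a b : rnorm (cmul a a - cmul b b) <= (rnorm a + rnorm b) * rnorm (a - b).
Proof.
have -> : cmul a a - cmul b b = cmul a (a - b) + cmul (a - b) b.
  by rewrite cmulDr cmulDl cmulNr cmulNl addrA subrK.
rewrite (le_trans (rnormD _ _)) // mulrDl lerD ?cnormM_r //.
by rewrite (le_trans (cnormM_r _ _)) // mulrC.
Qed.

Section QuasiSqrt.
Variable c : A.
Hypotheses (cc : cstar c = c) (c1 : rnorm c <= 3 / 4).

Let u := fix u n := if n is m.+1 then (2^-1)%:C *: (c + cmul (u m) (u m)) else 0 : A.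

(** The origin of 3/4: since [(3/4 + 1/4) / 2 = 1/2], the ball of radius 1/2 is invariant, and there
    the iteration contracts by the factor 1/2, by [csquareB]. *)
Let u_le n : rnorm (u n) <= 1 / 2.
Proof.
elim: n => [|n IH]; first by rewrite rnorm0 divr_ge0.
rewrite /= rnormZ rabs_real ger0_norm ?invr_ge0 //.
have := rnormD c (cmul (u n) (u n)); have := cnormM_r (u n) (u n).
have : rnorm (u n) * rnorm (u n) <= 1 / 2 * (1 / 2) by rewrite ler_pM ?rnorm_ge0.
move: c1; lra.
Qed.

Let u_dist n k : rnorm (u (n + k) - u n) <= (2^-1) ^+ n.
Proof.
elim: n => [|n IH]; first by rewrite subr0 expr0; apply: le_trans (u_le _) _; lra.
rewrite addSn /= -scalerBr opprD addrACA subrr add0r rnormZ rabs_real.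
rewrite ger0_norm ?invr_ge0 // exprS ler_wpM2l ?invr_ge0 //.
apply: le_trans (csquareB _ _) _; apply: le_trans IH.
rewrite ler_piMl ?rnorm_ge0 //; have := u_le n; have := u_le (n + k); lra.
Qed.

Let u_star n : cstar (u n) = u n.
Proof.
elim: n => [|n IH]; first by rewrite /= -{1}(scale0r (0 : A)) cstarZ rmorph0 scale0r.
by rewrite /= cstarZ cstarD cstarM IH cc; congr (_ *: _); exact: conjc_real.
Qed.

(* [1 - b] is a square root of [1 - c] in the unitization, obtained by iterating
   [b |-> (c + b^2) / 2] from [0]. *)
Lemma quasi_sqrt : exists2 b, cstar b = b & c = b + b - cmul b b.
Proof.
have half (e : R) : 0 < e -> exists N, forall n, (N <= n)%N -> (2^-1 : R) ^+ n <= e.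
  move=> e0; have /cvgrPdist_lt/(_ _ e0)[N _ NP] : (2^-1 : R) ^+ n @[n --> \oo] --> (0 : R).
    by apply: cvg_expr; rewrite ger0_norm ?invr_ge0 // invf_lt1 // ltr1n.
  exists N => n /NP; rewrite /= sub0r normrN ger0_norm ?exprn_ge0 ?invr_ge0 //; exact: ltW.
have [b bP] : exists b, forall e : R, 0 < e -> exists N, forall n, (N <= n)%N -> rnorm (u n - b) <= e.
  apply: rnorm_complete => e e0; have e2 : 0 < e / 2 by rewrite divr_gt0.
  have [N NP] := half _ e2; exists N => m n Nm Nn.
  have := rnorm_dist (u m) (u N) (u n); rewrite (rnormB (u N)).
  have := u_dist N (m - N); have := u_dist N (n - N); rewrite !subnKC //.
  have := NP N (leqnn _); lra.
have b_le : rnorm b <= 1.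
  apply/ler_addgt0Pr => e e0; have [N NP] := bP e e0.
  have := NP N (leqnn _); have := u_le N; have := rnorm_dist b (u N) 0.
  rewrite !subr0 (rnormB b); lra.
exists b.
  apply/subr0_eq/rnorm0_eq0/ler_addgt0Pr => e e0; rewrite add0r.
  have e2 : 0 < e / 2 by rewrite divr_gt0.
  have [N NP] := bP _ e2; have h := NP N (leqnn _).
  have := rnorm_dist (cstar b) (u N) b.
  rewrite -{1}(u_star N) -cstarN -cstarD cstar_isom (rnormB b); lra.
apply/subr0_eq/rnorm0_eq0/ler_addgt0Pr => e e0; rewrite add0r.
have e4 : 0 < e / 4 by rewrite divr_gt0.
have [N NP] := bP _ e4; have h := NP N (leqnn _); have h' := NP N.+1 (leqnSn _).
(* [c + u_N^2 = 2 u_(N+1)], so the defect of [b] is twice the error at [N + 1] minus a difference of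
   squares; each part is at most [e / 2]. *)
have -> : c - (b + b - cmul b b) =
    (u N.+1 - b) + (u N.+1 - b) - (cmul (u N) (u N) - cmul b b).
  have -> : u N.+1 - b + (u N.+1 - b) = c + cmul (u N) (u N) - (b + b).
    rewrite addrACA -opprD /= -scalerDl -rcD.
    have -> : 2^-1 + 2^-1 = 1 :> R by lra.
    by rewrite scale1r.
  rewrite (addrAC c) -[RHS]addrA opprB (addrC (cmul (u N) _)) opprB subrK.
  by rewrite (addrC (cmul b b)) addrA.
apply: le_trans (rnormD _ _) _; rewrite rnormN.
have := rnormD (u N.+1 - b) (u N.+1 - b); have := csquareB (u N) b.
have : (rnorm (u N) + rnorm b) * rnorm (u N - b) <= 2 * (e / 4).
  by rewrite ler_pM ?addr_ge0 ?rnorm_ge0 //; have := u_le N; lra.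
lra.
Qed.

End QuasiSqrt.

Variables (H : hilbert R) (pi : A -> bop H).
Hypothesis pirep : representation pi.

Lemma rep_norm a x : rnorm (pi a x) ^+ 2 = rdot (pi (cmul (cstar a) a) x) x.
Proof. by rewrite -rdot_norm /rdot (repM pirep) (rep_star pirep) -adjPr. Qed.

(** If [a^* a = 2 b - b^2] with [b] self-adjoint, then [|x|^2 - |pi a x|^2 = |x - pi b x|^2]. *)
Lemma rep_bound_small a : rnorm a ^+ 2 <= 3 / 4 -> obound (pi a) 1.
Proof.
rewrite -cnorm_star_r => a1 x.
rewrite mul1r -(ler_pXn2r (n := 2)) ?nnegrE ?rnorm_ge0 // rep_norm.
have cc : cstar (cmul (cstar a) a) = cmul (cstar a) a by rewrite cstarM cstarK.
have [b bb ->] := quasi_sqrt cc a1.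
rewrite -scaleN1r !(repD pirep) (repZ pirep) scaleN1r !rdotDl rdotNl.
have := rep_norm b x; rewrite bb => <-.
have := sqr_ge0 (rnorm (x - pi b x)); rewrite rnormD_sq rnormN rdotNr (rdotC x); lra.
Qed.

(* The constant is not optimal: the norm of a representation is at most one. *)
Lemma rep_bounded a : obound (pi a) (2 * rnorm a).
Proof.
move=> x; have [a0|a0] := eqVneq (rnorm a) 0.
  have -> : a = 0 by apply: rnorm0_eq0; rewrite a0.
  by rewrite -{1}(scale0r (0 : A)) (repZ pirep) scale0r rnorm0 !mulr_ge0 ?rnorm_ge0.
have a1 : 0 < rnorm a by rewrite lt_def a0 rnorm_ge0.
have k0 : 0 < (2 * rnorm a)^-1 by rewrite invr_gt0 mulr_gt0.
(* After scaling, the norm is 1/2, whose square is below 3/4. *)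
have small : rnorm (((2 * rnorm a)^-1)%:C *: a) ^+ 2 <= 3 / 4.
  rewrite rnormZ rabs_real (ger0_norm (ltW k0)) invfM -mulrA mulVf // mulr1; lra.
have := rep_bound_small small x.
rewrite (repZ pirep) rnormZ rabs_real (ger0_norm (ltW k0)) mul1r.
by rewrite ler_pdivrMl ?mulr_gt0.
Qed.

End RepBounded.

(** * The correspondence *)

Section Forward.
Variables (R : realType) (E : digraph) (H : hilbert R).
Local Notation G := (toeplitz_groupoid E).
Variable TO : full_cstar R G.
Implicit Types (p q r d : gpath E) (g h : G) (x y : H) (a b : TO).
Local Notation emb := (full_emb TO).
Local Notation coef := (R[i] * (gpath E * gpath E))%type.
Implicit Types (l : seq coef).

Lemma quot_path0 p : quot p (path0 (pt p)) = p.
Proof. by rewrite /quot [pinv _](_ : _ = path0 (pt p)) ?pmulp0 //; exact: gpath_ext. Qed.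

Lemma prg_path0 g : prg g (path0 (pt (lab g))).
Proof.
have [p gp] := prs_neq0 (XE_pnt g); have dp := prg_directed gp.
rewrite (prg_po gp); apply: (prs_down gp) => //; apply: prefix_VL => //.
exact: prefix0s.
Qed.

(** The empty path is a prefix of every source, so a slice is one of the sets [Zset]. *)
Lemma slice_chi p : \1_(slice p) = chi R p (path0 (pt p)).
Proof.
rewrite /chi; congr (\1_ _); apply/seteqP; split=> g.
  move=> gp; have lg : lab g = p by exact: gp.
  split; first by rewrite -/(quot p (path0 (pt p))) quot_path0.
  by rewrite -lg; exact: prg_path0.
by case; rewrite -/(quot p (path0 (pt p))) quot_path0 => lg _; exact: lg.
Qed.

Lemma emb_nil : emb (ev [::]) = 0.
Proof.
have -> : ev [::] = (fun g => 0 * (fun=> 0) g) :> (G -> R[i]).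
  by apply/funext => g; rewrite /ev big_nil mul0r.
by rewrite full_embZ ?scale0r //; exact: Cc0.
Qed.

Lemma emb_ev (B : TO -> H) l : (forall a b, B (a + b) = B a + B b) ->
  (forall k a, B (k *: a) = k *: B a) -> lgood l ->
  B (emb (ev l)) = \sum_(t <- l) t.1 *: B (emb (chi R t.2.1 t.2.2)).
Proof.
move=> BD BZ; elim: l => [|t l IH] gl.
  by rewrite emb_nil -(scale0r (0 : TO)) BZ scale0r big_nil.
have [[dq dp qp] gl'] := (lgood_cons t l).1 gl.
have Ct := Cc_chi R dq dp qp; have Cl := ev_Cc gl'.
have -> : ev (t :: l) = (fun g => t.1 * chi R t.2.1 t.2.2 g) \+ ev l.
  by apply/funext => g; rewrite ev_cons.
by rewrite full_embD // ?full_embZ // ?BD ?BZ ?big_cons ?IH //; exact: CcZ.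
Qed.

Variable pi : TO -> bop H.
Hypothesis pirep : representation pi.
Local Notation K q p := (pi (emb (chi R q p))).

Lemma K_adj q p : good (q, p) -> adj (K q p) = K p q.
Proof.
move=> [/= dq dp qp]; rewrite -(rep_star pirep) -full_emb_star; last exact: Cc_chi.
by rewrite ginvol_chi.
Qed.

Lemma K_mul q p p' r x : good (q, p) -> good (p', r) ->
  K q p (K p' r x) = pi (emb (gconv (chi R q p) (chi R p' r))) x.
Proof.
by move=> [/= dq dp qp] [/= dp' dr pr]; rewrite full_embM ?(repM pirep) //; exact: Cc_chi.
Qed.

Lemma K_mul_ext q p d r x : directed q -> directed p -> directed d -> directed r ->
  pt q = pt p -> pt p = po d -> pt d = pt r ->
  K q p (K (pmul p d) r x) = K (pmul q d) r x.
Proof.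
move=> dq dp dd dr qp pd dre; rewrite K_mul ?chi_mul_ext //; split=> //=.
  exact: directed_pmul.
by rewrite pt_pmul.
Qed.

Lemma K_mulE q p r x : directed q -> directed p -> directed r ->
  pt q = pt p -> pt p = pt r -> K q p (K p r x) = K q r x.
Proof.
move=> dq dp dr qp pr; have := @K_mul_ext q p (path0 (pt p)) r x.
by rewrite pmulp0 [pmul q _](_ : _ = q); [apply|rewrite -qp pmulp0].
Qed.

Lemma K_orth q p p' r x : good (q, p) -> good (p', r) ->
  ~ (VL p [::] p' \/ VL p' [::] p) -> K q p (K p' r x) = 0.
Proof.
move=> gqp gpr npp; rewrite K_mul //; have [/= dp' dr pr] := gpr.
rewrite chi_mul_orth //.
have -> : (fun=> 0) = (fun g => 0 * (fun=> 0) g) :> (G -> R[i]).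
  by apply/funext => g; rewrite mul0r.
by rewrite full_embZ ?(repZ pirep) ?scale0r //; exact: Cc0.
Qed.

Local Notation P u := (K (path0 u) (path0 u)).
Local Notation S e := (K (path1 e) (path0 (et e))).

Lemma family_S (e : pedge E) : (family_of pi).1 e = S (val e).
Proof. by rewrite /= slice_chi. Qed.

Lemma family_P u : (family_of pi).2 u = P u.
Proof. by rewrite /= slice_chi. Qed.

Lemma good_S (e : edge E) : dpos e -> good (path1 e, path0 (et e)).
Proof. by move=> de; split=> //; rewrite directed1. Qed.

Lemma K_proj p : directed p -> projection (K p p).
Proof. by move=> dp; split=> [x|]; [exact: K_mulE|rewrite K_adj]. Qed.

Lemma P_K q p x : directed q -> directed p -> pt q = pt p -> P (po q) (K q p x) = K q p x.
Proof.
by move=> dq dp qp; have := @K_mul_ext (path0 (po q)) (path0 (po q)) q p x; rewrite pmul0p; apply.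
Qed.

Lemma P_orth_rep u v x : u <> v -> P u (P v x) = 0.
Proof.
by move=> uv; apply: K_orth => // -[[uv' _]|[vu _]]; apply: uv.
Qed.

Lemma SadjSE (e : edge E) x : dpos e -> S e (adj (S e) x) = K (path1 e) (path1 e) x.
Proof.
move=> de; rewrite K_adj; last exact: good_S.
by rewrite K_mulE // ?directed1.
Qed.

(** The vectors on which condition (iii) holds. They form a closed subspace that contains all
    [pi a x]; nondegeneracy makes it the whole space. *)
Definition psummable x := forall e : R, 0 < e -> exists F0 : {fset vertex E},
  forall F : {fset vertex E}, (F0 `<=` F)%fset ->
    rnorm (\sum_(u <- F) P u x - x) <= e.

Lemma psum_contr (F : {fset vertex E}) x : rnorm (\sum_(u <- F) P u x) <= rnorm x.
Proof.
apply: (@psum_le _ _ _ [set: vertex E] (fun u => P u)) => // [u _|u v _ _].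
  exact: K_proj.
by move=> uv y; exact: P_orth_rep.
Qed.

Lemma psummable_comb k x y : psummable x -> psummable y -> psummable (k *: x + y).
Proof.
move=> hx hy e e0; pose c := 1 + rabs k; have c0 : 0 < c by rewrite ltr_pwDl ?rabs_ge0.
have ec : 0 < e / c by rewrite divr_gt0.
have [F1 F1P] := hx _ ec; have [F2 F2P] := hy _ ec; exists (F1 `|` F2)%fset => F FF.
have h1 := F1P F (fsubset_trans (fsubsetUl _ _) FF).
have h2 := F2P F (fsubset_trans (fsubsetUr _ _) FF).
have -> : \sum_(u <- F) P u (k *: x + y) - (k *: x + y) =
    k *: (\sum_(u <- F) P u x - x) + (\sum_(u <- F) P u y - y).
  rewrite scalerBr addrACA -opprD; congr (_ - _).
  by rewrite scaler_sumr -big_split; apply: eq_bigr => u _; rewrite bopD bopZ.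
apply: le_trans (rnormD _ _) _; rewrite rnormZ.
have : rabs k * rnorm (\sum_(u <- F) P u x - x) <= rabs k * (e / c) by rewrite ler_wpM2l ?rabs_ge0.
have : e / c * c = e by rewrite divfK // gt_eqF.
rewrite /c mulrDr mulr1 (mulrC _ (rabs k)); lra.
Qed.

Lemma psummable0 : psummable 0.
Proof.
move=> e e0; exists fset0 => F _; rewrite subr0 big1 ?rnorm0 ?ltW // => u _.
exact: bop0.
Qed.

Lemma psummable_lim x : (forall e : R, 0 < e -> exists2 y, psummable y & rnorm (x - y) <= e) ->
  psummable x.
Proof.
move=> h e e0; have e3 : 0 < e / 3 by rewrite divr_gt0.
have [y hy xy] := h _ e3; have [F0 F0P] := hy _ e3; exists F0 => F /F0P h1.
have h2 := psum_contr F (x - y).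
have -> : \sum_(u <- F) P u x - x = \sum_(u <- F) P u (x - y) +
    ((\sum_(u <- F) P u y - y) - (x - y)).
  have -> : \sum_(u <- F) P u (x - y) = \sum_(u <- F) P u x - \sum_(u <- F) P u y.
    by rewrite -sumrB; apply: eq_bigr => u _; rewrite bopB.
  by rewrite opprB !subrKA.
apply: le_trans (rnormD _ _) _.
have := rnormD (\sum_(u <- F) P u y - y) (- (x - y)); rewrite rnormN; lra.
Qed.

(** One vertex suffices: [P (po q)] fixes the range of [K q p], and every other vertex projection
    kills it. *)
Lemma psummable_K q p x : good (q, p) -> psummable (K q p x).
Proof.
move=> [/= dq dp qp] e e0; exists [fset po q]%fset => F; rewrite fsub1set => qF.
rewrite (bigD1_seq (po q)) ?fset_uniq //= P_K // big1 ?addr0 ?subrr ?rnorm0 ?ltW //.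
by move=> u /eqP uq; rewrite -(P_K x dq dp qp) P_orth_rep.
Qed.

Lemma psummable_sum (I : Type) (s : seq I) (f : I -> H) :
  (forall i, psummable (f i)) -> psummable (\sum_(i <- s) f i).
Proof.
move=> fs; elim: s => [|i s IH]; first by rewrite big_nil; exact: psummable0.
by rewrite big_cons -[f i]scale1r; exact: psummable_comb.
Qed.

Lemma psummable_rep a x : psummable (pi a x).
Proof.
apply: psummable_lim => e e0.
have c0 : 0 < 2 * rnorm x + 1 by rewrite ltr_wpDl // mulr_ge0 ?rnorm_ge0.
have [l gl al] := ev_dense a (divr_gt0 e0 c0); exists (pi (emb (ev l)) x).
  rewrite (emb_ev (B := fun a => pi a x)) //; last 2 first.
  - by move=> b b'; rewrite (repD pirep).
  - by move=> k b; rewrite (repZ pirep).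
  (* Terms are set to zero outside [l], so that every summand is zero or comes from a [good]
     pair. *)
  rewrite big_seq_cond (eq_bigr (fun t => if t \in l then t.1 *: K t.2.1 t.2.2 x else 0)); last first.
    by move=> t /andP[-> _].
  rewrite -big_seq_cond; apply: psummable_sum => t; case: ifP => [tl|_]; last exact: psummable0.
  rewrite -[_ *: _]addr0; apply: psummable_comb psummable0.
  by apply: psummable_K; case: t tl => z [q p] /gl.
have -> : pi a x - pi (emb (ev l)) x = pi (a - emb (ev l)) x.
  by rewrite (repD pirep) -[- emb _]scaleN1r (repZ pirep) scaleN1r.
apply: le_trans (rep_bounded pirep _ _) _.
apply: (@le_trans _ _ (2 * (e / (2 * rnorm x + 1)) * rnorm x)).
  by rewrite ler_wpM2r ?rnorm_ge0 // ler_wpM2l.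
rewrite (mulrC 2) -!mulrA -[leRHS]mulr1 ler_wpM2l ?(ltW e0) //.
by rewrite mulrC ler_pdivrMr // mul1r lerDl.
Qed.

Hypothesis nd : nondegenerate_rep pi.

Lemma psummable_all x : psummable x.
Proof.
apply: psummable_lim => e e0.
have /closure_rnormP/(_ _ e0)[y [s ->] xs] : closure [set y : H | exists s : seq (TO * H),
    y = \sum_(ax <- s) pi ax.1 ax.2] x by rewrite nd.
by exists (\sum_(ax <- s) pi ax.1 ax.2); [apply: psummable_sum => ax; exact: psummable_rep|exact: ltW].
Qed.

Lemma family_of_toeplitz : toeplitz_family (family_of pi).
Proof.
split.
- move=> e x; have de := valP e; rewrite family_S K_adj; last exact: good_S.
  by rewrite !K_mulE // ?directed1.
- by move=> u; rewrite family_P; exact: K_proj.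
- by move=> u v uv x; rewrite !family_P; exact: P_orth_rep.
- move=> x U /nbhs_rnormP[e e0 eU]; have e2 : 0 < e / 2 by rewrite divr_gt0.
  have [F0 F0P] := psummable_all x e2; exists F0 => // F F0F _; apply: eU.
  rewrite rnormB (eq_bigr (fun u => P u x)); last by move=> u _; rewrite family_P.
  have := F0P F F0F; rewrite /=; lra.
- move=> e x; have de := valP e; rewrite family_S family_P K_adj; last exact: good_S.
  by rewrite K_mulE // ?directed1.
(* Condition (v): different edges are divergent paths, so the projections [S_f S_f^*] are
   orthogonal, and they lie below [P u]. *)
- move=> u.
  have [f Df|f f' Df Df' ff' x|//|f Df x|Q QS QP] :=
    @sot_orth_proj _ H _ [set f : pedge E | eo (val f) = u]
      (fun f => K (path1 (val f)) (path1 (val f))) _ _ (P u).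
  + by apply: K_proj; rewrite directed1; exact: valP.
  + have df : directed (path1 (val f)) by rewrite directed1; exact: valP.
    have df' : directed (path1 (val f')) by rewrite directed1; exact: valP.
    apply: K_orth => // -[] /VL_prefix[] // _.
      by rewrite /= andbT => /eqP h; apply: ff'; exact: val_inj.
    by rewrite /= andbT => /eqP h; apply: ff'; exact: val_inj.
  + exact: K_proj.
  + have df : directed (path1 (val f)) by rewrite directed1; exact: valP.
    have uE : u = po (path1 (val f)) by rewrite -[LHS]Df.
    by rewrite uE P_K.
  exists Q; last by rewrite family_P.
  rewrite [X in sot_sum _ X](_ : _ = fun f x => K (path1 (val f)) (path1 (val f)) x) //.
  apply/funext => f; apply/funext => x; rewrite family_S SadjSE //.
  exact: valP.
Qed.

(** Induction on [q] identifies the value at its slice with the path operator; [S_q S_p^*] follows.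
    This is why the family determines the representation. *)
Lemma rep_chi q p : good (q, p) -> pi (emb (chi R q p)) = mx_op (family_of pi) q p.
Proof.
have tf := family_of_toeplitz.
have W r : directed r -> K r (path0 (pt r)) = path_op (family_of pi) r.
  elim/directed_ind => [v|e r' de dr er IH]; apply: bop_ext => x.
    by rewrite path_op0 /proj_at family_P.
  have pr : pt (path1 e) = po r' by [].
  have Sd := good_S de; have [_ _ e0] := Sd.
  rewrite path_op_cons // -IH; have [e' eE ->] := isom_atP (family_of pi) de.
  rewrite family_S eE pt_pmul //.
  have := @K_mul_ext (path1 e) (path0 (et e)) r' (path0 (pt r')) x.
  by rewrite er pmul0p => -> //; rewrite ?directed1.
move=> [/= dq dp qp]; apply: bop_ext => x.
have gp : good (p, path0 (pt p)) by split.
by rewrite /mx_op bcompE -!W // K_adj // qp K_mulE.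
Qed.

End Forward.

(** * Injectivity, and from families to representations *)

Section Correspondence.
Variables (R : realType) (E : digraph) (H : hilbert R).
Local Notation G := (toeplitz_groupoid E).
Variable TO : full_cstar R G.
Implicit Types (p q r d : gpath E) (g h : G) (x y : H) (a b c : TO).
Local Notation emb := (full_emb TO).
Local Notation coef := (R[i] * (gpath E * gpath E))%type.
Implicit Types (l m : seq coef).

Lemma additiveB (B : TO -> H) a b : (forall k a b, B (k *: a + b) = k *: B a + B b) ->
  B (a - b) = B a - B b.
Proof. by move=> BL; rewrite addrC -scaleN1r BL scaleN1r addrC. Qed.

(** Identities are tested with the vector fixed, so only maps from the algebra to [H] occur, and [K]
    may depend on that vector. *)
Lemma dense_eq0 (B : TO -> H) (K : R) : (forall k a b, B (k *: a + b) = k *: B a + B b) ->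
  (forall a, rnorm (B a) <= K * rnorm a) -> (forall l, lgood l -> B (emb (ev l)) = 0) ->
  forall a, B a = 0.
Proof.
move=> BL BK Bl a; apply/rnorm0_eq0/ler_addgt0Pr => e e0; rewrite add0r.
have c0 : 0 < `|K| + 1 by rewrite ltr_wpDl.
have [l gl al] := ev_dense a (divr_gt0 e0 c0).
rewrite -[B a]subr0 -(Bl l gl) -additiveB // (le_trans (BK _)) //.
rewrite (@le_trans _ _ (`|K| * rnorm (a - emb (ev l)))) //.
  by rewrite ler_wpM2r ?rnorm_ge0 ?ler_norm.
rewrite (@le_trans _ _ (`|K| * (e / (`|K| + 1)))) // ?ler_wpM2l //.
rewrite mulrCA ler_piMr ?(ltW e0) // ler_pdivrMr // mul1r lerDl //.
Qed.

Lemma family_of_inj (pi pi' : TO -> bop H) : representation pi -> nondegenerate_rep pi ->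
  representation pi' -> nondegenerate_rep pi' ->
  family_of pi = family_of pi' -> pi = pi'.
Proof.
move=> rep nd rep' nd' fam; apply/funext => a; apply: bop_ext => x; apply/subr0_eq.
have lin (r : TO -> bop H) : representation r -> forall k b c, r (k *: b + c) x = k *: r b x + r c x.
  by move=> rr k b c; rewrite (repD rr) (repZ rr).
apply: (@dense_eq0 (fun a => pi a x - pi' a x) (4 * rnorm x)) => [k b c|b|l gl].
- by rewrite !lin // scalerBr addrACA -opprD.
- have h1 := rep_bounded rep b x; have h2 := rep_bounded rep' b x.
  by apply: le_trans (rnormD _ _) _; rewrite rnormN; lra.
- have evE (r : TO -> bop H) : representation r ->
      r (emb (ev l)) x = \sum_(t <- l) t.1 *: r (emb (chi R t.2.1 t.2.2)) x.
    move=> rr; apply: (emb_ev (B := fun a => r a x)) => // [b c|k b].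
      by rewrite (repD rr).
    by rewrite (repZ rr).
  rewrite !evE //.
  apply/eqP; rewrite subr_eq0; apply/eqP; rewrite big_seq [RHS]big_seq; apply: eq_bigr => t tl.
  have gt : good (t.2.1, t.2.2) by case: t tl => z [q p] /gl.
  by rewrite (rep_chi rep nd gt) (rep_chi rep' nd' gt) fam.
Qed.

Section Construction.
Variable SP : (pedge E -> bop H) * (vertex E -> bop H).
Hypothesis tf : toeplitz_family SP.
Local Notation lsum := (lsum SP).

Lemma emb_ev_cat l m k : lgood l -> lgood m ->
  emb (ev (lscale k l ++ m)) = k *: emb (ev l) + emb (ev m).
Proof.
move=> gl gm; have Cl := ev_Cc gl; have Cm := ev_Cc gm.
have -> : ev (lscale k l ++ m) = (fun g => ev m g + k * ev l g).
  by apply/funext => g; rewrite ev_cat ev_lscale addrC.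
by rewrite full_emb_comb // addrC.
Qed.

Lemma lsum_comb k l m x : lsum (lscale k l ++ m) x = k *: lsum l x + lsum m x.
Proof. by rewrite lsum_cat lsum_lscale. Qed.

(** [pi0] is one of the representations over which the full norm is the supremum. *)
Lemma lsum_full l : lgood l -> obound (lsum l) (rnorm (emb (ev l))).
Proof.
move=> gl x; have := full_norm_ub TO (ev_Cc gl) (pi0_rep tf) x.
by rewrite (pi0_eq tf (apx_ev SP gl)) -!rnormE -rcM lecR rhoE.
Qed.

Lemma lsum_fullB l m : lgood l -> lgood m ->
  obound (fun x => lsum l x - lsum m x) (rnorm (emb (ev l) - emb (ev m))).
Proof.
move=> gl gm x; have := lsum_full (lgood_cat (lscale_good (k := -1) gm) gl) x.
by rewrite lsum_comb emb_ev_cat // !scaleN1r addrC [- _ + _]addrC.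
Qed.

(** A single estimate determines [pi]: [a = emb (ev l)] gives the values on step functions, the
    empty list gives [|pi a| <= |a|], and density gives the algebraic rules. *)
Lemma ext_exists : exists pi : TO -> bop H, forall a l, lgood l ->
  obound (fun x => pi a x - lsum l x) (rnorm (a - emb (ev l))).
Proof.
suff /choice[pi piP] : forall a, exists T : bop H, forall l, lgood l ->
    obound (fun x => T x - lsum l x) (rnorm (a - emb (ev l))) by exists pi.
move=> a.
pose app l (e : R) := lgood l /\ rnorm (a - emb (ev l)) <= e.
have [||l m e d [gl le] [gm me] x|T TP] := @limit_operator _ H _ app (rho SP) 1.
- exact: ler01.
- by move=> e /(ev_dense a)[l gl al]; exists l.
- rewrite !rhoE; apply: le_trans (lsum_fullB gl gm x) _; rewrite mul1r.
  rewrite ler_wpM2r ?rnorm_ge0 //.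
  have := rnorm_dist (emb (ev l)) a (emb (ev m)); rewrite (rnormB (emb (ev l)) a); lra.
exists T => l gl x; rewrite -rhoE -[rnorm (a - _)]mul1r.
by apply: TP; split.
Qed.

Variable pi : TO -> bop H.
Hypothesis piP : forall a l, lgood l ->
  obound (fun x => pi a x - lsum l x) (rnorm (a - emb (ev l))).

Lemma ext_ev l x : lgood l -> pi (emb (ev l)) x = lsum l x.
Proof.
move=> gl; apply/subr0_eq/rnorm0_eq0; have := piP (emb (ev l)) gl x.
by rewrite subrr rnorm0 mul0r.
Qed.

Lemma ext_lin k a b x : pi (k *: a + b) x = k *: pi a x + pi b x.
Proof.
apply/subr0_eq; pose K := 2 * (1 + rabs k).
have c0 : 0 <= rabs k by exact: rabs_ge0.
apply: (obound_eq0 (f := fun x => pi (k *: a + b) x - (k *: pi a x + pi b x)) (K := K)) => e e0 {}x.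
have [l gl al] := ev_dense a e0; have [m gm bm] := ev_dense b e0.
have glm := lgood_cat (lscale_good (k := k) gl) gm.
have h1 : rnorm (pi (k *: a + b) x - lsum (lscale k l ++ m) x) <= (rabs k * e + e) * rnorm x.
  apply: le_trans (piP _ glm x) _; rewrite ler_wpM2r ?rnorm_ge0 //.
  rewrite emb_ev_cat // opprD addrACA -scalerBr (le_trans (rnormD _ _)) // rnormZ.
  by rewrite lerD // ler_wpM2l.
have h2 : rnorm (k *: (pi a x - lsum l x)) <= rabs k * (e * rnorm x).
  rewrite rnormZ ler_wpM2l // (le_trans (piP _ gl x)) //.
  by rewrite ler_wpM2r ?rnorm_ge0.
have h3 : rnorm (pi b x - lsum m x) <= e * rnorm x.
  by rewrite (le_trans (piP _ gm x)) // ler_wpM2r ?rnorm_ge0.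
have -> : pi (k *: a + b) x - (k *: pi a x + pi b x) =
    (pi (k *: a + b) x - lsum (lscale k l ++ m) x) -
    (k *: (pi a x - lsum l x) + (pi b x - lsum m x)).
  by rewrite lsum_comb scalerBr [X in _ = _ - X]addrACA -opprD opprB subrKA.
apply: le_trans (rnormD _ _) _; rewrite rnormN.
have := rnormD (k *: (pi a x - lsum l x)) (pi b x - lsum m x).
rewrite /K !mulrDl mulrDr; move: h1; rewrite !mulrDl; move: h2; rewrite mulr1; lra.
Qed.

Lemma ext_bound a : obound (pi a) (rnorm a).
Proof.
have g0 : lgood ([::] : seq coef) by [].
move=> x; have := piP a g0 x; rewrite /lsum big_nil subr0.
by rewrite emb_nil subr0.
Qed.

Lemma ext_mul a b x : pi (cmul a b) x = pi a (pi b x).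
Proof.
(* Density is used twice, first in [b] for arbitrary [a], then in [a] with [b] a step function. *)
apply/subr0_eq; apply: (@dense_eq0 (fun b => pi (cmul a b) x - pi a (pi b x)) (2 * (rnorm a * rnorm x))).
- move=> k c d; rewrite cmulDr cmulZr !ext_lin bopD bopZ.
  by rewrite scalerBr [RHS]addrACA -opprD.
- move=> c; apply: le_trans (rnormD _ _) _; rewrite rnormN.
  have h1 : rnorm (pi (cmul a c) x) <= rnorm a * rnorm c * rnorm x.
    by apply: le_trans (ext_bound _ _) _; rewrite ler_wpM2r ?rnorm_ge0 ?cnormM_r.
  have h2 : rnorm (pi a (pi c x)) <= rnorm a * (rnorm c * rnorm x).
    by apply: le_trans (ext_bound _ _) _; rewrite ler_wpM2l ?rnorm_ge0 ?ext_bound.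
  move: h1 h2; rewrite -!mulrA (mulrC (rnorm c)); lra.
move=> l gl; move: a; apply: (@dense_eq0 (fun a => pi (cmul a (emb (ev l))) x - pi a (pi (emb (ev l)) x))
  (rnorm (emb (ev l)) * rnorm x + rnorm (pi (emb (ev l)) x))).
- move=> k c d; rewrite cmulDl cmulZl !ext_lin.
  by rewrite scalerBr [RHS]addrACA -opprD.
- move=> c; apply: le_trans (rnormD _ _) _; rewrite rnormN mulrDl lerD //.
    apply: le_trans (ext_bound _ _) _; rewrite -[leRHS]mulrC mulrA ler_wpM2r ?rnorm_ge0 //.
    exact: cnormM_r.
  by rewrite mulrC ext_bound.
move=> m gm; have [n [gn nE nS]] := lmul_exists gm gl.
rewrite -full_embM; [|exact: ev_Cc..].
have <- : ev n = gconv (ev m) (ev l) by apply/funext.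
by rewrite !ext_ev // nS // subrr.
Qed.

Lemma ext_star a : pi (cstar a) = adj (pi a).
Proof.
suff h c x : adj (pi (cstar c)) x - pi c x = 0.
  rewrite -{2}[a]cstarK; apply: bop_ext => x; apply/esym/subr0_eq; exact: h.
apply: (@dense_eq0 (fun c => adj (pi (cstar c)) x - pi c x) (2 * rnorm x)).
- move=> k b d; rewrite ext_lin.
  have -> : adj (pi (cstar (k *: b + d))) x = k *: adj (pi (cstar b)) x + adj (pi (cstar d)) x.
    apply: dot_inj => z; rewrite dotDr dotZr -!adjP cstarD cstarZ ext_lin dotDl dotZl.
    by [].
  by rewrite scalerBr [RHS]addrACA -opprD.
- move=> b; have h1 : rnorm (adj (pi (cstar b)) x) <= rnorm b * rnorm x.
    apply: (obound_adj (S := pi (cstar b))); first exact: rnorm_ge0.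
      by move=> y z; rewrite adjP.
    by rewrite -(cstar_isom b); exact: ext_bound.
  have := ext_bound b x; have := rnormD (adj (pi (cstar b)) x) (- pi b x).
  rewrite rnormN; lra.
move=> l gl; rewrite -full_emb_star; last exact: ev_Cc.
have -> : ginvol (ev l) = ev (lstar l) by apply/funext => g; rewrite ev_lstar.
apply/eqP; rewrite subr_eq0; apply/eqP; apply: dot_inj => z.
rewrite -adjP !ext_ev //; last exact: lstar_good.
by rewrite dotC -lsum_lstar -dotC.
Qed.

Lemma ext_rep : representation pi.
Proof.
split.
- by move=> a b x; rewrite -[a]scale1r ext_lin !scale1r.
- move=> k a x; rewrite -[_ *: a]addr0 ext_lin.
  have -> : pi 0 x = 0 by apply: rnorm0_eq0; have := ext_bound 0 x; rewrite rnorm0 mul0r.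
  by rewrite addr0.
- exact: ext_mul.
- exact: ext_star.
Qed.

Lemma ext_chi q p x : good (q, p) -> pi (emb (chi R q p)) x = mx_op SP q p x.
Proof.
move=> gqp; have gl : lgood [:: (1 : R[i], (q, p))] by move=> t; rewrite inE => /eqP ->.
have evE : ev [:: (1 : R[i], (q, p))] = chi R q p.
  by apply/funext => g; rewrite /ev big_seq1 mul1r.
by rewrite -evE ext_ev // /lsum big_seq1 scale1r.
Qed.

(** The vertex projections inside the path operators are absorbed by [adj P = P], [P P = P] and
    [S_e P_(t(e)) = S_e]. *)
Lemma ext_family : family_of pi = SP.
Proof.
rewrite [RHS]surjective_pairing; congr pair; apply/funext => e; apply: bop_ext => x.
  have de := valP e; rewrite slice_chi ext_chi; last exact: good_S.
  have [_ PA] := tf_proj tf (et (val e)).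
  rewrite /mx_op bcompE path_op0 /proj_at PA.
  have -> : path1 (val e) = pmul (path1 (val e)) (path0 (et (val e))) by rewrite [RHS]pmulp0.
  rewrite path_op_cons // path_op0 isom_atE /proj_at.
  have SPE y : SP.1 e (SP.2 (et (val e)) y) = SP.1 e y.
    by have := S_P tf y de; rewrite isom_atE.
  by rewrite !SPE.
rewrite slice_chi ext_chi // /mx_op bcompE path_op0 /proj_at.
by have [PP ->] := tf_proj tf e.
Qed.

(** By condition (iii) each [x] is a limit of finite sums of [P_u x], and [P_u] is the image of a
    [chi]. *)
Lemma ext_nondegenerate : nondegenerate_rep pi.
Proof.
apply/seteqP; split=> // x _; apply/closure_rnormP => e e0.
have sumP : sot_sum [set: vertex E] (fun u x => SP.2 u x) idfun := tf_sum tf.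
have [|F0 _ F0P] := sumP x [set y | rnorm (x - y) < e].
  by apply/nbhs_rnormP; exists e.
exists (\sum_(u <- F0) SP.2 u x); last by apply: F0P.
exists [seq (emb (chi R (path0 u) (path0 u)), x) | u <- F0].
rewrite big_map; apply: eq_bigr => u _; rewrite ext_chi // /mx_op bcompE path_op0 /proj_at.
by have [PP ->] := tf_proj tf u.
Qed.

End Construction.
End Correspondence.

Theorem theorem2p19 (R : realType) (E : digraph)
    (TO : full_cstar R (toeplitz_groupoid E)) (H : hilbert R) :
  set_bij [set pi : TO -> bop H | representation pi /\ nondegenerate_rep pi]
          [set SP | toeplitz_family SP]
          (@family_of R E H TO).
Proof.
split.
- by move=> pi [rep nd]; exact: family_of_toeplitz.
- by move=> pi pi' /set_mem[rep nd] /set_mem[rep' nd']; exact: family_of_inj.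
- move=> SP tf; have [pi piP] := ext_exists TO tf.
  have fam : family_of pi = SP by exact: (ext_family tf piP).
  by exists pi => //; split; [exact: (ext_rep tf piP)|exact: (ext_nondegenerate tf piP)].
Qed.
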